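(* For any closed manifold $M$, one has $\Delta(M,1)\le N$ if and only if $M$ can be smoothly embedded into the sphere $S^{N-1}$. In particular, for $k=2^j$ (a power of $2$), $\Delta(\mathbf{RP}^k,1)=2k+1$.
   Context: Let $M$ be a smooth manifold. A smooth embedding $M\to\mathbf{R}^N$ is called $1$-neighborly if for any point of $M$ there is an affine hyperplane in $\mathbf{R}^N$ supporting (the image of) $M$ (i.e. $M$ lies in one of the two closed half-spaces it bounds) and touching it at exactly this point (i.e. the hyperplane meets $M$ only at this point). A smooth embedding $M\to\mathbf{R}^N$ is called stably $1$-neighborly if it is $1$-neighborly and any other embedding sufficiently close to it in the $C^2$-topology is also $1$-neighborly. $\Delta(M,1)$ denotes the minimal dimension $N$ of a Euclidean space such that there exists a stably $1$-neighborly embedding $M\to\mathbf{R}^N$. $\mathbf{RP}^k$ is the $k$-dimensional real projective space.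
   Formalization: The formula for projective spaces is stated for k = 2^j with j ≥ 1; at k = 1 it is false, since RP^1 is a circle, embeds in S^1, and so has Δ(RP^1,1) ≤ 2 rather than 3. *)

(* Defs.v *)
From HB Require Import structures.
From mathcomp Require Import all_boot all_order all_algebra generic_quotient.
From mathcomp Require Import all_classical all_reals topology normedtype landau derive.
From mathcomp Require Import ring lra.

Set Implicit Arguments. Unset Strict Implicit. Unset Printing Implicit Defensive.
Import Order.TTheory GRing.Theory Num.Theory.
Import numFieldNormedType.Exports.
Local Open Scope classical_set_scope.
Local Open Scope ring_scope.

(* [U] is meant to be open.  The derivatives of order k+1 are the directional
   derivatives, in all directions, of those of order k. *)
Fixpoint Ck_on (R : realType) (V W : normedModType R) (k : nat) (U : set V)
    (f : V -> W) : Prop :=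
  if k is k'.+1 then
    (forall x, U x -> differentiable f x) /\ (forall v, Ck_on k' U ('D_v f))
  else forall x, U x -> {for x, continuous f}.

Definition smooth_on (R : realType) (V W : normedModType R) (U : set V)
  (f : V -> W) : Prop := forall k, Ck_on k U f.

Section SmoothCalculus.
Context {R : realType}.
Implicit Types V W : normedModType R.

Let differentiable_ext V W (f g : V -> W) x :
  {near x, f =1 g} -> differentiable f x -> differentiable g x.
Proof.
move=> fg df.
have fgx : f x = g x by exact: nbhs_singleton fg.
pose d : {linear V -> W} := 'd f x.
have cd : continuous d by exact: diff_continuous.
have fg0 : \forall h \near (0 : V), f (h + x) = g (h + x).
  have : (fun h : V => h + x) @ (0 : V) --> x.
    rewrite -[X in _ --> X]add0r; apply: cvgD; [exact: cvg_id|exact: cvg_cst].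
  by move=> /(_ _ fg).
have gE : g \o shift x = cst (g x) + d +o_ (0 : V) id.
  have /eqaddoP fE := diff_locally df.
  apply/eqaddoP => e e0; have {}fE := fE e e0.
  apply: filterS2 fg0 fE => h fgh.
  by rewrite !fctE /= fgx fgh.
apply/diff_locallyP; rewrite (diff_unique cd gE); split; [exact: cd|exact: gE].
Qed.

Let derive_near V W (U : set V) (f g : V -> W) v : open U ->
  (forall x, U x -> f x = g x) -> forall x, U x -> 'D_v f x = 'D_v g x.
Proof.
move=> oU fg x Ux; apply: near_eq_derive.
by apply: filterS (open_nbhs_nbhs (conj oU Ux)) => y /fg.
Qed.

Lemma Ck_on_ext V W k (U : set V) (f g : V -> W) : open U ->
  (forall x, U x -> f x = g x) -> Ck_on k U f -> Ck_on k U g.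
Proof.
move=> oU; elim: k f g => [|k IH] f g fg /=.
  move=> cf x Ux; have fgx : {near x, f =1 g}.
    by apply: filterS (open_nbhs_nbhs (conj oU Ux)) => y /fg.
  rewrite /prop_for /continuous_at -(fg _ Ux).
  exact: cvg_trans (near_eq_cvg fgx) (cf x Ux).
move=> [df Df]; split.
  move=> x Ux; apply: differentiable_ext (df _ Ux).
  by apply: filterS (open_nbhs_nbhs (conj oU Ux)) => y /fg.
by move=> v; apply: IH (Df v) => x; exact: derive_near.
Qed.

Lemma Ck_onW V W k (U : set V) (f : V -> W) : Ck_on k.+1 U f -> Ck_on k U f.
Proof.
elim: k f => [|k IH] f [df Df] /=.
  by move=> x /df; exact: differentiable_continuous.
by split=> // v; exact: IH.
Qed.

Lemma smooth_cst V W (U : set V) (a : W) : smooth_on U (fun=> a).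
Proof.
move=> k; elim: k a => [|k IH] a /=; first by move=> x _; exact: cst_continuous.
split=> [x _|v]; first exact: differentiable_cst.
rewrite (_ : 'D_v _ = fun=> 0) //.
by apply/funext => x; rewrite derive_cst.
Qed.

Lemma Ck_onD V W k (U : set V) (f g : V -> W) : open U ->
  Ck_on k U f -> Ck_on k U g -> Ck_on k U (fun x => f x + g x).
Proof.
move=> oU; elim: k f g => [|k IH] f g /= => [cf cg x Ux|[df Df] [dg Dg]].
  by apply: continuousD; [exact: cf|exact: cg].
split=> [x Ux|v]; first by apply: differentiableD; [exact: df|exact: dg].
apply: (@Ck_on_ext _ _ _ _ (fun x => 'D_v f x + 'D_v g x)) => //; last exact: IH.
move=> x Ux; rewrite -deriveD//; apply: diff_derivable; [exact: df|exact: dg].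
Qed.

Lemma Ck_onM V k (U : set V) (f g : V -> R) : open U ->
  Ck_on k U f -> Ck_on k U g -> Ck_on k U (fun x => f x * g x).
Proof.
move=> oU; elim: k f g => [|k IH] f g => [cf cg x Ux|Cf Cg].
  by apply: continuousM; [exact: cf|exact: cg].
have [df Df] := Cf; have [dg Dg] := Cg.
split=> [x Ux|v]; first by apply: differentiableM; [exact: df|exact: dg].
apply: (@Ck_on_ext _ _ _ _ (fun x => f x * 'D_v g x + g x * 'D_v f x)) => //.
  move=> x Ux; rewrite deriveM//; apply: diff_derivable; [exact: df|exact: dg].
by apply: Ck_onD => //; apply: IH; [exact: Ck_onW|exact: Dg|exact: Ck_onW|exact: Df].
Qed.

Lemma Ck_onV V k (U : set V) (f : V -> R) : open U ->
  (forall x, U x -> f x != 0) -> Ck_on k U f -> Ck_on k U (fun x => (f x)^-1).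
Proof.
move=> oU f0; elim: k => [|k IH] => [cf x Ux|Cf].
  by apply: (continuousV (f0 _ Ux)); exact: cf.
have [df Df] := Cf; have Vf := IH (Ck_onW Cf).
split=> [x Ux|v]; first by apply: differentiableV; [exact: df|exact: f0].
apply: (@Ck_on_ext _ _ _ _ (fun x => (-1 * ((f x)^-1 * (f x)^-1)) * 'D_v f x)) => //.
  move=> x Ux; rewrite deriveV; last 2 first.
  - exact: f0.
  - by apply: diff_derivable; exact: df.
  by rewrite mulN1r -invfM -expr2.
apply: Ck_onM => //; last exact: Df.
by apply: Ck_onM => //; [exact: smooth_cst|exact: Ck_onM].
Qed.

Lemma smooth_coord n (U : set 'rV[R]_n) i :
  smooth_on U (fun x : 'rV[R]_n => x 0 i : R).
Proof.
case=> [|k] /=; first by move=> x _; exact: coord_continuous.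
split=> [x _|v]; first exact: differentiable_coord.
rewrite (_ : 'D_v _ = fun=> v 0 i); first exact: smooth_cst.
apply/funext => x.
have := derive_id x v; rewrite (@derive_mx _ _ _ _ (@id 'rV[R]_n)); last first.
  exact: derivable_id.
by move=> /rowP /(_ i); rewrite mxE.
Qed.

Lemma continuous_mx (T : topologicalType) m n (f : T -> 'M[R]_(m, n)) x :
  (forall i j, {for x, continuous (fun y => f y i j : R)}) ->
  {for x, continuous f}.
Proof.
move=> cf A [P nP PA]; rewrite nbhs_filterE.
have : \forall y \near x, forall i : 'I_m, forall j : 'I_n, P i j (f y i j).
  apply: filter_forall => i; apply: filter_forall => j.
  exact: cf (nP i j).
by apply: filterS => y Py; exact: PA.
Qed.

Lemma continuous_row (T : topologicalType) n (f : T -> 'rV[R]_n) x :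
  (forall i, {for x, continuous (fun y => f y 0 i : R)}) ->
  {for x, continuous f}.
Proof. by move=> cf; apply: continuous_mx => i j; rewrite ord1. Qed.

Lemma Ck_on_row V n k (U : set V) (f : V -> 'rV[R]_n) : open U ->
  (forall i, Ck_on k U (fun x => f x 0 i : R)) -> Ck_on k U f.
Proof.
move=> oU; elim: k f => [|k IH] f Cf.
  by move=> x Ux; apply: continuous_row => i; exact: Cf.
have df x : U x -> differentiable f x.
  move=> Ux; rewrite (_ : f = \sum_i (fun x => f x 0 i *: delta_mx 0 i)).
    apply: differentiable_sum => i; apply: differentiableZl.
    by have [df _] := Cf i; exact: df.
  by apply/funext => y; rewrite fct_sumE; exact: row_sum_delta.
split=> // v; apply: IH => i; have [dfi Dfi] := Cf i.
apply: (@Ck_on_ext _ _ _ _ ('D_v (fun x => f x 0 i : R))) => //; last exact: Dfi.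
move=> x Ux; rewrite [in RHS]derive_mx ?mxE//.
by apply: diff_derivable; exact: df.
Qed.

End SmoothCalculus.

Record chart (R : realType) (n : nat) (M : topologicalType) := Chart {
  chart_dom : set M;
  chart_codom : set 'rV[R]_n;
  chart_coord : M -> 'rV[R]_n;
  chart_param : 'rV[R]_n -> M;
  open_chart_dom : open chart_dom;
  open_chart_codom : open chart_codom;
  chart_coordP : forall x, chart_dom x ->
    chart_codom (chart_coord x) /\ chart_param (chart_coord x) = x;
  chart_paramP : forall y, chart_codom y ->
    chart_dom (chart_param y) /\ chart_coord (chart_param y) = y;
  chart_coord_continuous :
    forall x, chart_dom x -> {for x, continuous chart_coord};
  chart_param_continuous :
    forall y, chart_codom y -> {for y, continuous chart_param} }.

(* Second countability is not a field: only compact manifolds are considered below,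
   for which it follows from [atlas_cover].  As a [chart] contains a function
   [chart_param] to [M], an empty manifold has an empty atlas. *)
Record manifold (R : realType) (n : nat) := Manifold {
  manifold_space :> topologicalType;
  atlas : set (chart R n manifold_space);
  manifold_hausdorff : hausdorff_space manifold_space;
  atlas_cover : forall x, exists2 c, atlas c & chart_dom c x;
  atlas_compatible : forall c d, atlas c -> atlas d ->
    smooth_on (chart_codom c `&` chart_param c @^-1` chart_dom d)
      (chart_coord d \o chart_param c) }.

Section EuclideanSpace.
Variables (R : realType) (n : nat).

Program Definition id_chart : chart R n 'rV[R]_n :=
  {| chart_dom := setT; chart_codom := setT;
     chart_coord := id; chart_param := id |}.
Next Obligation. exact: openT. Qed.
Next Obligation. exact: openT. Qed.
Next Obligation. by []. Qed.
Next Obligation. by []. Qed.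
Next Obligation. by move=> x _; exact: cvg_id. Qed.
Next Obligation. by move=> x _; exact: cvg_id. Qed.

Program Definition euclidean : manifold R n :=
  {| manifold_space := 'rV[R]_n; atlas := [set id_chart] |}.
Next Obligation. exact: norm_hausdorff. Qed.
Next Obligation. by move=> x; exists id_chart. Qed.
Next Obligation.
move=> _ _ -> -> k /=; rewrite preimage_setT setIT.
by apply: Ck_on_row => [|i]; [exact: openT|exact: smooth_coord].
Qed.

End EuclideanSpace.

Definition dotv (R : realType) n (u v : 'rV[R]_n) : R := \sum_i u 0 i * v 0 i.

Section AuxiliaryLemmas.
Context {R : realType}.

Lemma inj_hausdorff (S T : topologicalType) (f : S -> T) :
  continuous f -> injective f -> hausdorff_space T -> hausdorff_space S.
Proof.
move=> cf fI hT p q pq; apply/fI/hT => A B nA nB.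
have [x [Ax Bx]] := pq _ _ (cf p _ nA) (cf q _ nB).
by exists (f x).
Qed.

Lemma smooth_sum (V : normedModType R) m (U : set V) (f : 'I_m -> V -> R) :
  open U -> (forall i, smooth_on U (f i)) ->
  smooth_on U (fun x => \sum_i f i x).
Proof.
move=> oU; elim: m f => [|m IH] f sf k.
  rewrite (_ : (fun x => _) = fun=> 0); first exact: smooth_cst.
  by apply/funext => x; rewrite big_ord0.
rewrite (_ : (fun x => _) = fun x => f ord0 x + \sum_i f (lift ord0 i) x).
  by apply: Ck_onD => //; [exact: sf|apply: IH => i; exact: sf].
by apply/funext => x; rewrite big_ord_recl.
Qed.

Lemma Ck_onS (V W : normedModType R) k (U : set V) (f : V -> W) :
  Ck_on k setT f -> Ck_on k U f.
Proof.
elim: k f => [|k IH] f; first by move=> cf x _; exact: cf.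
by move=> [df Df]; split=> [x _|v]; [exact: df|apply: IH; exact: Df].
Qed.

Lemma smooth_on_entry (V : normedModType R) n (U : set V) (f : V -> 'rV[R]_n) i :
  open U -> smooth_on U f -> smooth_on U (fun x => f x 0 i : R).
Proof.
move=> oU + k => /(_ k); elim: k f => [|k IH] f.
  move=> cf x Ux; apply: (@continuous_comp _ _ _ f (fun z : 'rV[R]_n => z 0 i : R)).
    exact: cf.
  exact: coord_continuous.
move=> [df Df]; split=> [x Ux|v].
  apply: (@differentiable_comp _ _ _ _ f (fun z : 'rV[R]_n => z 0 i : R)).
    exact: df.
  exact: differentiable_coord.
apply: (@Ck_on_ext _ _ _ _ _ (fun x => 'D_v f x 0 i : R)) => //; last first.
  by apply: IH; exact: Df.
move=> x Ux; rewrite derive_mx ?mxE//.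
by apply: diff_derivable; exact: df.
Qed.

Lemma dotv_ge0 n (y : 'rV[R]_n) : 0 <= dotv y y.
Proof. by apply: sumr_ge0 => i _; rewrite -expr2 sqr_ge0. Qed.

Lemma dotvZ n (a : R) (u : 'rV[R]_n) : dotv (a *: u) (a *: u) = a ^+ 2 * dotv u u.
Proof.
by rewrite /dotv mulr_sumr; apply: eq_bigr => k _; rewrite !mxE mulrACA -expr2.
Qed.

Lemma dotv_lift n (i : 'I_n) (u v : 'rV[R]_n) :
  dotv u v = u 0 i * v 0 i + dotv (col' i u) (col' i v).
Proof.
rewrite /dotv (bigD1_ord i)//=; congr (_ + _).
by apply: eq_bigr => k _; rewrite !mxE.
Qed.

Lemma smooth_dotvv n : smooth_on setT (fun y : 'rV[R]_n => dotv y y).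
Proof.
apply: smooth_sum => [|i k]; first exact: openT.
by apply: Ck_onM; [exact: openT|exact: smooth_coord|exact: smooth_coord].
Qed.

Lemma continuous_set_type (T S : topologicalType) (A : set T) (f : S -> A) x :
  {for x, continuous (\val \o f)} -> {for x, continuous f}.
Proof.
move=> cf B /= [_ [[C oC <-]] Cfx CB]; apply: filterS CB _.
by apply: (cf C); exact: open_nbhs_nbhs.
Qed.

End AuxiliaryLemmas.

(* The unit sphere S^(N-1) of R^N, empty for N = 0, with the stereographic charts
   from the poles (-1)^s e_i. *)
Section Sphere.
Variables (R : realType) (N : nat).

Definition sphere_set : set 'rV[R]_N := [set x | dotv x x = 1].

Section Stereographic.
Variables (s : bool) (i : 'I_N).

Definition stereo_height (x : sphere_set) : R := (-1) ^+ s * val x 0 i.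

Definition stereo_coord (x : sphere_set) : 'rV[R]_N.-1 :=
  (1 - stereo_height x)^-1 *: col' i (val x).

Definition stereo_point (y : 'rV[R]_N.-1) : 'rV[R]_N :=
  \row_j if unlift i j is Some k then 2 * y 0 k / (dotv y y + 1)
         else (-1) ^+ s * (dotv y y - 1) / (dotv y y + 1).

Lemma dotvD1_neq0 (y : 'rV[R]_N.-1) : dotv y y + 1 != 0.
Proof. by rewrite gt_eqF// ltr_wpDl// dotv_ge0. Qed.

Let signM : (-1) ^+ s * (-1) ^+ s = 1 :> R.
Proof. by rewrite -expr2 sqrr_sign. Qed.

Lemma stereo_pointi y :
  stereo_point y 0 i = (-1) ^+ s * (dotv y y - 1) / (dotv y y + 1).
Proof. by rewrite mxE unlift_none. Qed.

Lemma col'_stereo_point y :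
  col' i (stereo_point y) = (2 / (dotv y y + 1)) *: y.
Proof. by apply/rowP => k; rewrite !mxE liftK mulrAC. Qed.

Lemma stereo_point_sphere y : stereo_point y \in sphere_set.
Proof.
rewrite inE /sphere_set /= (dotv_lift i) stereo_pointi col'_stereo_point dotvZ.
have := dotvD1_neq0 y; move: (dotv y y) => q q0.
have -> : (-1) ^+ s * (q - 1) / (q + 1) * ((-1) ^+ s * (q - 1) / (q + 1)) =
  ((-1) ^+ s * (-1) ^+ s) * ((q - 1) / (q + 1)) ^+ 2 by ring.
by rewrite signM; field.
Qed.

Definition stereo_param (y : 'rV[R]_N.-1) : sphere_set :=
  SigSub (stereo_point_sphere y).

Lemma smooth_stereo_point : smooth_on setT stereo_point.
Proof.
move=> k; apply: Ck_on_row => [|j]; first exact: openT.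
have sV : Ck_on k setT (fun y : 'rV[R]_N.-1 => (dotv y y + 1)^-1).
  apply: Ck_onV; [exact: openT|by move=> y _; exact: dotvD1_neq0|].
  by apply: Ck_onD; [exact: openT|exact: smooth_dotvv|exact: smooth_cst].
case: (unliftP i j) => [j' ->|->].
  rewrite (_ : (fun y => _) = fun y : 'rV[R]_N.-1 => 2 * y 0 j' * (dotv y y + 1)^-1).
    apply: Ck_onM => //; first exact: openT.
    by apply: Ck_onM; [exact: openT|exact: smooth_cst|exact: smooth_coord].
  by apply/funext => y; rewrite mxE liftK.
rewrite (_ : (fun y => _) =
  fun y : 'rV[R]_N.-1 => (-1) ^+ s * (dotv y y - 1) * (dotv y y + 1)^-1).
  apply: Ck_onM => //; first exact: openT.
  apply: Ck_onM; [exact: openT|exact: smooth_cst|].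
  by apply: Ck_onD; [exact: openT|exact: smooth_dotvv|exact: smooth_cst].
by apply/funext => y; rewrite stereo_pointi.
Qed.

Lemma sphere_coord_continuous j :
  continuous (fun x : sphere_set => val x 0 j : R).
Proof.
move=> x; apply: (@continuous_comp _ _ _ (fun x : sphere_set => val x)
  (fun x : 'rV[R]_N => x 0 j : R)); first exact: initial_continuous.
exact: coord_continuous.
Qed.

Lemma stereo_height_continuous : continuous stereo_height.
Proof.
move=> x; apply: (@continuousM _ _ (fun=> (-1) ^+ s)
  (fun x : sphere_set => val x 0 i : R)); first exact: cst_continuous.
exact: sphere_coord_continuous.
Qed.

Program Definition stereo_chart : chart R N.-1 sphere_set :=
  {| chart_dom := [set x | stereo_height x != 1]; chart_codom := setT;
     chart_coord := stereo_coord; chart_param := stereo_param |}.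
Next Obligation.
rewrite (_ : mkset _ = stereo_height @^-1` [set r | r != 1]) //.
apply: open_comp => [x _|]; first exact: stereo_height_continuous.
exact: open_neq.
Qed.
Next Obligation. exact: openT. Qed.
Next Obligation.
move=> x hx; split=> //; apply/val_inj => /=.
set h := stereo_height x in hx *; have h1 : 1 - h != 0 by rewrite subr_eq0 eq_sym.
have xiE : val x 0 i = (-1) ^+ s * h by rewrite /h /stereo_height mulrA signM mul1r.
have qE : dotv (stereo_coord x) (stereo_coord x) = (1 + h) / (1 - h).
  have /set_mem := valP x; rewrite /sphere_set /= (dotv_lift i) xiE mulrACA signM.
  move=> /(canRL (addKr _)); rewrite /stereo_coord dotvZ -/h => ->.
  by field.
have q1 : (1 + h) / (1 - h) + 1 != 0 by rewrite -qE dotvD1_neq0.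
have h2 : 1 + h + (1 - h) != 0.
  by rewrite (_ : _ + _ = 2) ?pnatr_eq0//; ring.
apply/rowP => j; case: (unliftP i j) => [k ->|->].
  by rewrite mxE liftK qE !mxE -/h; field; rewrite h1 h2.
by rewrite stereo_pointi qE xiE -!mulrA; congr (_ * _); field; rewrite h1 h2.
Qed.
Next Obligation.
move=> y _; have q0 := dotvD1_neq0 y.
have hE : 1 - stereo_height (stereo_param y) = 2 / (dotv y y + 1).
  rewrite /stereo_height /= stereo_pointi.
  have -> : (-1) ^+ s * ((-1) ^+ s * (dotv y y - 1) / (dotv y y + 1)) =
    ((-1) ^+ s * (-1) ^+ s) * ((dotv y y - 1) / (dotv y y + 1)) by ring.
  by rewrite signM; field.
have h0 : 2 / (dotv y y + 1) != 0 by rewrite mulf_neq0 ?invr_eq0 ?(pnatr_eq0 R 2).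
split; first by rewrite /= eq_sym -subr_eq0 hE.
by rewrite /stereo_coord hE col'_stereo_point scalerA mulVf ?scale1r.
Qed.
Next Obligation.
move=> x /= hx; apply: continuous_row => k.
rewrite (_ : (fun y => _) =
    fun y : sphere_set => (1 - stereo_height y)^-1 * val y 0 (lift i k)).
  apply: (@continuousM _ _ (fun y => (1 - stereo_height y)^-1)
    (fun y : sphere_set => val y 0 (lift i k) : R));
    last exact: sphere_coord_continuous.
  apply: (@continuousV _ _ (fun y => 1 - stereo_height y)).
    by rewrite subr_eq0 eq_sym.
  apply: (@continuousB _ _ _ (fun=> 1 : R) (stereo_height : _ -> R) x); first exact: cst_continuous.
  exact: stereo_height_continuous.
by apply/funext => y; rewrite !mxE.
Qed.
Next Obligation.
move=> y _; apply: continuous_set_type.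
exact: (smooth_stereo_point 0).
Qed.
End Stereographic.

Program Definition sphere : manifold R N.-1 :=
  {| manifold_space := sphere_set;
     atlas := [set c | exists s i, c = stereo_chart s i] |}.
Next Obligation.
apply: (@inj_hausdorff _ _ (fun x : sphere_set => val x)).
- exact: initial_continuous.
- exact: val_inj.
- exact: norm_hausdorff.
Qed.
Next Obligation.
move=> x; have /set_mem := valP x; rewrite /sphere_set /= => x1.
have [i _|N0] := pickP (@predT 'I_N); last first.
  by move: x1; rewrite /dotv big_pred0 // => /esym/eqP; rewrite oner_eq0.
have [x0|x0] := eqVneq (val x 0 i) 1.
  exists (stereo_chart true i); first by exists true, i.
  rewrite /= /stereo_height x0 expr1 mulr1 -subr_eq0 -opprD oppr_eq0.
  by rewrite (pnatr_eq0 R 2).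
exists (stereo_chart false i); first by exists false, i.
by rewrite /= /stereo_height expr0 mul1r.
Qed.
Next Obligation.
move=> _ _ [s [i ->]] [t [j ->]]; rewrite /= setTI.
set U := _ @^-1` _.
pose g y : R := 1 + - 1 * ((-1) ^+ t * stereo_point s i y 0 j).
have sp l : smooth_on setT (fun y => stereo_point s i y 0 l).
  exact/smooth_on_entry/smooth_stereo_point/openT.
have sg : smooth_on setT g.
  move=> k; do ?[apply: Ck_onD|apply: Ck_onM|exact: openT|exact: smooth_cst].
  exact: sp.
have UE : U = g @^-1` [set r | r != 0].
  by apply/seteqP; split=> y; rewrite /U /g /= mulN1r subr_eq0 eq_sym.
have oU : open U.
  rewrite UE; apply: open_comp; last exact: open_neq.
  by move=> y _; exact: (sg 0).
move=> k; apply: Ck_on_row => // l.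
rewrite (_ : (fun y => _) = fun y => (g y)^-1 * stereo_point s i y 0 (lift j l)).
  apply: Ck_onM => //; last exact: Ck_onS (sp _ _).
  by apply: Ck_onV => //; [rewrite UE|exact: Ck_onS (sg _)].
by apply/funext => y; rewrite !mxE /g mulN1r.
Qed.
End Sphere.

(* Real projective space RP^k: the quotient of R^(k+1) minus the origin. *)
Section ProjectiveSpace.
Local Open Scope quotient_scope.

Lemma quotient_local_continuous (T Z : topologicalType) (Q0 : quotType T)
    (Q := quotient_topology Q0) (U : set Q) (g : T -> Z) :
  open U ->
  (forall a b : T, \pi_Q a = \pi_Q b :> Q -> g a = g b) ->
  (forall a : T, U (\pi_Q a) -> {for a, continuous g}) ->
  forall p, U p -> {for p, continuous (g \o repr : Q -> Z)}.
Proof.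
move=> oU gI cg p Up A; rewrite /= nbhsE => -[B [oB Bp] BA].
have gE a : g (repr (\pi_Q a)) = g a by apply: gI; rewrite reprK.
have oV : open [set q : Q | U q /\ B (g (repr q))].
  rewrite /open /= /quotient_open openE => a /= [Ua]; rewrite gE => Ba.
  have nU : nbhs a [set b | U (\pi_Q b)] by apply: open_nbhs_nbhs.
  have nO : nbhs a [set b | B (g b)] by apply: (cg a Ua); exact: open_nbhs_nbhs.
  by apply: filterS2 nU nO => b Ub Bb /=; rewrite gE.
have nV : nbhs p [set q : Q | U q /\ B (g (repr q))].
  by apply: open_nbhs_nbhs; split.
by apply: filterS nV => q [_ /BA].
Qed.

Variables (R : realType) (k : nat).

Definition nonzero_vector : set 'rV[R]_k.+1 := [set x | x != 0].

(* Equality of the row spaces, i.e. of the lines spanned. *)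
Definition same_line (x y : nonzero_vector) := (val x == val y)%MS.

Lemma same_line_refl : reflexive same_line.
Proof. by move=> x; exact/genmxP. Qed.

Lemma same_line_sym : symmetric same_line.
Proof. by move=> x y; apply/genmxP/genmxP. Qed.

Lemma same_line_trans : transitive same_line.
Proof. by move=> y x z /genmxP xy /genmxP yz; apply/genmxP; rewrite xy. Qed.

Definition same_line_equiv :=
  EquivRel same_line same_line_refl same_line_sym same_line_trans.

Definition projective : topologicalType :=
  quotient_topology {eq_quot same_line_equiv}.

Definition line_of (x : nonzero_vector) : projective := \pi_projective x.
Definition vector_of (p : projective) : nonzero_vector := repr p.

Lemma line_ofP (x y : nonzero_vector) : line_of x = line_of y ->
  exists2 c, c != 0 & val x = c *: val y.
Proof.
move=> xy; have /eqmodP /andP[/sub_rVP[c xE] _] :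
  x = y %[mod {eq_quot same_line_equiv}] := xy.
exists c => //; apply/eqP => c0; have /set_mem := valP x.
by rewrite /nonzero_vector /= xE c0 scale0r eqxx.
Qed.

Lemma line_of_scale (x y : nonzero_vector) c :
  c != 0 -> val x = c *: val y -> line_of x = line_of y.
Proof.
move=> c0 xE.
suff xy : x = y %[mod {eq_quot same_line_equiv}] by exact: xy.
by apply/eqmodP/eqmxP; rewrite xE; exact: eqmx_scale.
Qed.

Lemma vector_ofK p : line_of (vector_of p) = p.
Proof. exact: reprK. Qed.

(* Chart [x_0 : ... : x_k] |-> (x_j / x_i)_(j != i) on {x_i <> 0}. *)
Section AffineChart.
Variable i : 'I_k.+1.

Definition affine_coord (x : nonzero_vector) : 'rV[R]_k :=
  (val x 0 i)^-1 *: col' i (val x).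

Definition affine_point (y : 'rV[R]_k) : 'rV[R]_k.+1 :=
  \row_j if unlift i j is Some l then y 0 l else 1.

Lemma affine_point_neq0 y : affine_point y \in nonzero_vector.
Proof.
rewrite inE /nonzero_vector /=; apply/eqP => /rowP /(_ i) /eqP.
by rewrite !mxE unlift_none oner_eq0.
Qed.

Definition affine_param (y : 'rV[R]_k) : projective :=
  line_of (SigSub (affine_point_neq0 y)).

Lemma affine_coord_line (x y : nonzero_vector) :
  line_of x = line_of y -> affine_coord x = affine_coord y.
Proof.
move=> /line_ofP[c c0 xE]; apply/rowP => j; rewrite !mxE xE !mxE.
by rewrite invfM mulrACA mulVf ?mul1r.
Qed.

Lemma nonzero_line (x y : nonzero_vector) :
  line_of x = line_of y -> (val x 0 i != 0) = (val y 0 i != 0).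
Proof. by move=> /line_ofP[c c0 ->]; rewrite mxE mulf_eq0 (negPf c0). Qed.

Lemma line_of_nonzero (x : nonzero_vector) :
  (val (vector_of (line_of x)) 0 i != 0) = (val x 0 i != 0).
Proof. by apply: nonzero_line; rewrite vector_ofK. Qed.

Lemma nonzero_coord_continuous j :
  continuous (fun x : nonzero_vector => val x 0 j : R).
Proof.
move=> x; apply: (@continuous_comp _ _ _ (fun x : nonzero_vector => val x)
  (fun x : 'rV[R]_k.+1 => x 0 j : R)); first exact: initial_continuous.
exact: coord_continuous.
Qed.

Lemma smooth_affine_point j : smooth_on setT (fun y => affine_point y 0 j : R).
Proof.
case: (unliftP i j) => [l ->|->] m.
  rewrite (_ : (fun y => _) = fun y : 'rV[R]_k => y 0 l); first exact: smooth_coord.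
  by apply/funext => y; rewrite mxE liftK.
rewrite (_ : (fun y => _) = fun=> 1); first exact: smooth_cst.
by apply/funext => y; rewrite mxE unlift_none.
Qed.

Let affine_dom : set projective := [set p | val (vector_of p) 0 i != 0].

Let open_affine_dom : open affine_dom.
Proof.
rewrite /open /= /quotient_open.
rewrite (_ : _ @^-1` _ =
    (fun x : nonzero_vector => val x 0 i : R) @^-1` [set r | r != 0]).
  apply: open_comp; last exact: open_neq.
  by move=> x _; exact: nonzero_coord_continuous.
by apply/seteqP; split=> x; rewrite /affine_dom /= -/(line_of x) line_of_nonzero.
Qed.

Program Definition affine_chart : chart R k projective :=
  {| chart_dom := affine_dom; chart_codom := setT;
     chart_coord := affine_coord \o vector_of; chart_param := affine_param |}.
Next Obligation. exact: open_affine_dom. Qed.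
Next Obligation. exact: openT. Qed.
Next Obligation.
move=> p pi0; split=> //; rewrite -[RHS]vector_ofK.
apply: (@line_of_scale _ _ (val (vector_of p) 0 i)^-1); rewrite ?invr_eq0 //=.
apply/rowP => j; case: (unliftP i j) => [l ->|->].
  by rewrite !mxE liftK !mxE.
by rewrite !mxE unlift_none mulVf.
Qed.
Next Obligation.
move=> y _; split.
  by rewrite /affine_dom /= line_of_nonzero /= mxE unlift_none oner_eq0.
rewrite /= (@affine_coord_line _ (SigSub (affine_point_neq0 y))) ?vector_ofK//.
by apply/rowP => j; rewrite !mxE unlift_none liftK invr1 mul1r.
Qed.
Next Obligation.
apply: (quotient_local_continuous open_affine_dom).
  by move=> x y; exact: affine_coord_line.
move=> x; rewrite /affine_dom /= -/(line_of x) line_of_nonzero => x0.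
apply: continuous_row => l.
rewrite (_ : (fun y => _) = fun y : nonzero_vector =>
    (val y 0 i)^-1 * val y 0 (lift i l)).
  apply: (@continuousM _ _ (fun y : nonzero_vector => (val y 0 i)^-1 : R)
    (fun y : nonzero_vector => val y 0 (lift i l) : R));
    last exact: nonzero_coord_continuous.
  apply: (@continuousV _ _ (fun y : nonzero_vector => val y 0 i : R)) => //.
  exact: nonzero_coord_continuous.
by apply/funext => y; rewrite !mxE.
Qed.
Next Obligation.
move=> y _; apply: (@continuous_comp _ _ _
  (fun y => SigSub (affine_point_neq0 y) : nonzero_vector) line_of).
  apply: continuous_set_type; apply: continuous_row => j.
  exact: (smooth_affine_point j 0).
exact: pi_continuous.
Qed.
End AffineChart.

Lemma projective_hausdorff : hausdorff_space projective.
Proof.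
pose P (x : nonzero_vector) : 'M[R]_k.+1 :=
  (dotv (val x) (val x))^-1 *: ((val x)^T *m val x).
have dot0 (x : nonzero_vector) : dotv (val x) (val x) != 0.
  have /set_mem := valP x; rewrite /nonzero_vector /=; apply: contra_neq => x0.
  apply/rowP => j; rewrite mxE; apply/eqP; rewrite -sqrf_eq0 expr2; apply/eqP.
  by apply: (psumr_eq0P _ x0) => // l _; rewrite -expr2 sqr_ge0.
have mulP (x y : nonzero_vector) : val x *m P y =
    ((dotv (val y) (val y))^-1 * dotv (val x) (val y)) *: val y.
  rewrite -scalemxAr mulmxA [X in X *m _]mx11_scalar mul_scalar_mx scalerA.
  by congr (_ * _ *: _); rewrite mxE; apply: eq_bigr => j _; rewrite mxE.
apply: (@inj_hausdorff _ _ (P \o vector_of)).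
- move=> p; apply: (@quotient_local_continuous _ _ _ setT P _ _ _ p I).
  + exact: openT.
  + move=> x y /line_ofP[c c0 xE]; rewrite /P xE dotvZ.
    rewrite [(c *: _)^T]linearZ -scalemxAr -scalemxAl !scalerA; congr (_ *: _).
    by have := dot0 y; move: (dotv _ _) => q q0; field; rewrite c0 q0.
  + move=> x _; apply: continuous_mx => i j.
    rewrite (_ : (fun y => _) = fun y : nonzero_vector =>
      (dotv (val y) (val y))^-1 * (val y 0 i * val y 0 j)); last first.
      by apply/funext => y; rewrite !mxE big_ord1 !mxE.
    apply: (@continuousM _ _
      (fun y : nonzero_vector => (dotv (val y) (val y))^-1 : R)
      (fun y : nonzero_vector => val y 0 i * val y 0 j : R)).
      apply: (@continuousV _ _
        (fun y : nonzero_vector => dotv (val y) (val y) : R)) => //.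
      apply: (@continuous_comp _ _ _ (fun y : nonzero_vector => val y)
        (fun y => dotv y y : R)); first exact: initial_continuous.
      exact: (@smooth_dotvv R k.+1 0).
    apply: (@continuousM _ _ (fun y : nonzero_vector => val y 0 i : R)
      (fun y : nonzero_vector => val y 0 j : R)); exact: nonzero_coord_continuous.
- move=> p q /= pq; rewrite -[p]vector_ofK -[q]vector_ofK.
  set x := vector_of p in pq *; set y := vector_of q in pq *.
  have := mulP x x; rewrite mulVf // scale1r pq mulP => xE.
  apply: line_of_scale (esym xE); apply/eqP => c0.
  have /set_mem := valP x; rewrite /nonzero_vector /= -xE c0 scale0r.
  by rewrite eqxx.
- exact: norm_hausdorff.
Qed.

Program Definition projective_space : manifold R k :=
  {| manifold_space := projective; atlas := range affine_chart |}.
Next Obligation. exact: projective_hausdorff. Qed.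
Next Obligation.
move=> p; have /set_mem := valP (vector_of p).
rewrite /nonzero_vector /= => /eqP p0.
have [j pj|p00] := pickP (fun j => val (vector_of p) 0 j != 0).
  by exists (affine_chart j); first by exists j.
by case: p0; apply/rowP => j; rewrite mxE; apply/eqP; move: (p00 j) => /negbFE.
Qed.
Next Obligation.
move=> _ _ [i _ <-] [j _ <-]; rewrite /= setTI.
set U := _ @^-1` _.
have UE : U = (fun y => affine_point i y 0 j) @^-1` [set r | r != 0].
  by apply/seteqP; split=> y; rewrite /U /= line_of_nonzero.
have oU : open U.
  rewrite UE; apply: open_comp; last exact: open_neq.
  by move=> y _; exact: (smooth_affine_point i j 0).
move=> m; apply: Ck_on_row => // l.
rewrite (_ : (fun y => _) = fun y =>
    (affine_point i y 0 j)^-1 * affine_point i y 0 (lift j l)).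
  apply: Ck_onM => //; last exact: Ck_onS (smooth_affine_point _ _ _).
  apply: Ck_onV => //; first by rewrite UE.
  exact: Ck_onS (smooth_affine_point _ _ _).
apply/funext => y; rewrite /= (@affine_coord_line _ _ (SigSub (affine_point_neq0 i y))).
  by rewrite !mxE.
exact: vector_ofK.
Qed.
End ProjectiveSpace.

Section SmoothEmbeddings.
Context {R : realType} {m n : nat} {M : manifold R m} {N : manifold R n}.
Implicit Types (f : M -> N) (c : chart R m M) (d : chart R n N).

Definition local_expr f c d : 'rV[R]_m -> 'rV[R]_n :=
  chart_coord d \o f \o chart_param c.

Definition local_dom f c d : set 'rV[R]_m :=
  chart_codom c `&` (f \o chart_param c) @^-1` chart_dom d.

Definition smooth_map f : Prop :=
  continuous f /\ forall c d, atlas c -> atlas d ->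
    smooth_on (local_dom f c d) (local_expr f c d).

Definition immersion f : Prop :=
  smooth_map f /\ forall c d, atlas c -> atlas d ->
    forall y, local_dom f c d y ->
      injective ('d (local_expr f c d) y : 'rV[R]_m -> 'rV[R]_n).

Definition smooth_embedding f : Prop :=
  [/\ immersion f, injective f &
      forall U : set M, open U -> exists2 V : set N, open V & U = f @^-1` V].

End SmoothEmbeddings.

Section Neighborly.
Context {R : realType} {n : nat} (M : manifold R n).

Section FixedTarget.
Context {N : nat}.
Implicit Types f g : M -> euclidean R N.

Definition hyperplane (a : 'rV[R]_N) (b : R) : set 'rV[R]_N :=
  [set x | dotv a x = b].

Definition neighborly1 f : Prop :=
  smooth_embedding f /\
  forall p : M, exists (a : 'rV[R]_N) (b : R),
    [/\ a != 0,
        (forall q, dotv a (f q) <= b) \/ (forall q, b <= dotv a (f q)) &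
        range f `&` hyperplane a b = [set f p]].

Definition C2_close (c : chart R n M) (K : set M) (e : R) f g : Prop :=
  let h : 'rV[R]_n -> 'rV[R]_N :=
    fun y => (f (chart_param c y) : 'rV[R]_N) - g (chart_param c y) in
  forall p, K p -> let y := chart_coord c p in
    [/\ `|h y| < e,
        forall u, `|u| <= 1 -> `|'D_u h y| < e &
        forall u v, `|u| <= 1 -> `|v| <= 1 -> `|'D_u ('D_v h) y| < e].

(* Neighborhoods of [f] in the space of smooth maps for the C^2-topology of
   uniform convergence, on compact subsets of charts, of the derivatives of order
   at most 2; for compact [M] the weak and strong C^2-topologies coincide. *)
Definition C2_nbhs f (W : set (M -> euclidean R N)) : Prop :=
  exists (r : nat) (c : 'I_r -> chart R n M) (K : 'I_r -> set M) (e : R),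
    [/\ 0 < e,
        forall i, [/\ atlas (c i), compact (K i) & K i `<=` chart_dom (c i)] &
        forall g, smooth_map g -> (forall i, C2_close (c i) (K i) e f g) -> W g].

Definition stably_neighborly1 f : Prop :=
  neighborly1 f /\ C2_nbhs f [set g | smooth_embedding g -> neighborly1 g].

End FixedTarget.

Definition neighborly_dims : set nat :=
  [set N | exists f : M -> euclidean R N, stably_neighborly1 f].

(* The least element of [neighborly_dims].  The default value 0 is used only if
   there is no stably 1-neighborly embedding, which never happens for compact
   [M]: embed [M] in a sphere. *)
Definition Delta1 : nat :=
  xget 0%N [set N | neighborly_dims N /\
                    forall N', neighborly_dims N' -> (N <= N')%N].

Definition closed_manifold : Prop := compact [set: M].

End Neighborly.

(* Main.v *)
(* Only hyperplane supports of second order matter.  If f is stably 1-neighborly, apply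
   neighborliness at p to f + t |f - f p|^2 w with w = f p - f q0 and t small: this
   gives a and k > 0 with a.(f p - f q) >= k |f p - f q|^2 for all q.  Such an
   inequality survives C^2-small perturbations of f and of p, with k/2 for k, once a is
   projected to the normal space: near p it holds to second order along segments in a
   chart, and far from p by compactness.  Gluing with bump functions gives a smooth
   field a with a(p).(f p - f q) >= k(p) |f p - f q|^2; then a(p) and a(q) never
   lie on the same ray and the differential of a is never radial on a nonzero tangent
   vector, so a/|a| embeds M in the sphere.  Conversely a map to the unit sphere
   satisfies the inequality with a(p) = f p and k = 1/2, and its perturbations with 1/4.

   RP^k embeds in the unit sphere of R^(2k+1) by [x] |-> coefficients of (sum x_i T^i)^2,
   normalized.  An embedding in S^(2k-1) would miss a point by Borsuk-Ulam, hence give an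
   injection g to R^(2k-1); then (u, v) |-> (u.v, g[u+v] - g[u-v]) has no zero
   on S^k x S^k, is odd in u and in v, and symmetric.  A mod 2 count over the cells of a
   grid on which one sign is constant shows that C(2k-1, k) must then be even, which fails
   for k = 2^j. *)
From mathcomp Require Import all_boot all_order all_algebra mxpoly.
From mathcomp Require Import all_classical all_reals topology normedtype derive.
From mathcomp Require Import realfun sequences exp.
From mathcomp Require Import zify ring lra.
Require Import Defs.

Set Implicit Arguments. Unset Strict Implicit. Unset Printing Implicit Defensive.
Import Order.TTheory GRing.Theory Num.Theory.
Import numFieldNormedType.Exports.
Local Open Scope ring_scope.

(** * Mod 2 cochains on a cubical grid *)

(** The direction w is chosen so that testing the support of the perturbed map at q0, where f p - f
    q0 = w, gives (a.w)(1 - t |w|^2) > 0. Hence a.w > 0, and k = t (a.w) is the constant gained.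

    For RP^k the obstacle is that 2k functions on S^k x S^k, odd in u and in v, are obstructed only
    by the coefficient C(2k, k) of x^k y^k in (x + y)^(2k), which is always even. The symmetry must
    be used: counting one cell of each pair exchanged by (u, v) |-> (v, u) yields half of it,
    C(2k-1, k). The cells fixed by the exchange lie on the diagonal and need separate care; there
    u.v > 0 settles the sign.

    The count replaces homology by signs on a grid. A cube [0,1]^k parametrizes a hemisphere of S^k:
    the faces t_l = 0 and t_l = 1 with l < k - 1 are collapsed, and the two faces orthogonal to the
    last direction are opposite hemispheres of S^(k-1). Induction on the dimension then amounts to
    Pascal's rule. *)

Lemma addbool_eq0 (a : bool) : a + a = 0 :> bool.
Proof. by case: a. Qed.

(** The terms (i, j) and (j, i) cancel; the diagonal is left out of the sum. *)
Lemma big_sym_char2 (I : finType) (P : pred I) (f : I -> I -> bool) :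
  (forall i j, f i j = f j i) ->
  \sum_(i | P i) \sum_(j | P j && (j != i)) f i j = 0 :> bool.
Proof.
move=> fC; pose lt (i j : I) := (enum_rank i < enum_rank j)%N.
pose T := \sum_(i | P i) \sum_(j | P j && lt j i) f i j.
have TE : T = \sum_(i | P i) \sum_(j | P j && lt i j) f i j.
  rewrite /T (exchange_big_dep P) /=; last by move=> i j _ /andP[].
  by apply: eq_bigr => i Pi; apply: eq_big => [j|j _]; rewrite ?Pi.
rewrite -[RHS](addbool_eq0 T) {2}TE /T -big_split /=; apply: eq_bigr => i Pi.
rewrite (bigID (fun j => lt j i)) /=; congr (_ + _); apply: eq_bigl => j;
  rewrite -andbA; congr (_ && _);
  by rewrite /lt -(inj_eq enum_rank_inj) -(inj_eq val_inj) /=; lia.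
Qed.

Section Cells.
Variables (D : finType) (M : nat).
Local Notation L := M.*2.
(* The cell of the grid with coordinates [x d]: an even coordinate [2 c] stands for
   the point [c], an odd one [2 c + 1] for the interval from [c] to [c + 1]. *)
Definition cell : Type := {ffun D -> 'I_L.+1}.
Implicit Types (x y : cell) (d : D) (b : bool).

Definition upd x d (c : 'I_L.+1) : cell := [ffun e => if e == d then c else x e].
(** Meant for odd [x d]: the new coordinate is one of the two ends of the interval, and [inord] does
    not overflow because [L] is even. *)
Definition facet x d b : cell := upd x d (inord (if b then (x d).+1 else (x d).-1)).

Lemma updE x d c e : upd x d c e = if e == d then c else x e.
Proof. by rewrite ffunE. Qed.

Lemma facetE x d b e : odd (x d) -> facet x d b e =
  (if e == d then if b then (x d).+1 else (x d).-1 else x e) :> nat.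
Proof.
move=> xd; rewrite updE; case: eqP => // _; rewrite inordK //.
by case: b; have := ltn_ord (x d); lia.
Qed.

Lemma facet_odd x d b e : odd (x d) -> odd (facet x d b e) = odd (x e) && (e != d).
Proof.
move=> xd; rewrite facetE //; case: eqVneq => [->|] /=; last by rewrite andbT.
by rewrite andbF; case: b; lia.
Qed.

Lemma facetC x d b e b' : d != e -> odd (x d) -> odd (x e) ->
  facet (facet x d b) e b' = facet (facet x e b') d b.
Proof.
move=> de xd xe; apply/ffunP => i; apply/val_inj => /=.
have ed : e != d by rewrite eq_sym.
have o1 : odd (facet x d b e) by rewrite facet_odd // xe.
have o2 : odd (facet x e b' d) by rewrite facet_odd // xd.
rewrite (facetE _ _ o1) (facetE _ _ o2) !facetE // (negPf ed) (negPf de).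
by case: (eqVneq i e) => [->|_]; rewrite ?(negPf de) ?(negPf ed).
Qed.

(** The mod 2 cellular coboundary. *)
Definition cobd (g : cell -> bool) x : bool :=
  \sum_(d | odd (x d)) \sum_(b : bool) g (facet x d b).

Lemma cobd_cobd g x : cobd (cobd g) x = 0.
Proof.
(* A face of codimension 2 is reached by dropping [d] and [e] in either order. The last factor makes
   [f] symmetric for all [d] and [e], also where [facetC] does not apply. *)
pose f d e := \sum_(b : bool) \sum_(b' : bool) g (facet (facet x d b) e b') *
  (odd (x d) && odd (x e) && (d != e)).
rewrite -(@big_sym_char2 _ (fun d => odd (x d)) f).
  apply: eq_bigr => d xd; rewrite exchange_big /=.
  under eq_bigr do rewrite /cobd.
  rewrite -exchange_big /=.
  transitivity (\sum_(b : bool) \sum_(e | odd (x e) && (e != d))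
      \sum_(b' : bool) g (facet (facet x d b) e b')).
    by apply: eq_bigr => b _; apply: eq_bigl => e; rewrite facet_odd.
  rewrite exchange_big; apply: eq_bigr => e /andP[xe ed]; apply: eq_bigr => b _.
  by apply: eq_bigr => b' _; rewrite xd xe eq_sym ed mulr1.
move=> d e; rewrite /f exchange_big; apply: eq_bigr => b _; apply: eq_bigr => b' _.
rewrite (eq_sym e d) [odd (x e) && _]andbC.
case H : (_ && _); last by rewrite !mulr0.
by move: H => /andP[/andP[xd xe] de]; rewrite facetC.
Qed.

Section Cocycles.
Variable eps : nat -> cell -> bool.

(* Mod 2 cup product of the coboundaries of [eps 0], ..., [eps m.-1], on cells of
   dimension [m].  It vanishes on a cell as soon as one [eps i] is constant on its faces. *)
Fixpoint W m x : bool :=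
  if m is m'.+1 then \sum_(d | odd (x d)) \sum_(b : bool)
    W m' (facet x d b) * (eps m' (facet x d b) + eps m' x)
  else 1.

(** Leibniz rule: the second term disappears once [W m] is known to be a cocycle. *)
Lemma W_cobd m x : W m.+1 x = cobd (fun y => eps m y * W m y) x + eps m x * cobd (W m) x.
Proof.
rewrite /= /cobd mulr_sumr -big_split; apply: eq_bigr => d xd /=.
rewrite mulr_sumr -big_split; apply: eq_bigr => b _ /=.
by ring.
Qed.

(** [W 0] is the constant 1 and an interval has two ends; each later [W] is a coboundary by [W_cobd]
    and the induction hypothesis. *)
Lemma cobd_W m x : cobd (W m) x = 0.
Proof.
elim: m x => [|m IH] x.
  by rewrite /cobd /=; apply: big1 => d _; rewrite big_bool.
rewrite -(cobd_cobd (fun y => eps m y * W m y) x); apply: eq_bigr => d _.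
by apply: eq_bigr => b _; rewrite W_cobd IH mulr0 addr0.
Qed.

Lemma WS m x : W m.+1 x = cobd (fun y => eps m y * W m y) x.
Proof. by rewrite W_cobd cobd_W mulr0 addr0. Qed.

Lemma W_const (P : cell -> Prop) m0 v :
  (forall x d b, P x -> odd (x d) -> P (facet x d b)) ->
  (forall x, P x -> eps m0 x = v) ->
  forall m x, (m0 < m)%N -> P x -> W m x = 0.
Proof.
move=> Pf Pe; elim=> // m IH x; rewrite ltnS leq_eqVlt => /orP[/eqP m0E|mm] Px /=.
  apply: big1 => d xd; apply: big1 => b _; rewrite -m0E !Pe ?addbool_eq0 ?mulr0 //.
  exact: Pf.
by apply: big1 => d xd; apply: big1 => b _; rewrite IH ?mul0r //; exact: Pf.
Qed.

(** The top-dimensional cells of the face of the grid on which all coordinates outside [S] are 0. *)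
Definition cube (S : {set D}) : pred cell :=
  [pred x : cell | [forall d, if d \in S then odd (x d) else x d == ord0]].

Lemma cubeP (S : {set D}) x :
  reflect (forall d, if d \in S then odd (x d) : Prop else x d = ord0) (x \in cube S).
Proof.
apply: (iffP forallP) => H d; have := H d; case: ifP => // _; first by move/eqP.
by move=> ->.
Qed.

Lemma sum_telescope_nat (h : nat -> bool) n :
  \sum_(0 <= c < n.*2.+1 | odd c) (h c.+1 + h c.-1) = h 0 + h n.*2.
Proof.
rewrite big_mkcond; elim: n => [|n IH]; first by rewrite big_nat1 /= addbool_eq0.
rewrite doubleS big_nat_recr // big_nat_recr // IH /= odd_double /=.
rewrite addr0 -addrA [h n.*2 + _]addrC -addrA addbool_eq0 addr0 //.
Qed.

Lemma sum_telescope (h : 'I_L.+1 -> bool) :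
  \sum_(c : 'I_L.+1 | odd c) (h (inord c.+1) + h (inord c.-1)) = h ord0 + h ord_max.
Proof.
pose h' i := h (inord i).
have -> : h ord0 + h ord_max = h' 0 + h' L.
  by congr (h _ + h _); apply/val_inj; rewrite /= inordK.
by rewrite -(sum_telescope_nat h') big_mkord.
Qed.

Lemma sum_cube_split (S : {set D}) d (h : cell -> bool) : d \in S ->
  \sum_(x in cube S) h x =
  \sum_(x in cube (S :\ d)) \sum_(c : 'I_L.+1 | odd c) h (upd x d c).
Proof.
move=> dS; rewrite pair_big_dep /=.
rewrite (reindex_onto (fun p : cell * 'I_L.+1 => upd p.1 d p.2)
    (fun x => (upd x d ord0, x d))) /=; last first.
  by move=> x _; apply/ffunP => e; rewrite !updE; case: eqP => // ->.
apply: eq_bigl => -[x c] /=; rewrite xpair_eqE updE eqxx [c == c]eqxx andbT.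
apply/andP/andP => [[/cubeP xS /eqP xE]|[/cubeP xS co]]; split.
- apply/cubeP => e; have := xS e; rewrite !inE updE; case: eqP => [->|] //= _.
  by move: xE => /(congr1 (fun z : cell => z d)); rewrite !updE eqxx => <-.
- by have := xS d; rewrite dS updE eqxx.
- apply/cubeP => e; have := xS e; rewrite !inE updE; case: eqP => [->|] //=.
  by rewrite dS.
- apply/eqP/ffunP => e; rewrite !updE; case: eqP => // ->.
  by have := xS d; rewrite !inE eqxx.
Qed.

Lemma sum_faces (S : {set D}) d (g : cell -> bool) : d \in S ->
  \sum_(x in cube S) \sum_(b : bool) g (facet x d b) =
  \sum_(x in cube (S :\ d)) (g x + g (upd x d ord_max)).
Proof.
move=> dS; rewrite (sum_cube_split _ dS); apply: eq_bigr => x /cubeP xS.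
have x0 : upd x d ord0 = x.
  apply/ffunP => e; rewrite updE; case: eqP => // ->.
  by have := xS d; rewrite !inE eqxx.
rewrite -{2}x0 -(sum_telescope (fun c => g (upd x d c))); apply: eq_bigr => c _.
rewrite big_bool; congr (g _ + g _); apply/ffunP => e; rewrite !updE;
  by case: eqP => // _; rewrite eqxx.
Qed.

(** Stokes' formula mod 2: interior facets occur twice, so only the facets on the two ends of each
    direction of [S] remain. *)
Lemma sum_cobd (S : {set D}) (g : cell -> bool) :
  \sum_(x in cube S) cobd g x =
  \sum_(d in S) \sum_(x in cube (S :\ d)) (g x + g (upd x d ord_max)).
Proof.
transitivity (\sum_(x in cube S) \sum_(d in S) \sum_(b : bool) g (facet x d b)).
  apply: eq_bigr => x /cubeP xS; apply: eq_bigl => d.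
  by have := xS d; case: ifP => // _ ->.
by rewrite exchange_big; apply: eq_bigr => d dS; exact: sum_faces.
Qed.

End Cocycles.
End Cells.

(** * Boundary identifications on a product of parametrized spheres *)

Section Blocks.
Variables (B : finType) (k M : nat).
Local Notation D := (B * 'I_k)%type.
Local Notation L := M.*2.
Local Notation cell := (cell D M).
Implicit Types (x y : cell) (b : B) (i l : 'I_k).
Variable eps : nat -> cell -> bool.
Local Notation W := (W eps).

Definition extremal (c : 'I_L.+1) := (c == ord0) || (c == ord_max).

Lemma extremal_even c : extremal c -> ~~ odd c.
Proof. by case/orP => /eqP -> //=; rewrite odd_double. Qed.

Definition antipode b i x : cell :=
  [ffun d : B * 'I_k => if d.1 == b then if (d.2 < i)%N then rev_ord (x d) else ord0 else x d].

(* Each block of coordinates parametrizes a sphere as in [sphere_param] below. *)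
Hypothesis eps_degenerate : forall m x b l l' c, (l < l')%N ->
  extremal (x (b, l)) -> eps m (upd x (b, l') c) = eps m x.
Hypothesis eps_antipode : forall m x b i, x (b, i) = ord_max ->
  (forall l, (i < l)%N -> x (b, l) = ord0) -> eps m x = ~~ eps m (antipode b i x).

(** The cell is collapsed in the direction [l']. Dropping [l'] itself does not change the sign, and
    dropping another direction keeps the situation. As [m] is the dimension of the cell, [l'] is
    dropped before the constant [W 0] is reached. *)
Lemma W_degenerate m x b l l' : #|[set d | odd (x d)]| = m -> (l < l')%N ->
  extremal (x (b, l)) -> odd (x (b, l')) -> W m x = 0.
Proof.
elim: m x => [|m IH] x xm ll xl xl'.
  by move/eqP: xm; rewrite cards_eq0 => /eqP/setP/(_ (b, l')); rewrite !inE xl'.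
rewrite /=; apply: big1 => d xd; apply: big1 => s _.
have [->|dl'] := eqVneq d (b, l'); first by rewrite (eps_degenerate _ _ ll) // addbool_eq0 mulr0.
have dl : (b, l) != d by apply: contraL xd => /eqP <-; exact: extremal_even.
rewrite IH ?mul0r //.
- apply/eqP; rewrite -eqSS -xm (cardsD1 d [set e | odd (x e)]) inE xd add1n eqSS.
  apply/eqP/eq_card => e; rewrite !inE facet_odd //.
  by rewrite andbC.
- by rewrite updE (negPf dl).
- by rewrite facet_odd // xl' eq_sym.
Qed.

(** [W] depends only on sums of two signs, and [antipode] negates both. *)
Lemma W_antipode m x b i : x (b, i) = ord_max ->
  (forall l, (i < l)%N -> x (b, l) = ord0) -> W m x = W m (antipode b i x).
Proof.
elim: m x => // m IH x xi x0 /=.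
have oddA d : odd (antipode b i x d) = odd (x d).
  rewrite ffunE; case: eqP => // db; case: ltnP => [_|il].
    by rewrite /= subSS oddB ?odd_double // -ltnS.
  case: d db il => _ l /= ->; rewrite leq_eqVlt => /orP[/eqP/val_inj <-|/x0 -> //].
  by rewrite xi /= odd_double.
apply: eq_big => [d|d xd]; first by rewrite oddA.
(* [s] tells whether [antipode] reverses the coordinate [d]; if so, it exchanges the two facets in
   this direction. *)
pose s : bool := (d.1 == b) && (d.2 < i)%N.
have ns : ~~ s -> d.1 != b.
  rewrite negb_and; case: eqP => //= db; rewrite -leqNgt leq_eqVlt => /orP[/eqP/val_inj di|].
    by move: xd; rewrite [d]surjective_pairing db -di xi odd_double.
  by move=> /x0 xl; move: xd; rewrite [d]surjective_pairing db xl.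
have fA t : antipode b i (facet x d t) = facet (antipode b i x) d (t (+) s).
  apply/ffunP => e; apply/val_inj => /=; rewrite facetE ?oddA // ffunE.
  have xdL := ltn_ord (x d).
  have [->|ed] := eqVneq e d; last by rewrite updE (negPf ed) ffunE.
  rewrite [antipode b i x d]ffunE; case sE : s; last first.
    rewrite (negPf (ns (negbT sE))) facetE // eqxx addbF //.
  move/andP: sE => [-> ->] /=; rewrite facetE // eqxx addbT.
  have xd0 : (0 < x d)%N by case: (nat_of_ord (x d)) xd.
  by case: t => /=; [rewrite subnS|rewrite prednK // -subSn // subSS].
have fi t : facet x d t (b, i) = ord_max.
  rewrite updE; case: eqP => // E; move: xd; rewrite -E xi /= odd_double //.
have f0 t l : (i < l)%N -> facet x d t (b, l) = ord0.
  move=> il; rewrite updE; case: eqP => // E; last exact: x0.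
  by move: xd; rewrite -E x0.
rewrite (reindex_inj (@addIb s)); apply: eq_bigr => t _ /=.
rewrite IH //; last by move=> l; exact: f0.
rewrite fA addbK (eps_antipode m (fi _) (f0 _)) fA addbK.
by rewrite (eps_antipode m xi x0); case: (eps _ _); case: (eps _ _).
Qed.

(** [cube (corner h)] triangulates, by cubes, a fundamental domain of a product of projective spaces
    of dimensions [h b]. *)
Definition corner (h : B -> nat) : {set D} := [set d : D | (d.2 < h d.1)%N].

Definition cut (h : B -> nat) b : B -> nat := fun b' => if b' == b then (h b').-1 else h b'.

Lemma corner_cut (h : B -> nat) b i : h b = i.+1 -> corner h :\ (b, i) = corner (cut h b).
Proof.
move=> hb; apply/setP => -[b' l]; rewrite !inE /cut /= xpair_eqE.
case: (eqVneq b' b) => [->|] //=; rewrite hb /= ltnS ltn_neqAle; congr (_ && _).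
Qed.

Lemma card_corner (h : B -> nat) : (forall b, h b <= k)%N ->
  #|corner h| = (\sum_b h b)%N.
Proof.
move=> hk; rewrite -sum1_card (eq_bigl (fun d : D => (d.2 < h d.1)%N)); last first.
  by move=> d; rewrite inE.
rewrite -(pair_big_dep xpredT (fun b (l : 'I_k) => (l < h b)%N) (fun _ _ => 1%N)) /=.
by apply: eq_bigr => b _; rewrite -(big_ord_widen k (fun=> 1%N)) // sum1_card card_ord.
Qed.

(** If [(b, i)] is not the last direction of its block in [corner h], the facets orthogonal to it
    are degenerate. If it is the last one, they are opposite hemispheres, where [W m] takes equal
    and [eps m] opposite values, so that one copy of [W m] survives. *)
Lemma sum_corner_face (h : B -> nat) b i m : (forall b, h b <= k)%N ->
  (\sum_b h b)%N = m.+1 -> (i < h b)%N ->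
  \sum_(x in cube (corner h :\ (b, i)))
    (eps m x * W m x + eps m (upd x (b, i) ord_max) * W m (upd x (b, i) ord_max)) =
  if h b == i.+1 then \sum_(x in cube (corner (cut h b))) W m x else 0.
Proof.
move=> hk hm ih.
have oddc x : x \in cube (corner h :\ (b, i)) ->
    [set d | odd (x d)] = corner h :\ (b, i).
  move=> /cubeP xS; apply/setP => d; rewrite [LHS]inE.
  by have := xS d; case: ifP => [_ ->|_ ->].
have cardc : #|corner h :\ (b, i)| = m.
  by move: hm; rewrite -card_corner // (cardsD1 (b, i)) inE ih => -[].
have ucube x : x \in cube (corner h :\ (b, i)) ->
    [set d | odd (upd x (b, i) ord_max d)] = corner h :\ (b, i).
  move=> xS; rewrite -(oddc x) //; apply/setP => d; rewrite !inE updE.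
  case: eqP => // ->; rewrite /= odd_double.
  by move/cubeP: xS => /(_ (b, i)); rewrite !inE eqxx => ->.
case: eqP => [hb|/eqP hb]; last first.
  (* The direction [i.+1] of the block is still free, while [(b, i)] is extremal. *)
  have il : (i.+1 < h b)%N by rewrite ltn_neqAle eq_sym hb.
  have il' := leq_trans il (hk b); pose l := Ordinal il'.
  have lS : (b, l) \in corner h :\ (b, i).
    by rewrite !inE /= xpair_eqE eqxx -(inj_eq val_inj) /= gtn_eqF.
  apply: big1 => x xS; have /setP/(_ (b, l)) := oddc _ xS; have /setP/(_ (b, l)) := ucube _ xS.
  rewrite lS !inE => ul xl.
  rewrite !(@W_degenerate m _ b i l) ?mulr0 ?addr0 ?ucube ?oddc //.
    by rewrite /extremal updE eqxx eqxx orbT.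
  by move/cubeP: xS => /(_ (b, i)); rewrite /extremal !inE eqxx => ->.
(* Reversing the earlier coordinates of the block permutes the cells of the facet and matches each
   cell at the maximal end with its antipode at 0. *)
rewrite corner_cut //; pose r x : cell :=
  [ffun d : D => if (d.1 == b) && (d.2 < i)%N then rev_ord (x d) else x d].
have rK : involutive r.
  by move=> x; apply/ffunP => d; rewrite !ffunE; case: ifP => c; rewrite c ?rev_ordK.
have rS x : (r x \in cube (corner (cut h b))) = (x \in cube (corner (cut h b))).
  suff H y : y \in cube (corner (cut h b)) -> r y \in cube (corner (cut h b)).
    by apply/idP/idP => /H //; rewrite rK.
  move=> /cubeP yS; apply/cubeP => d; have := yS d; rewrite ffunE inE /cut.
  case: eqP => [-> /=|//]; rewrite hb /=; case: (d.2 < i)%N => //=.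
  by rewrite subSS oddB ?odd_double // -ltnS.
rewrite big_split /= [X in _ + X](reindex_inj (inv_inj rK)) /=.
rewrite [X in _ + X](eq_bigl _ _ rS) -big_split; apply: eq_bigr => x xS /=.
have x0 l : (i <= l)%N -> x (b, l) = ord0.
  by move=> il; move/cubeP: xS => /(_ (b, l)); rewrite inE /cut eqxx hb /= ltnNge il.
have uE : upd (r x) (b, i) ord_max (b, i) = ord_max by rewrite updE eqxx.
have u0 l : (i < l)%N -> upd (r x) (b, i) ord_max (b, l) = ord0.
  move=> il; rewrite updE xpair_eqE eqxx -(inj_eq val_inj) /= gtn_eqF //.
  by rewrite ffunE /= ltnNge (ltnW il) andbF x0 // ltnW.
have aE : antipode b i (upd (r x) (b, i) ord_max) = x.
  apply/ffunP => -[b' l]; rewrite ffunE /= updE ffunE xpair_eqE /=.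
  case: eqP => [-> /=|//]; case: ltnP => [li|il]; last by rewrite x0.
  by rewrite -(inj_eq val_inj) ltn_eqF // rev_ordK.
rewrite (eps_antipode m uE u0) (W_antipode _ uE u0) aE.
by case: (eps m x); case: (W m x).
Qed.

(** The recursion of the multinomial coefficients: the sum is the coefficient mod 2 of the monomial
    with exponents [h b] in the power [m.+1] of the sum of the variables. *)
Lemma sum_corner (h : B -> nat) m : (forall b, h b <= k)%N -> (\sum_b h b)%N = m.+1 ->
  \sum_(x in cube (corner h)) W m.+1 x =
  \sum_(b | (0 < h b)%N) \sum_(x in cube (corner (cut h b))) W m x.
Proof.
move=> hk hm; under eq_bigr do rewrite WS.
rewrite sum_cobd.
rewrite (eq_bigr (fun d : D => if h d.1 == d.2.+1
  then \sum_(x in cube (corner (cut h d.1))) W m x else 0)); last first.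
  by move=> [b i]; rewrite inE => ih; exact: sum_corner_face.
rewrite (eq_bigl (fun d : D => (d.2 < h d.1)%N)); last by move=> d; rewrite inE.
rewrite -(pair_big_dep xpredT (fun b (l : 'I_k) => (l < h b)%N)
  (fun b l => if h b == l.+1 then \sum_(x in cube (corner (cut h b))) W m x else 0)) /=.
rewrite [RHS]big_mkcond; apply: eq_bigr => b _.
case hb : (h b) => [|n] /=; first by rewrite big_pred0.
have nk : (n < k)%N by rewrite -hb.
rewrite (bigD1 (Ordinal nk)) //= eqxx [X in _ + X]big1 ?addr0 // => l /andP[_ ln].
by case: eqP => // -[] E; move: ln; rewrite -(inj_eq val_inj) /= E eqxx.
Qed.

End Blocks.
Arguments corner {B k} h.

Section Faces.
Variables (D : finType) (M : nat).
Local Notation L := M.*2.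
Implicit Types (x y : cell D M) (d : D).

Definition face_of x y := forall d, y d = x d \/
  [/\ ~~ odd (y d) & (y d).+1 = x d :> nat \/ y d = (x d).+1 :> nat].

Lemma face_of_facet x y d b : face_of x y -> odd (y d) -> face_of x (facet y d b).
Proof.
move=> xy yd e; have [->|ed] := eqVneq e d; last by rewrite updE (negPf ed); exact: xy.
right; have fE := facetE b d yd; have := fE; rewrite eqxx => {}fE.
have := xy d; rewrite yd => -[ydE|[]//].
by rewrite -[x d]ydE fE; case: b {fE}; case: (nat_of_ord (y d)) yd => //= n ->; split=> //; [right|left].
Qed.

Lemma sum_W_faces (eps : nat -> cell D M -> bool) n (P : pred (cell D M)) :
  (forall x, P x -> forall d, odd (x d)) ->
  (forall x : cell D M, (forall d, odd (x d)) -> exists m v, (m < n)%N /\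
     forall y, face_of x y -> eps m y = v) ->
  \sum_(x | P x) W eps n x = 0.
Proof.
move=> Podd H; apply: big1 => x /Podd xodd; have [m [v [mn eE]]] := H x xodd.
apply: (@W_const _ _ eps (face_of x) m v) => //; last by left.
by move=> y d b; exact: face_of_facet.
Qed.

Lemma mem_cubeT x : (x \in cube [set: D]) = [forall d, odd (x d)].
Proof. by apply: eq_forallb => d; rewrite inE. Qed.

End Faces.

Section BorsukUlam.
Variables (B : finType) (k M : nat).
Local Notation D := (B * 'I_k)%type.
Variable eps : nat -> cell D M -> bool.

Lemma sum_corner0 : \sum_(x in cube (corner (fun _ : B => 0%N) : {set D})) W eps 0 x = 1.
Proof.
rewrite (big_pred1 [ffun=> ord0]) // => x; apply/cubeP/eqP => [x0|-> d].
  by apply/ffunP => d; have := x0 d; rewrite inE ffunE.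
by rewrite inE ffunE.
Qed.

End BorsukUlam.

Section OneBlock.
Variables (k M : nat).
Local Notation D := (unit * 'I_k)%type.
Variable eps : nat -> cell D M -> bool.
Hypothesis eps_degenerate : forall m (x : cell D M) (b : unit) (l l' : 'I_k) c, (l < l')%N ->
  extremal (x (b, l)) -> eps m (upd x (b, l') c) = eps m x.
Hypothesis eps_antipode : forall m (x : cell D M) b i, x (b, i) = ord_max ->
  (forall l : 'I_k, (i < l)%N -> x (b, l) = ord0) -> eps m x = ~~ eps m (antipode b i x).

Lemma sum_W1 n : (n <= k)%N -> \sum_(x in cube (corner (fun _ : unit => n) : {set D})) W eps n x = 1.
Proof.
elim: n => [|n IH] nk; first exact: sum_corner0.
rewrite (sum_corner eps_degenerate eps_antipode) //; last first.
  by rewrite (big_pred1 tt) // => -[].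
rewrite (big_pred1 tt) //=.
rewrite -(IH (ltnW nk)); apply: eq_bigl => x; congr (x \in cube _).
Qed.

(** The sum of [W eps k] over all top cells is 1 by [sum_W1], but each term is 0 when some sign is
    constant on the faces of the cell. *)
Lemma borsuk_ulam_signs :
  (forall x : cell D M, (forall d, odd (x d)) -> exists m v, (m < k)%N /\
     forall y, face_of x y -> eps m y = v) -> False.
Proof.
move=> H; have := sum_W1 (leqnn k).
rewrite (eq_bigl (fun x : cell D M => [forall d, odd (x d)])); last first.
  move=> x; rewrite -mem_cubeT; congr (x \in cube _).
  by apply/setP => -[b i]; rewrite !inE /= ltn_ord.
by rewrite (sum_W_faces _ H) // => x /forallP.
Qed.
End OneBlock.

(** * The symmetric count on two blocks *)

Section TwoBlocks.
Variables (k M : nat).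
Local Notation D := (bool * 'I_k)%type.
Implicit Types x y : cell D M.
Variable eps : nat -> cell D M -> bool.
Hypothesis eps_degenerate : forall m x (b : bool) (l l' : 'I_k) c, (l < l')%N ->
  extremal (x (b, l)) -> eps m (upd x (b, l') c) = eps m x.
Hypothesis eps_antipode : forall m (x : cell D M) b i, x (b, i) = ord_max ->
  (forall l : 'I_k, (i < l)%N -> x (b, l) = ord0) -> eps m x = ~~ eps m (antipode b i x).
Local Notation W := (W eps).

Lemma sum_W2 (h : bool -> nat) n : (forall b, h b <= k)%N -> (\sum_b h b)%N = n ->
  \sum_(x in cube (corner h : {set D})) W n x = odd 'C(n, h true).
Proof.
elim: n h => [|n IH] h hk hn.
  have h0 b : h b = 0%N.
    by move: hn; rewrite big_bool /=; case: b; lia.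
  rewrite h0 bin0 -[RHS](sum_corner0 eps); apply: eq_bigl => x; congr (x \in cube _).
  by apply/setP => d; rewrite !inE h0.
rewrite (sum_corner eps_degenerate eps_antipode) //.
have cutE b : (0 < h b)%N -> \sum_(x in cube (corner (cut h b) : {set D})) W n x =
    odd 'C(n, cut h b true).
  move=> hb; apply: IH.
    by move=> b'; rewrite /cut; have := hk b'; case: eqP => _; lia.
  by move: hn; rewrite !big_bool /cut; case: b hb => /=; lia.
rewrite (eq_bigr (fun b => odd 'C(n, cut h b true))) //.
rewrite big_mkcond big_bool /= /cut /=; move: hn; rewrite big_bool /=.
case: (h true) => [|a] /=; case: (h false) => [|c] /= hn.
- by move: hn.
- by rewrite add0r !bin0.
- have -> : a = n by lia.
  by rewrite addr0 !binn.
- by rewrite binS oddD addbC.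
Qed.

Definition swap_blocks x : cell D M := [ffun d : D => x (~~ d.1, d.2)].

Lemma swap_blocksK : involutive swap_blocks.
Proof. by move=> x; apply/ffunP => -[b i]; rewrite !ffunE /= negbK. Qed.

Hypothesis eps_swap : forall m x, eps m (swap_blocks x) = eps m x.

Lemma facet_swap x d b :
  swap_blocks (facet x d b) = facet (swap_blocks x) (~~ d.1, d.2) b.
Proof.
apply/ffunP => -[c i]; case: d => d j; rewrite !ffunE /= !xpair_eqE negbK.
by case: c; case: d.
Qed.

Lemma W_swap m x : W m (swap_blocks x) = W m x.
Proof.
elim: m x => // m IH x /=.
rewrite (reindex_inj (_ : injective (fun d : D => (~~ d.1, d.2)))) /=; last first.
  by move=> [b i] [c j] /= [/negb_inj -> ->].
apply: eq_big => [d|d xd]; first by rewrite ffunE /= negbK; case: d.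
by apply: eq_bigr => b _; rewrite -facet_swap IH !eps_swap.
Qed.

(* By symmetry the sum over all cells would only give 0 = 0; summing over one cell of each
   orbit of [swap_blocks] leaves a sum over the faces orthogonal to one block. *)
Definition block_lt x :=
  (enum_rank [ffun i => x (false, i)] < enum_rank [ffun i => x (true, i)])%N.

Lemma block_ltP x : block_lt x (+) block_lt (swap_blocks x) = (x != swap_blocks x).
Proof.
rewrite /block_lt; have xE b : [ffun i => swap_blocks x (b, i)] = [ffun i => x (~~ b, i)].
  by apply/ffunP => i; rewrite !ffunE.
rewrite !xE /=; set u := enum_rank _; set v := enum_rank _.
have -> : (x != swap_blocks x) = (u != v).
  rewrite (inj_eq enum_rank_inj); congr (~~ _); apply/eqP/eqP => [E|/ffunP E].
    by apply/ffunP => i; rewrite !ffunE [in LHS]E ffunE.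
  apply/ffunP => -[b i]; have := E i; rewrite !ffunE /=.
  by case: b => [/esym|].
by rewrite -(inj_eq val_inj) /=; case: ltngtP.
Qed.

(** Start from the sum of [W] over one cell per orbit, which is 0. Moving the faces orthogonal to
    block [false] to the swapped cell gives the faces orthogonal to block [true] of all non-diagonal
    cells, and the diagonal ones add 0. Telescoping in block [true] alone leaves exponents k and k -
    1, so C(2k-1, k-1) would be even. *)
Lemma sign_pattern_contra :
  odd 'C(k.*2.-1, k) -> (0 < k)%N ->
  (forall x y : cell D M, (forall d, odd (x d)) -> swap_blocks x = x -> face_of x y ->
     eps 0 y = false) ->
  (forall x : cell D M, (forall d, odd (x d)) -> exists m v, (m < k.*2)%N /\
     forall y, face_of x y -> eps m y = v) -> False.
Proof.
move=> Ck k0 Hdiag H.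
pose n := k.*2.-1; have nE : k.*2 = n.+1 by rewrite prednK ?double_gt0.
pose g x := eps n x * W n x.
pose Q x := [forall d, odd (x d)].
pose face b x := \sum_(i < k) \sum_(s : bool) g (facet x (b, i) s).
have gS x : g (swap_blocks x) = g x by rewrite /g W_swap eps_swap.
have faceS x : face false x = face true (swap_blocks x).
  by apply: eq_bigr => i _; apply: eq_bigr => s _; rewrite -gS facet_swap.
have QS x : Q (swap_blocks x) = Q x.
  apply/forallP/forallP => xo [b i]; have := xo (~~ b, i); rewrite ffunE //= ?negbK //.
have : \sum_(x | Q x && block_lt x) W n.+1 x = 0.
  by rewrite -nE (sum_W_faces _ H) // => x /andP[/forallP].
have WE x : Q x -> W n.+1 x = face false x + face true x.
  move=> /forallP xo; rewrite WS /cobd (eq_bigl xpredT); last by move=> d; rewrite xo.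
  transitivity (\sum_(d : D) \sum_(s : bool) g (facet x (d.1, d.2) s)).
    by apply: eq_bigr => -[].
  rewrite -(pair_bigA _ (fun b i => \sum_(s : bool) g (facet x (b, i) s))) /=.
  by rewrite big_bool addrC.
under eq_bigr => x /andP[Qx _] do rewrite WE // faceS.
rewrite big_split /= (reindex_inj (inv_inj swap_blocksK)) /=.
under eq_bigr do rewrite swap_blocksK.
under eq_bigl do rewrite QS.
have -> : \sum_(x | Q x && block_lt (swap_blocks x)) face true x +
          \sum_(x | Q x && block_lt x) face true x =
          \sum_(x | Q x && (x != swap_blocks x)) face true x.
  rewrite !big_mkcondr -big_split; apply: eq_bigr => x _ /=.
  rewrite -block_ltP; case: (block_lt x); case: (block_lt _) => //=;
    by rewrite ?addbool_eq0 ?add0r ?addr0.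
(* On a diagonal cell [eps 0] is constant, and [W n] involves [eps 0] because n = 2k - 1 > 0. *)
have : \sum_(x | Q x && (x == swap_blocks x)) face true x = 0.
  apply: big1 => x /andP[/forallP xo /eqP xS]; apply: big1 => i _; apply: big1 => s _.
  rewrite /g (@W_const _ _ eps (face_of x) 0 false) ?mulr0 //.
  - by move=> y d b; exact: face_of_facet.
  - by move=> y; apply: Hdiag.
  - by move: nE; case: k k0 => // k' _; rewrite doubleS => -[<-].
  - by apply: face_of_facet => //; left.
move=> D0 D1; have : \sum_(x | Q x) face true x = 0.
  by rewrite (bigID (fun x => x == swap_blocks x)) /= D0 D1 addr0.
rewrite (eq_bigl (fun x => x \in cube [set: D])); last by move=> x; rewrite mem_cubeT.
rewrite exchange_big /=.
have TE : [set: D] = corner (fun=> k) by apply/setP => d; rewrite !inE ltn_ord.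
have sk : (\sum_(b : bool) k)%N = n.+1 by rewrite big_bool /= addnn.
rewrite (eq_bigr (fun i : 'I_k => if k == i.+1
    then \sum_(x in cube (corner (cut (fun=> k) true))) W n x else 0)); last first.
  move=> i _; rewrite sum_faces ?inE // TE.
  rewrite -(sum_corner_face eps_degenerate eps_antipode (h := fun=> k)) //.
have k1 : (k.-1 < k)%N by rewrite ltn_predL.
rewrite (bigD1 (Ordinal k1)) //= prednK // eqxx [X in _ + X]big1 ?addr0; last first.
  move=> i ik; case: eqP => // kE; case/eqP: ik; apply/val_inj; exact: (congr1 predn (esym kE)).
rewrite sum_W2 => [|b|]; last 2 first.
- by rewrite /cut; case: eqP => _ //; exact: leq_pred.
- by move: nE; rewrite big_bool /cut /=; case: k k0 => // k' _; rewrite doubleS /= -addnn; lia.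
rewrite /cut eqxx => C0.
have nk : (n - k = k.-1)%N by rewrite /n; lia.
by move: C0; rewrite -nk bin_sub ?Ck // /n; lia.
Qed.

End TwoBlocks.

Local Open Scope classical_set_scope.
Local Open Scope ring_scope.

(** * Norms, compactness and dot products of row vectors *)

Lemma rV_norm_lt (R : realType) n (x : 'rV[R]_n) e : 0 < e ->
  (forall i, `|x 0 i| < e) -> `|x| < e.
Proof.
move=> e0 xe; rewrite [ltLHS]/Num.Def.normr /= mx_normrE.
by apply/bigmax_ltP; split=> // -[i j] _ /=; rewrite ord1.
Qed.

Lemma rV_norm_le (R : realType) n (x : 'rV[R]_n) e : 0 <= e ->
  (forall i, `|x 0 i| <= e) -> `|x| <= e.
Proof.
move=> e0 xe; rewrite [leLHS]/Num.Def.normr /= mx_normrE.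
by apply/bigmax_leP; split=> // -[i j] _ /=; rewrite ord1.
Qed.

Lemma le_coord_norm (R : realType) n (x : 'rV[R]_n) i : `|x 0 i| <= `|x|.
Proof.
rewrite [leRHS]/Num.Def.normr /= mx_normrE.
by apply/bigmax_geP; right => /=; exists (0, i).
Qed.

Lemma near_closeP (R : realType) (V W : normedModType R) (f : V -> W) x e :
  {for x, continuous f} -> 0 < e ->
  exists2 d, 0 < d & forall y, `|y - x| < d -> `|f y - f x| < e.
Proof.
move=> cf e0; have /cvgrPdist_lt/(_ e e0) := cf.
rewrite near_simpl => /nbhs_ballP[d d0 xd]; exists d => // y yx.
by rewrite distrC; apply: xd; rewrite -ball_normE /= distrC.
Qed.

Lemma near_same_sign (R : realType) (V : normedModType R) (f : V -> R) x :
  {for x, continuous f} -> f x != 0 ->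
  exists2 d, 0 < d & forall y, `|y - x| < d -> 0 < f x * f y.
Proof.
move=> cf fx; have [|d d0 dP] := near_closeP cf (e := `|f x|); first by rewrite normr_gt0.
exists d => // y /dP; rewrite ltr_distl; have [fx0|fx0] := ltP 0 (f x).
  by rewrite gtr0_norm // subrr => /andP[? _]; rewrite mulr_gt0.
rewrite ler0_norm // opprK subrr => /andP[_ ?].
by rewrite nmulr_rgt0 // lt_neqAle fx.
Qed.

Lemma continuous_norm_comp (R : realType) (T : topologicalType) (V : normedModType R)
    (f : T -> V) x :
  {for x, continuous f} -> {for x, continuous (fun y => `|f y| : R)}.
Proof.
by move=> cf; apply: (@continuous_comp _ _ _ f Num.norm); [exact: cf|exact: norm_continuous].
Qed.

Lemma compact_norm_ball (R : realType) n (y0 : 'rV[R]_n) r :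
  compact [set y : 'rV[R]_n | `|y - y0| <= r].
Proof.
apply: bounded_closed_compact.
  exists (`|y0| + r); split; first exact: num_real.
  move=> B HB y yr; apply: ltW; apply: le_lt_trans HB.
  by rewrite -[y](subrK y0) addrC (le_trans (ler_normD _ _)) // lerD2l.
rewrite (_ : [set y | _] = (fun y : 'rV[R]_n => `|y - y0|) @^-1` [set t | t <= r]) //.
apply: closed_comp; last exact: closed_le.
move=> y _; apply: (@continuous_norm_comp _ _ _ (fun y : 'rV[R]_n => y - y0)).
by apply: continuousB; [exact: cvg_id|exact: cst_continuous].
Qed.

Lemma open_norm_ball (R : realType) n (y0 : 'rV[R]_n) r : open [set y : 'rV[R]_n | `|y - y0| < r].
Proof.
rewrite (_ : [set y | _] = ball y0 r); first exact: ball_open.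
by apply/seteqP; split=> y; rewrite -ball_normE /= distrC.
Qed.

Lemma compact_norm_sphere (R : realType) n : compact [set y : 'rV[R]_n | `|y| = 1].
Proof.
apply: (@subclosed_compact _ _ [set y : 'rV[R]_n | `|y - 0| <= 1]).
- rewrite (_ : [set y | _] = Num.norm @^-1` [set 1 : R]) //.
  by apply: closed_comp; [move=> y _; exact: norm_continuous|exact: closed_eq].
- exact: compact_norm_ball.
- by move=> y /= y1; rewrite subr0 y1.
Qed.

Lemma continuous_bigprod (R : realType) (T : topologicalType) (I : Type) (r : seq I)
    (P : pred I) (f : I -> T -> R) x : (forall i, {for x, continuous (f i)}) ->
  {for x, continuous (fun y => \prod_(i <- r | P i) f i y)}.
Proof.
move=> cf; elim: r => [|i r IH].
  rewrite (_ : (fun y => _) = fun=> 1); first exact: cst_continuous.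
  by apply/funext => y; rewrite big_nil.
rewrite (_ : (fun y => _) = if P i then (fun y => f i y * \prod_(i <- r | P i) f i y)
  else (fun y => \prod_(i <- r | P i) f i y)).
  by case: (P i) => //; apply: continuousM => //; exact: cf.
by apply/funext => y; rewrite big_cons; case: (P i).
Qed.

Lemma continuous_bigsum (R : realType) (T : topologicalType) (I : Type) (r : seq I)
    (f : I -> T -> R) x : (forall i, {for x, continuous (f i)}) ->
  {for x, continuous (fun y => \sum_(i <- r) f i y)}.
Proof.
move=> cf; elim: r => [|i r IH].
  rewrite (_ : (fun y => _) = fun=> 0); first exact: cst_continuous.
  by apply/funext => y; rewrite big_nil.
rewrite (_ : (fun y => _) = (fun y => f i y + \sum_(i <- r) f i y)).
  by apply: continuousD => //; exact: cf.
by apply/funext => y; rewrite big_cons.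
Qed.

Section Dotv.
Variables (R : realType) (n : nat).
Implicit Types (a : R) (u v w : 'rV[R]_n).

Lemma dotvC u v : dotv u v = dotv v u.
Proof. by apply: eq_bigr => i _; rewrite mulrC. Qed.

Lemma dotvDl u v w : dotv (u + v) w = dotv u w + dotv v w.
Proof. by rewrite -big_split; apply: eq_bigr => i _; rewrite mxE mulrDl. Qed.

Lemma dotvDr u v w : dotv u (v + w) = dotv u v + dotv u w.
Proof. by rewrite !(dotvC u) dotvDl. Qed.

Lemma dotvZl a u v : dotv (a *: u) v = a * dotv u v.
Proof. by rewrite mulr_sumr; apply: eq_bigr => i _; rewrite mxE mulrA. Qed.

Lemma dotvZr a u v : dotv u (a *: v) = a * dotv u v.
Proof. by rewrite dotvC dotvZl dotvC. Qed.

Lemma dotvNl u v : dotv (- u) v = - dotv u v.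
Proof. by rewrite -scaleN1r dotvZl mulN1r. Qed.

Lemma dotvNr u v : dotv u (- v) = - dotv u v.
Proof. by rewrite dotvC dotvNl dotvC. Qed.

Lemma dotvBl u v w : dotv (u - v) w = dotv u w - dotv v w.
Proof. by rewrite dotvDl dotvNl. Qed.

Lemma dotvBr u v w : dotv u (v - w) = dotv u v - dotv u w.
Proof. by rewrite dotvDr dotvNr. Qed.

Lemma dotv0l u : dotv 0 u = 0.
Proof. by rewrite /dotv big1 // => i _; rewrite mxE mul0r. Qed.

Lemma dotv0r u : dotv u 0 = 0.
Proof. by rewrite dotvC dotv0l. Qed.

Lemma dotv_suml (I : Type) (r : seq I) (f : I -> 'rV[R]_n) u :
  dotv (\sum_(i <- r) f i) u = \sum_(i <- r) dotv (f i) u.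
Proof.
elim: r => [|i r IH]; first by rewrite !big_nil dotv0l.
by rewrite !big_cons dotvDl IH.
Qed.

Lemma dotv_eq0 u : (dotv u u == 0) = (u == 0).
Proof.
apply/eqP/eqP => [u0|->]; last exact: dotv0l.
apply/rowP => j; rewrite mxE; apply/eqP; rewrite -sqrf_eq0 expr2; apply/eqP.
by apply: (psumr_eq0P _ u0) => // l _; rewrite -expr2 sqr_ge0.
Qed.

Lemma dotv_gt0 u : (0 < dotv u u) = (u != 0).
Proof. by rewrite lt_neqAle dotv_ge0 andbT eq_sym dotv_eq0. Qed.

Lemma dotv_continuous_comp (T : topologicalType) (f g : T -> 'rV[R]_n) x :
  {for x, continuous f} -> {for x, continuous g} ->
  {for x, continuous (fun y => dotv (f y) (g y))}.
Proof.
move=> cf cg; apply: continuous_bigsum => i; apply: continuousM.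
  by apply: (@continuous_comp _ _ _ f (fun z : 'rV[R]_n => z 0 i : R)) => //; exact: coord_continuous.
by apply: (@continuous_comp _ _ _ g (fun z : 'rV[R]_n => z 0 i : R)) => //; exact: coord_continuous.
Qed.

Lemma dotv_sign u v : dotv u v != 0 -> exists2 d, 0 < d &
  forall u' v', `|u' - u| < d -> `|v' - v| < d -> 0 < dotv u v * dotv u' v'.
Proof.
move=> uv0; have c : {for (u, v), continuous (fun p : 'rV[R]_n * 'rV[R]_n => dotv p.1 p.2)}.
  by apply: dotv_continuous_comp; [exact: cvg_fst|exact: cvg_snd].
have [d d0 dP] := near_same_sign c uv0.
exists d => // u' v' ud vd; have := dP (u', v'); rewrite prod_normE gt_max /= ud vd; exact.
Qed.
End Dotv.

(** * Borsuk-Ulam theorems *)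

Section SphereParam.
Variables (R : realType) (k : nat).
Local Notation V := 'rV[R]_k.+1.
Implicit Types t : 'I_k -> R.

(* The coordinates are 1 - 2 t_0, s_0 (1 - 2 t_1), s_0 s_1 (1 - 2 t_2), ... with
   s_l = t_l (1 - t_l).  If t_i is 0 or 1 then the later t_l do not matter; if t_i = 1,
   putting 0 for t_i and 1 - t_l for t_l with l < i gives the opposite point. *)
Definition sphere_param t : V :=
  \row_(m < k.+1) ((\prod_(l < k | (l < m)%N) (t l * (1 - t l))) *
    (if insub (val m) is Some l then 1 - 2 * t l else 1)).

Lemma sphere_param_in t (i : 'I_k) (m : 'I_k.+1) : i = m :> nat ->
  sphere_param t 0 m = (\prod_(l < k | (l < m)%N) (t l * (1 - t l))) * (1 - 2 * t i).
Proof.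
move=> im; rewrite mxE; case: insubP => [j _ jm|]; last by rewrite /= -im ltn_ord.
by congr (_ * (1 - 2 * t _)); apply/val_inj; rewrite /= jm im.
Qed.

(** If all coordinates but the last vanish, every t_l is 1/2, and then the last one, the product of
    the t_l (1 - t_l), is not 0. Only this is needed of a point of the sphere, as signs do not
    depend on its length. *)
Lemma sphere_param_neq0 t : sphere_param t != 0.
Proof.
apply/eqP => t0.
have H n : (n <= k)%N -> \prod_(l < k | (l < n)%N) (t l * (1 - t l)) != 0.
  elim: n => [|n IH] nk; first by rewrite big_pred0 ?oner_eq0.
  have {}IH := IH (ltnW nk); have nk' : (n < k.+1)%N by rewrite ltnW.
  rewrite (bigD1 (Ordinal nk)) //= mulf_neq0 //; last first.
    rewrite (eq_bigl (fun l : 'I_k => (l < n)%N)) // => l.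
    by rewrite -(inj_eq val_inj) /= ltnS ltn_neqAle andbC.
  have := sphere_param_in t (i := Ordinal nk) (m := Ordinal nk') erefl.
  rewrite t0 mxE /= => /esym/eqP; rewrite mulf_eq0 (negPf IH) /= => /eqP tn.
  by apply: mulf_neq0; apply/eqP; lra.
have /eqP Hk := H k (leqnn k); have /rowP/(_ ord_max) := t0.
by rewrite !mxE insubF ?ltnn // mulr1 => E; case: Hk.
Qed.

Lemma sphere_param_degenerate t t' (l l' : 'I_k) : (l < l')%N ->
  t l * (1 - t l) = 0 -> (forall i, i != l' -> t' i = t i) ->
  sphere_param t' = sphere_param t.
Proof.
move=> ll tl tt'; apply/rowP => m; rewrite !mxE.
have [lm|ml] := ltnP l m.
  rewrite !(bigD1 (P := fun i : 'I_k => (i < m)%N) l) //= tt' ?tl ?mul0r //.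
  by rewrite -(inj_eq val_inj) /= ltn_eqF.
congr (_ * _).
  by apply: eq_bigr => i im; rewrite tt' // -(inj_eq val_inj) /= ltn_eqF //; lia.
case: insubP => // i _ im; rewrite tt' // -(inj_eq val_inj) /= ltn_eqF //.
by rewrite im; exact: leq_ltn_trans ml ll.
Qed.

Lemma sphere_param_antipode t t' (i : 'I_k) :
  (forall l, t' l = if (l < i)%N then 1 - t l else 0) -> t i = 1 ->
  sphere_param t' = - sphere_param t.
Proof.
move=> tt' ti; apply/rowP => m; rewrite !mxE.
have [im|mi] := ltnP i m.
  by rewrite !(bigD1 (P := fun i : 'I_k => (i < m)%N) i) //= tt' ti ltnn; ring.
rewrite -mulrN; congr (_ * _).
  by apply: eq_bigr => l lm; rewrite tt' (leq_trans lm) //; ring.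
case: insubP => [j _ jm|]; last by rewrite (leq_ltn_trans mi (ltn_ord i)).
rewrite tt' jm; case: ltnP => [_|im]; first by ring.
have -> : j = i by apply/val_inj/eqP; rewrite eqn_leq /= [in X in X && _]jm mi jm.
by rewrite ti; ring.
Qed.

Lemma sphere_param_continuous N (a : 'I_k -> 'I_N) (T : 'rV[R]_N) :
  {for T, continuous (fun T : 'rV[R]_N => sphere_param (fun l => T 0 (a l)))}.
Proof.
apply: continuous_row => m.
rewrite (_ : (fun y => _) = fun y : 'rV[R]_N =>
  (\prod_(l < k | (l < m)%N) (y 0 (a l) * (1 - y 0 (a l)))) *
    (if insub (val m) is Some l then 1 - 2 * y 0 (a l) else 1)); last first.
  by apply/funext => y; rewrite mxE.
have cc l : {for T, continuous (fun y : 'rV[R]_N => y 0 (a l) : R)}.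
  exact: coord_continuous.
apply: (@continuousM R 'rV[R]_N (fun y => \prod_(l < k | (l < m)%N) (y 0 (a l) * (1 - y 0 (a l))))).
  apply: continuous_bigprod => l; apply: continuousM => //.
  by apply: (@continuousB R R _ (fun=> 1)) => //; exact: cst_continuous.
case: insub => [l|]; last exact: cst_continuous.
apply: (@continuousB R R _ (fun=> 1)); first exact: cst_continuous.
by apply: (@continuousM R 'rV[R]_N (fun=> 2)) => //; exact: cst_continuous.
Qed.
End SphereParam.

Section LexSign.
Variables (R : realType) (n : nat).
Implicit Types v : 'rV[R]_n.

Definition lex_neg v := [exists i, (v 0 i < 0) && [forall j : 'I_n, (j < i)%N ==> (v 0 j == 0)]].

Lemma lex_negN v : v != 0 -> lex_neg (- v) = ~~ lex_neg v.
Proof.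
move=> v0; have /existsP[i0 vi0] : [exists i, v 0 i != 0].
  rewrite -[X in is_true X]negbK negb_exists; apply: contra v0 => /forallP v0.
  by apply/eqP/rowP => i; rewrite mxE; apply/eqP; move: (v0 i); rewrite negbK.
have [i vi imin] := @arg_minnP _ i0 (fun i => v 0 i != 0) (fun i => val i) vi0.
have vj (j : 'I_n) : (j < i)%N -> v 0 j = 0.
  by move=> ji; apply/eqP; apply: contraLR ji => /imin; rewrite -leqNgt.
have lexE (w : 'rV[R]_n) : (forall j, (w 0 j == 0) = (v 0 j == 0)) -> lex_neg w = (w 0 i < 0).
  move=> wv; apply/existsP/idP => [[j /andP[wj /forallP wjl]]|wi]; last first.
    exists i; rewrite wi; apply/forallP => j; apply/implyP => ji.
    by rewrite wv; apply/eqP; exact: vj.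
  have [ij|ji|/val_inj -> //] := ltngtP i j.
    by move: (wjl i); rewrite ij wv (negPf vi).
  by move: wj; rewrite lt_neqAle wv vj // eqxx.
rewrite !lexE // => [|j]; last by rewrite mxE oppr_eq0.
by rewrite mxE oppr_lt0 -leNgt le_eqVlt eq_sym (negPf vi).
Qed.
End LexSign.

Section SignFunctions.
Variables (R : realType) (k : nat) (B : finType).
Local Notation V := 'rV[R]_k.+1.
Local Notation D := (B * 'I_k)%type.
Local Notation T := 'rV[R]_#|{: B * 'I_k}|.
Variable F : nat -> (B -> V) -> R.

Definition neg_at (u : B -> V) b : B -> V := fun b' => if b' == b then - u b' else u b'.

Hypothesis F_odd : forall m u b, F m (neg_at u b) = - F m u.

Definition torus_point (t : T) (b : B) : V :=
  sphere_param (fun l => t 0 (enum_rank (b, l))).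

Definition grid_point M (x : cell D M) : T :=
  \row_j ((x (enum_val j))%:R / M.*2%:R).

(* Breaking ties with [lex_neg] keeps the sign odd where [F m] vanishes. *)
Definition sign_of m (u : B -> V) : bool :=
  if F m u == 0 then \sum_b (lex_neg (u b) : bool) else F m u < 0.

Lemma sign_ofN m u b : u b != 0 -> sign_of m (neg_at u b) = ~~ sign_of m u.
Proof.
move=> ub; rewrite /sign_of F_odd oppr_eq0; case: eqP => [_|/eqP F0]; last first.
  by rewrite oppr_lt0 -leNgt le_eqVlt eq_sym (negPf F0).
rewrite (bigD1 b) //= [in RHS](bigD1 b) //= {1}/neg_at eqxx lex_negN //.
rewrite (eq_bigr (fun b' => lex_neg (u b'))); last first.
  by move=> b' /negPf b'b; rewrite /neg_at b'b.
by case: (lex_neg (u b)); case: (\sum_(_ | _) _).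
Qed.

Definition grid_sign M m (x : cell D M) := sign_of m (torus_point (grid_point x)).

Lemma torus_point_grid M (x : cell D M) b :
  torus_point (grid_point x) b = sphere_param (fun l => (x (b, l))%:R / M.*2%:R : R).
Proof. by congr sphere_param; apply/funext => l; rewrite mxE enum_rankK. Qed.

Lemma grid_sign_degenerate M m (x : cell D M) b (l l' : 'I_k) c : (0 < M)%N ->
  (l < l')%N -> extremal (x (b, l)) -> grid_sign m (upd x (b, l') c) = grid_sign m x.
Proof.
move=> M0 ll xl; congr (sign_of m _); apply/funext => b'; rewrite !torus_point_grid.
have [->|bb] := eqVneq b' b; last first.
  by congr sphere_param; apply/funext => i; rewrite updE xpair_eqE (negPf bb).
apply: (sphere_param_degenerate ll).
  have M1 : M.*2%:R != 0 :> R by rewrite pnatr_eq0 double_eq0 -lt0n.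
  by case/orP: xl => /eqP -> /=; rewrite ?mul0r // divff // subrr mulr0.
by move=> i il; rewrite updE xpair_eqE eqxx (negPf il).
Qed.

Lemma grid_sign_antipode M m (x : cell D M) b (i : 'I_k) : (0 < M)%N ->
  x (b, i) = ord_max -> (forall l : 'I_k, (i < l)%N -> x (b, l) = ord0) ->
  grid_sign m x = ~~ grid_sign m (antipode b i x).
Proof.
move=> M0 xi x0; have M1 : M.*2%:R != 0 :> R by rewrite pnatr_eq0 double_eq0 -lt0n.
rewrite /grid_sign -(@sign_ofN m _ b); last first.
  by rewrite torus_point_grid sphere_param_neq0.
congr (sign_of m _); apply/funext => b'; rewrite /neg_at !torus_point_grid.
case: eqP => [->|bb]; last first.
  by congr sphere_param; apply/funext => l; rewrite ffunE /=; case: eqP bb.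
rewrite -[LHS]opprK; congr (- _); apply/esym.
apply: (@sphere_param_antipode _ _ _ _ i); last by rewrite xi divff.
move=> l; rewrite ffunE /= eqxx; case: ltnP => _; last by rewrite mul0r.
by rewrite /= subSS natrB ?mulrBl ?divff // -ltnS.
Qed.

Lemma torus_point_continuous b (t : T) : {for t, continuous (fun t => torus_point t b)}.
Proof. exact: (sphere_param_continuous (a := fun l => enum_rank (b, l))). Qed.

Definition torus_box : set T := [set t | forall j, `[0, 1]%classic (t ord0 j)].

Lemma torus_box_compact : compact torus_box.
Proof.
have := @rV_compact R _ (fun _ : 'I_#|{: B * 'I_k}| => `[0, 1]%classic).
apply => _; exact: segment_compact.
Qed.

(** A Lebesgue number for the sets where one sign is constant. Strict positivity of the product also
    excludes the ties in [sign_of]. *)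
Lemma uniform_sign n (K : set T) : compact K ->
  (forall t, K t -> exists m d, [/\ (m < n)%N, 0 < d &
     forall u, (forall b, `|u b - torus_point t b| < d) ->
       0 < F m (torus_point t) * F m u]) ->
  exists2 d, 0 < d & forall t, K t ->
  exists m v, (m < n)%N /\ forall t', `|t' - t| < d -> sign_of m (torus_point t') = v.
Proof.
(* Compactness is used as a near-covering property along the filter of positive reals tending to 0,
   which directly provides one radius valid on [K]. *)
move=> /compact_near_coveringP/(_ _ _ (fun d t => exists m v, (m < n)%N /\
    forall t', `|t' - t| < d -> sign_of m (torus_point t') = v)
    (at_right_proper_filter (0 : R))) cK F_sign.
case: cK => [t Kt|e /= e0 He]; last first.
  exists (e / 2); first by rewrite divr_gt0.
  by apply: He; rewrite ?divr_gt0 //= sub0r normrN gtr0_norm ?divr_gt0 //; lra.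
have [m [d [mn d0 Fd]]] := F_sign t Kt.
have [r r0 rP] : exists2 r, 0 < r & forall t', `|t' - t| < r ->
    forall b, `|torus_point t' b - torus_point t b| < d.
  have /choice[r rP] b : exists r, 0 < r /\ forall t', `|t' - t| < r ->
      `|torus_point t' b - torus_point t b| < d.
    by have [r r0 rP] := near_closeP (@torus_point_continuous b t) d0; exists r.
  exists (\big[Order.min/1]_b r b).
    by elim/big_ind : _ => // [x y x0 y0|b _]; [rewrite lt_min x0|case: (rP b)].
  move=> t' tr b; apply: (rP b).2; apply: lt_le_trans tr _.
  by rewrite (bigD1 b) //= ge_min lexx.
have r2 : 0 < r / 2 by rewrite divr_gt0.
exists ([set t' | `|t' - t| < r / 2], [set e | 0 < e < r / 2]) => /=.
  split; first by apply/nbhs_ballP; exists (r / 2) => // t'; rewrite -ball_normE /= distrC.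
  exists (r / 2) => // e /=; rewrite sub0r normrN => er e0.
  by rewrite e0 (le_lt_trans (ler_norm _) er).
move=> [t1 e] /= [t1t /andP[e0 er]]; exists m, (F m (torus_point t) < 0); split => //.
move=> t' t't1; have := Fd (torus_point t') (rP t' _).
have -> : `|t' - t| < r.
  rewrite -(subrK t1 t') -addrA (le_lt_trans (ler_normD _ _)) //.
  by rewrite (splitr r) ltrD // (lt_trans t't1).
move=> /(_ isT) FF; rewrite /sign_of; case: eqP => [F0|_]; first by move: FF; rewrite F0 mulr0 ltxx.
apply/idP/idP => F0.
  by move: FF; rewrite nmulr_lgt0.
by move: FF; rewrite nmulr_rgt0.
Qed.

Lemma grid_point_box M (x : cell D M) : (0 < M)%N -> torus_box (grid_point x).
Proof.
move=> M0 j; have M1 : 0 < M.*2%:R :> R by rewrite ltr0n double_gt0.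
rewrite /= mxE in_itv /= divr_ge0 ?ler0n //= ler_pdivrMr // mul1r ler_nat.
by rewrite -ltnS.
Qed.

Lemma grid_point_face M (x y : cell D M) d : (0 < M)%N -> M%:R^-1 < d -> face_of x y ->
  `|grid_point y - grid_point x| < d.
Proof.
move=> M0 Md xy; have M1 : 0 < M%:R :> R by rewrite ltr0n.
have d0 : 0 < d by apply: lt_trans Md; rewrite invr_gt0.
apply: rV_norm_lt => // j; rewrite !mxE -mulrBl normrM.
rewrite [X in _ * X]gtr0_norm ?invr_gt0 ?ltr0n ?double_gt0 //.
apply: le_lt_trans Md; rewrite ler_pdivrMr ?ltr0n ?double_gt0 //.
have -> : M%:R^-1 * M.*2%:R = 2 :> R.
  by rewrite -[M.*2]muln2 natrM mulrA mulVf ?mul1r ?gt_eqF.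
have [->|[_ [E|E]]] := xy (enum_val j); first by rewrite subrr normr0.
  by rewrite -E -natr1 opprD addrA subrr sub0r normrN normr1; lra.
by rewrite E -natr1 addrAC subrr add0r normr1; lra.
Qed.

Lemma ex_grid d : 0 < d -> exists2 M, (0 < M)%N & M%:R^-1 < d :> R.
Proof.
move=> d0; exists (Num.bound d^-1).+1 => //.
rewrite -[d]invrK ltf_pV2 ?posrE ?invr_gt0 ?ltr0n // invrK.
have d1 : 0 <= d^-1 by rewrite invr_ge0 ltW.
by apply: lt_trans (archi_boundP d1) _; rewrite ltr_nat.
Qed.

End SignFunctions.

Lemma borsuk_ulam (R : realType) k (F : nat -> 'rV[R]_k.+1 -> R) :
  (forall m u, F m (- u) = - F m u) ->
  (forall u, u != 0 -> exists m d, [/\ (m < k)%N, 0 < d &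
     forall u', `|u' - u| < d -> 0 < F m u * F m u']) -> False.
Proof.
move=> F_odd F_sign.
pose G m (u : unit -> 'rV[R]_k.+1) := F m (u tt).
have G_odd m u b : G m (neg_at u b) = - G m u by rewrite /G /neg_at -F_odd; case: b.
have [d d0 dP] : exists2 d, 0 < d & forall t, torus_box t -> exists m v, (m < k)%N /\
    forall t', `|t' - t| < d -> sign_of G m (torus_point t') = v.
  apply: uniform_sign => [|t _]; first exact: torus_box_compact.
  have [m [d [mk d0 mP]]] := F_sign (torus_point t tt) (sphere_param_neq0 _).
  by exists m, d; split=> // u ud; apply: mP; exact: ud.
have [M M0 Md] := ex_grid d0.
apply: (@borsuk_ulam_signs k M (@grid_sign R k unit G M)).
- by move=> m x b l l' c; exact: grid_sign_degenerate.
- by move=> m x b i; exact: grid_sign_antipode.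
- move=> x _; have [m [v [mk mv]]] := dP _ (@grid_point_box R k unit M x M0); exists m, v; split=> // y xy.
  by apply: mv; exact: grid_point_face.
Qed.

(* The last hypothesis says that the [F m u v] with [m < k.*2] are continuous and without
   common zero on nonzero vectors. *)
Lemma symmetric_borsuk_ulam (R : realType) k
    (F : nat -> 'rV[R]_k.+1 -> 'rV[R]_k.+1 -> R) :
  (0 < k)%N -> odd 'C(k.*2.-1, k) ->
  (forall u v, F 0 u v = dotv u v) ->
  (forall m u v, F m (- u) v = - F m u v) ->
  (forall m u v, F m u v = F m v u) ->
  (forall u v, u != 0 -> v != 0 -> exists m d, [/\ (m < k.*2)%N, 0 < d &
     forall u' v', `|u' - u| < d -> `|v' - v| < d -> 0 < F m u v * F m u' v']) -> False.
Proof.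
move=> k0 Ck F0 F_odd F_sym F_sign.
pose G m (u : bool -> 'rV[R]_k.+1) := F m (u false) (u true).
have G_odd m u b : G m (neg_at u b) = - G m u.
  by rewrite /G /neg_at; case: b => /=; [rewrite F_sym F_odd F_sym|rewrite F_odd].
have [d d0 dP] : exists2 d, 0 < d & forall t, torus_box t -> exists m v, (m < k.*2)%N /\
    forall t', `|t' - t| < d -> sign_of G m (torus_point t') = v.
  apply: uniform_sign => [|t _]; first exact: torus_box_compact.
  have [m [d [mk d0 mP]]] := F_sign (torus_point t false) (torus_point t true)
    (sphere_param_neq0 _) (sphere_param_neq0 _).
  by exists m, d; split=> // u ud; apply: mP; exact: ud.
pose diag (s : 'rV[R]_k) : 'rV[R]_#|{: bool * 'I_k}| := \row_j s 0 (enum_val j).2.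
(* The first application of [uniform_sign] does not control which sign is constant. On the compact
   diagonal the bound [m < 1] forces the sign of [F 0]. *)
have [e e0 eP] : exists2 d, 0 < d & forall t,
    (diag @` [set s : 'rV[R]_k | forall j, `[0, 1]%classic (s ord0 j)]) t ->
    exists m v, (m < 1)%N /\
    forall t', `|t' - t| < d -> sign_of G m (torus_point t') = v.
  apply: uniform_sign => [|t [s _ <-]].
    apply: continuous_compact; last first.
      have := @rV_compact R _ (fun _ : 'I_k => `[0, 1]%classic).
      by apply => _; exact: segment_compact.
    apply: continuous_subspaceT => s; apply: continuous_row => j.
    rewrite (_ : (fun y => _) = fun y : 'rV[R]_k => y 0 (enum_val j).2).
      exact: coord_continuous.
    by apply/funext => y; rewrite mxE.
  set u := torus_point _; have uE : u true = u false.
    by congr sphere_param; apply/funext => l; rewrite !mxE !enum_rankK.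
  have [|e e0 eP] := @dotv_sign _ _ (u false) (u true).
    by rewrite uE gt_eqF // dotv_gt0 sphere_param_neq0.
  by exists 0%N, e; split=> // u' u'e; rewrite /G !F0 eP.
have [M M0 Md] : exists2 M, (0 < M)%N & M%:R^-1 < Order.min d e.
  by apply: ex_grid; rewrite lt_min d0.
move: Md; rewrite lt_min => /andP[Md Me].
apply: (@sign_pattern_contra k M (@grid_sign R k bool G M)) => //.
- by move=> m x b l l' c; exact: grid_sign_degenerate.
- by move=> m x b i; exact: grid_sign_antipode.
- move=> m x; rewrite /grid_sign /sign_of.
  have sE b : torus_point (grid_point R (swap_blocks x)) b =
      torus_point (grid_point R x) (~~ b) :> 'rV[R]_k.+1.
    by rewrite !torus_point_grid; congr sphere_param; apply/funext => l; rewrite ffunE.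
  rewrite /G !sE /= F_sym; congr (if _ then _ else _).
  by rewrite !big_bool /= !sE addrC.
- move=> x y _ xS xy; have [|m [v [m1 vP]]] := eP (grid_point R x).
    exists (\row_l ((x (true, l))%:R / M.*2%:R)).
      move=> l; rewrite /= mxE; have := @grid_point_box R k bool M x M0 (enum_rank (true, l)).
      by rewrite /= mxE enum_rankK.
    apply/rowP => j; rewrite !mxE; case: (enum_val j) => -[] l //=.
    by rewrite -[in RHS]xS ffunE.
  have {m1} m0 : m = 0%N by case: m m1 {vP}.
  rewrite {}m0 in vP; rewrite /grid_sign (vP _ (grid_point_face M0 Me xy)).
  rewrite -(vP (grid_point R x)) ?subrr ?normr0 // /sign_of /G F0.
  have -> : torus_point (grid_point R x) true = torus_point (grid_point R x) false :> 'rV[R]_k.+1.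
    by rewrite !torus_point_grid; congr sphere_param; apply/funext => l; rewrite -[in RHS]xS ffunE.
  by rewrite gt_eqF ?dotv_gt0 ?sphere_param_neq0 //; apply/negbTE; rewrite -leNgt dotv_ge0.
- move=> x _; have [m [v [mk mv]]] := dP _ (@grid_point_box R k bool M x M0); exists m, v; split=> // y xy.
  by apply: mv; exact: grid_point_face.
Qed.

(** * Projective spaces do not embed in small spheres *)

Section LineFunctions.
Variables (R : realType) (k : nat).
Implicit Types (g : projective R k -> R) (x : 'rV[R]_k.+1).

Lemma nonzero_mem x : x != 0 -> x \in @nonzero_vector R k.
Proof. by move=> x0; rewrite inE. Qed.

(** [g] as a function of vectors, homogeneous of degree 0; the value at the origin is arbitrary. *)
Definition homog_ext g x : R :=
  if boolP (x != 0) is AltTrue x0 then g (line_of (SigSub (nonzero_mem x0))) else 0.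

Lemma homog_extE g x (x0 : x \in @nonzero_vector R k) :
  homog_ext g x = g (line_of (SigSub x0)).
Proof.
rewrite /homog_ext; case: {-}_ / boolP => [x1|/negP[]]; last by move: x0; rewrite inE.
by congr (g (line_of _)); exact/val_inj.
Qed.

Lemma homog_extZ g c x : c != 0 -> homog_ext g (c *: x) = homog_ext g x.
Proof.
move=> c0; have [->|x0] := eqVneq x 0; first by rewrite scaler0.
have cx0 : c *: x != 0 by rewrite scaler_eq0 negb_or c0.
rewrite (homog_extE g (nonzero_mem x0)) (homog_extE g (nonzero_mem cx0)).
by congr g; apply: (line_of_scale c0).
Qed.

Lemma homog_extN g x : homog_ext g (- x) = homog_ext g x.
Proof. by rewrite -scaleN1r homog_extZ // oppr_eq0 oner_eq0. Qed.

Lemma homog_ext_continuous g x : continuous g -> x != 0 ->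
  {for x, continuous (homog_ext g)}.
Proof.
move=> cg x0; have [i xi] : exists i, x 0 i != 0.
  apply: contrapT => H; case/eqP: x0; apply/rowP => i; rewrite mxE; apply/eqP.
  by apply: contrapT => xi; apply: H; exists i; exact/negP.
pose h (y : 'rV[R]_k.+1) : 'rV[R]_k := (y 0 i)^-1 *: col' i y.
have gh (y : 'rV[R]_k.+1) : y 0 i != 0 -> homog_ext g y = g (affine_param i (h y)).
  move=> yi; have y0 : y != 0 by apply: contraNneq yi => ->; rewrite mxE.
  rewrite (homog_extE g (nonzero_mem y0)); congr g.
  apply: (@line_of_scale _ _ _ _ (y 0 i)) => //=.
  apply/rowP => j; case: (unliftP i j) => [l ->|->].
    by rewrite !mxE liftK !mxE mulrA divff // mul1r.
  by rewrite !mxE unlift_none mulr1.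
have ci : {for x, continuous (fun y : 'rV[R]_k.+1 => y 0 i : R)} by exact: coord_continuous.
have near_i : nbhs x [set y : 'rV[R]_k.+1 | y 0 i != 0].
  apply: (ci [set r : R | r != 0]); apply: open_nbhs_nbhs; by split.
rewrite /prop_for /continuous_at (gh _ xi).
have : {for x, continuous (g \o affine_param i \o h)}.
  apply: continuous_comp; last first.
    apply: continuous_comp; last exact: cg.
    exact: (chart_param_continuous (c := affine_chart R i)).
  apply: continuous_row => j; rewrite (_ : (fun y => _) =
      fun y : 'rV[R]_k.+1 => (y 0 i)^-1 * y 0 (lift i j)).
    apply: (@continuousM R 'rV[R]_k.+1); last exact: coord_continuous.
    exact: (@continuousV R 'rV[R]_k.+1).
  by apply/funext => y; rewrite !mxE.
have E : {near x, g \o affine_param i \o h =1 homog_ext g}.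
  by apply: filterS near_i => y /gh.
by move=> cc; exact: cvg_trans (near_eq_cvg E) cc.
Qed.

(** Changing the sign of u exchanges the lines of u + v and u - v, hence oddness; exchanging u and v
    preserves both lines, hence symmetry. For orthogonal nonzero u and v the two lines differ, so
    [g] separates them. *)
Lemma no_injection_2km1 (g : nat -> projective R k -> R) :
  (0 < k)%N -> odd 'C(k.*2.-1, k) -> (forall l, continuous (g l)) ->
  (forall p q, (forall l, (l < k.*2.-1)%N -> g l p = g l q) -> p = q) -> False.
Proof.
move=> k0 Ck cg g_inj.
pose F m (u v : 'rV[R]_k.+1) : R := if m is l.+1
  then homog_ext (g l) (u + v) - homog_ext (g l) (u - v) else dotv u v.
apply: (@symmetric_borsuk_ulam R k F) => //.
- case=> [|l] u v /=; first by rewrite dotvNl.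
  have -> : - u + v = - (u - v) by rewrite opprB addrC.
  by rewrite -opprD !homog_extN opprB.
- case=> [|l] u v /=; first by rewrite dotvC.
  by rewrite [u + v]addrC -[v - u]opprB homog_extN.
move=> u v u0 v0; have [uv|uv] := eqVneq (dotv u v) 0; last first.
  by have [d d0 dP] := dotv_sign uv; exists 0%N, d; split=> //; rewrite double_gt0.
have uu : dotv u u != 0 by rewrite dotv_eq0.
have vv : dotv v v != 0 by rewrite dotv_eq0.
have pl : u + v != 0.
  have E : dotv u (u + v) = dotv u u by rewrite dotvDr uv addr0.
  by apply: contraNneq uu => uv0; rewrite -E uv0 dotv0r.
have mi : u - v != 0.
  have E : dotv u (u - v) = dotv u u by rewrite dotvBr uv subr0.
  by apply: contraNneq uu => uv0; rewrite -E uv0 dotv0r.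
have [l [lk gl]] : exists l, (l < k.*2.-1)%N /\
    homog_ext (g l) (u + v) - homog_ext (g l) (u - v) != 0.
  apply: contrapT => H.
  have : line_of (SigSub (nonzero_mem pl)) = line_of (SigSub (nonzero_mem mi)).
    apply: g_inj => l lk; apply/eqP; rewrite -subr_eq0 -!homog_extE.
    by apply: contrapT => /negP gl; apply: H; exists l.
  move/line_ofP => /= [c c0 E].
  (* Pairing u + v = c (u - v) with u gives c = 1, and then pairing with v gives |v|^2 = - |v|^2. *)
  have := congr1 (dotv u) E; rewrite dotvZr dotvDr dotvBr uv addr0 subr0.
  rewrite -{1}[dotv u u]mul1r => /(mulIf uu) c1.
  have := congr1 (dotv v) E; rewrite dotvZr dotvDr dotvBr (dotvC v u) uv add0r sub0r.
  by rewrite -c1 mul1r => vN; case/eqP: vv; lra.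
pose G (p : 'rV[R]_k.+1 * 'rV[R]_k.+1) := homog_ext (g l) (p.1 + p.2) - homog_ext (g l) (p.1 - p.2).
have c1 : {for (u, v), continuous (fun p : 'rV[R]_k.+1 * 'rV[R]_k.+1 => p.1)} by exact: cvg_fst.
have c2 : {for (u, v), continuous (fun p : 'rV[R]_k.+1 * 'rV[R]_k.+1 => p.2)} by exact: cvg_snd.
have cG : {for (u, v), continuous G}.
  apply: continuousB; apply: (@continuous_comp _ _ _ _ (homog_ext (g l))).
  - exact: continuousD.
  - exact: homog_ext_continuous.
  - exact: continuousB.
  - exact: homog_ext_continuous.
have [d d0 dP] := near_same_sign cG gl.
exists l.+1, d; split => //; first by lia.
move=> u' v' ud vd; have := dP (u', v'); rewrite prod_normE gt_max /= ud vd; exact.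
Qed.

End LineFunctions.

(** * From spheres to Euclidean spaces: a missed point *)

Section Unitize.
Variables (R : realType) (n : nat).
Implicit Types (a : R) (u v : 'rV[R]_n).

Definition unitize u : 'rV[R]_n := (Num.sqrt (dotv u u))^-1 *: u.

Lemma unitize_sphere u : u != 0 -> unitize u \in @sphere_set R n.
Proof.
move=> u0; rewrite inE /sphere_set /= /unitize dotvZ exprVn sqr_sqrtr ?dotv_ge0 //.
by rewrite mulVf // dotv_eq0.
Qed.

Lemma unitize_unit u : dotv u u = 1 -> unitize u = u.
Proof. by move=> u1; rewrite /unitize u1 sqrtr1 invr1 scale1r. Qed.

Lemma norm_sqrt_gt0 u : u != 0 -> 0 < (Num.sqrt (dotv u u))^-1.
Proof. by move=> u0; rewrite invr_gt0 sqrtr_gt0 dotv_gt0. Qed.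

Lemma unitize_ray u v : u != 0 -> v != 0 -> unitize u = unitize v ->
  exists2 s, 0 < s & u = s *: v.
Proof.
move=> u0 v0 E; exists (Num.sqrt (dotv u u) * (Num.sqrt (dotv v v))^-1).
  by rewrite mulr_gt0 ?norm_sqrt_gt0 // sqrtr_gt0 dotv_gt0.
rewrite -scalerA -[X in _ *: X]E /unitize scalerA divff ?scale1r //.
by rewrite gt_eqF // sqrtr_gt0 dotv_gt0.
Qed.

Lemma unitize_continuous_comp (T : topologicalType) (f : T -> 'rV[R]_n) x :
  f x != 0 -> {for x, continuous f} -> {for x, continuous (fun y => unitize (f y))}.
Proof.
move=> fx cf; apply: continuous_row => i.
rewrite (_ : (fun y => _) = fun y => (Num.sqrt (dotv (f y) (f y)))^-1 * f y 0 i); last first.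
  by apply/funext => y; rewrite mxE.
apply: continuousM; last first.
  by apply: (@continuous_comp _ _ _ f (fun z : 'rV[R]_n => z 0 i : R)) => //; exact: coord_continuous.
apply: continuousV; first by rewrite gt_eqF // sqrtr_gt0 dotv_gt0.
apply: (@continuous_comp _ _ _ (fun y => dotv (f y) (f y)) Num.sqrt).
  exact: dotv_continuous_comp.
exact: sqrt_continuous.
Qed.
End Unitize.

Section SphereMissesPoint.
Variables (R : realType) (k : nat).
Local Notation n := k.*2.
Variable f : projective_space R k -> sphere R n.
Hypothesis k2 : (2 <= k)%N.
Hypothesis f_embedding : smooth_embedding f.

(* If [f] were onto, its inverse followed by a chart would map a small (k+1)-dimensional
   disc of the sphere injectively to R^k. *)
Lemma embedding_misses_point : exists s : sphere R n, forall p, f p <> s.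
Proof.
apply: contrapT => H; have f_surj s : exists p, f p = s.
  by apply: contrapT => Hs; apply: H; exists s; move=> p fp; apply: Hs; exists p.
have [[[cf _] _] f_inj f_top] := f_embedding.
have [h hK] := choice f_surj.
pose p0 : projective R k := affine_param ord0 0.
pose c := affine_chart R (ord0 : 'I_k.+1).
have p0c : chart_dom c p0 by have [] := @chart_paramP _ _ _ c 0 I.
have [V oV VE] := f_top _ (open_chart_dom c).
have hV s : V s -> chart_dom c (h s) by move=> Vs; rewrite VE /= hK.
have h_cont s : {for s, continuous h}.
  move=> U; rewrite nbhsE => -[Q [oQ Qh] QU].
  have [V' oV' QE] := f_top _ oQ.
  apply: (filterS (P := V')); first by move=> s' V's'; apply: QU; rewrite QE /= hK.
  by apply: open_nbhs_nbhs; split => //; rewrite -(hK s); move: Qh; rewrite QE.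
have ch_cont s : V s -> {for s, continuous (chart_coord c \o h)}.
  move=> Vs; apply: (@continuous_comp _ _ _ h); first exact: h_cont.
  by apply: chart_coord_continuous; exact: hV.
pose s0 : 'rV[R]_n := val (f p0).
have s01 : dotv s0 s0 = 1 by have /set_mem := valP (f p0).
have [i si] : exists i, s0 0 i != 0.
  apply: contrapT => E; have /eqP := s01; rewrite (_ : s0 = 0) ?dotv0l ?(eq_sym 0) ?oner_eq0 //.
  by apply/rowP => j; rewrite mxE; apply: contrapT => /eqP sj; apply: E; exists j.
(* A copy of R^(k+1) in the hyperplane of vectors with [i]-th coordinate 0, of dimension 2k - 1;
   this is where k >= 2 enters. All [s0 + emb w] have the same nonzero [i]-th coordinate, so
   distinct ones lie on distinct rays. *)
pose emb (w : 'rV[R]_k.+1) : 'rV[R]_n := \row_j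
  if unlift i j is Some l then (if insub (val l) is Some m then w 0 m else 0) else 0.
have emb_i w : emb w 0 i = 0 by rewrite mxE unlift_none.
have emb0 : emb 0 = 0.
  by apply/rowP => j; rewrite !mxE; case: unlift => // l; case: insub => // m; rewrite mxE.
have emb_inj w w' : emb w = emb w' -> w = w'.
  move=> E; apply/rowP => m; have mn : (m < n.-1)%N by have := ltn_ord m; lia.
  have /rowP/(_ (lift i (Ordinal mn))) := E; rewrite !mxE liftK /=.
  by case: insubP => [m' _ mm'|]; [rewrite (_ : m' = m) //; exact/val_inj|rewrite ltn_ord].
have emb_cont : continuous emb.
  move=> w; apply: continuous_row => j; case: (unliftP i j) => [l ->|->]; last first.
    rewrite (_ : (fun y => _) = fun=> 0); first exact: cst_continuous.
    by apply/funext => y; rewrite mxE unlift_none.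
  case E : (insub (val l) : option 'I_k.+1) => [m|].
    rewrite (_ : (fun y => _) = fun y : 'rV[R]_k.+1 => y 0 m); first exact: coord_continuous.
    by apply/funext => y; rewrite mxE liftK E.
  rewrite (_ : (fun y => _) = fun=> 0); first exact: cst_continuous.
  by apply/funext => y; rewrite mxE liftK E.
have sw_i w : (s0 + emb w) 0 i = s0 0 i by rewrite mxE emb_i addr0.
have sw0 w : s0 + emb w != 0.
  by apply: contraNneq si => E; rewrite -(sw_i w) E mxE.
pose z w : sphere R n := SigSub (unitize_sphere (sw0 w)).
have z_cont : continuous z.
  move=> w; apply: continuous_set_type; apply: unitize_continuous_comp => //.
  apply: continuousD; [exact: cst_continuous|exact: emb_cont].
have z_inj w w' : z w = z w' -> w = w'.
  move=> /(congr1 val) /= /(unitize_ray (sw0 w) (sw0 w'))[t t0 E].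
  have : t = 1.
    have := congr1 (fun v : 'rV[R]_n => v 0 i) E; rewrite /= sw_i [in RHS]mxE sw_i.
    by rewrite -{1}[s0 0 i]mul1r => /(mulIf si).
  by move=> t1; move: E; rewrite t1 scale1r => /addrI /emb_inj.
have z0 : z 0 = f p0 by apply/val_inj => /=; rewrite emb0 addr0 unitize_unit.
have [r r0 rV] : exists2 r : R, 0 < r & forall w, `|w| < r -> V (z w).
  have : nbhs (0 : 'rV[R]_k.+1) (z @^-1` V).
    apply: z_cont; apply: open_nbhs_nbhs; split=> //.
    by rewrite z0; move: p0c; rewrite VE.
  move/nbhs_ballP => [r r0 rV]; exists r => // w wr; apply: rV.
  by rewrite -ball_normE /= sub0r normrN.
(* An odd injection of the whole space into the ball of radius [r], so that the map [E] is defined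
   and continuous at every vector. *)
pose sc (u : 'rV[R]_k.+1) : 'rV[R]_k.+1 := (r / 2 * (1 + `|u|)^-1) *: u.
have u1 (u : 'rV[R]_k.+1) : 0 < 1 + `|u| by rewrite ltr_pwDl.
have scN u : sc (- u) = - sc u by rewrite /sc normrN scalerN.
have sc_r u : `|sc u| < r.
  have a0 : 0 < r / 2 by rewrite divr_gt0.
  have ar : r / 2 < r by rewrite ltr_pdivrMr // ltr_pMr //; lra.
  rewrite /sc; move: (r / 2) a0 ar => a a0 ar.
  rewrite normrZ normrM gtr0_norm // gtr0_norm ?invr_gt0 // -mulrA.
  apply: le_lt_trans ar; rewrite ler_piMr ?(ltW a0) // ler_pdivrMl // mulr1.
  by rewrite lerDr.
have sc_cont : continuous sc.
  move=> u; apply: (continuousZ (s := fun u : 'rV[R]_k.+1 => r / 2 * (1 + `|u|)^-1) (f := id)); last exact: cvg_id.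
  apply: (@continuousM R _ (fun=> r / 2)); first exact: cst_continuous.
  apply: continuousV; first by rewrite gt_eqF.
  apply: (@continuousD R R _ (fun=> 1)); first exact: cst_continuous.
  exact: norm_continuous.
pose E u : 'rV[R]_k := chart_coord c (h (z (sc u))).
have cE u : {for u, continuous E}.
  apply: (@continuous_comp _ _ _ (z \o sc) (chart_coord c \o h)).
    apply: continuous_comp; [exact: sc_cont|exact: z_cont].
  by apply: ch_cont; exact: rV.
have E_inj u : u != 0 -> E u != E (- u).
  move=> u0; apply/eqP => EE.
  have hh : h (z (sc u)) = h (z (sc (- u))).
    have [_ <-] := chart_coordP (hV _ (rV _ (sc_r u))).
    by have [_ <-] := chart_coordP (hV _ (rV _ (sc_r (- u)))); rewrite -/(E u) EE.
  have := congr1 f hh; rewrite !hK => /z_inj; rewrite scN => /eqP.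
  rewrite -subr_eq0 opprK -mulr2n -scaler_nat scaler_eq0 pnatr_eq0 /=.
  by rewrite /sc scaler_eq0 (negPf u0) orbF gt_eqF // mulr_gt0 ?invr_gt0 ?divr_gt0.
pose G m u : R := if insub m is Some l then (E u - E (- u)) 0 l else 0.
apply: (@borsuk_ulam R k G) => [m u|u u0].
  rewrite /G; case: insub => [l|]; last by rewrite oppr0.
  by rewrite opprK !mxE opprB.
have [l El] : exists l, (E u - E (- u)) 0 l != 0.
  apply: contrapT => H0; have := E_inj u u0; rewrite -subr_eq0 => /eqP; apply.
  by apply/rowP => l; rewrite [RHS]mxE; apply: contrapT => /eqP El; apply: H0; exists l.
have GE u' : G l u' = (E u' - E (- u')) 0 l.
  by rewrite /G insubT //= => ll; congr (fun_of_matrix _ _ _); exact/val_inj.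
have cG : {for u, continuous (fun u' => (E u' - E (- u')) 0 l : R)}.
  apply: (@continuous_comp _ _ _ (fun u' => E u' - E (- u')) (fun w : 'rV[R]_k => w 0 l : R)).
    apply: continuousB; first exact: cE.
    apply: (@continuous_comp _ _ _ (fun w : 'rV[R]_k.+1 => - w) E u); last exact: cE.
    by apply: (@continuousN R _ _ id); exact: cvg_id.
  exact: coord_continuous.
have [d d0 dP] := near_same_sign cG El.
by exists l, d; split=> // u' ud; rewrite !GE; exact: dP.
Qed.

End SphereMissesPoint.

(** Here 2k - 1 = 2^(j+1) - 1, and all entries of such a row of Pascal's triangle are odd: in the
    next row all but the two outer entries are even, since m C(2^n, m) is a multiple of 2^n, so
    neighbours have equal parity. *)
Lemma odd_bin_pow2 j k : k = (2 ^ j)%N -> odd 'C(k.*2.-1, k).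
Proof.
move=> kE; have even_bin n m : (0 < m < 2 ^ n)%N -> ~~ odd 'C(2 ^ n, m).
  case: m => // m /= mn; apply/negP => Co.
  have E := mul_bin_diag (2 ^ n) m.
  have : (2 ^ n %| m.+1 * 'C(2 ^ n, m.+1))%N by rewrite -E dvdn_mulr.
  rewrite Gauss_dvdl; last by rewrite coprime_pexpl ?coprime2n //; case: n mn {E Co}.
  by move/dvdn_leq => /(_ isT); rewrite leqNgt mn.
have odd_bin n m : (m < 2 ^ n)%N -> odd 'C((2 ^ n).-1, m).
  elim: m => [|m IH] mn; first by rewrite bin0.
  have := even_bin n m.+1 mn; rewrite -(prednK (expn_gt0 2 n)) binS oddD IH //; last exact: ltnW.
  by rewrite addbT negbK.
by rewrite kE -mul2n -expnS; apply: odd_bin; rewrite ltn_exp2l.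
Qed.

(** [P] is the stereographic projection from the missed point [s], with values orthogonal to [s]. As
    s_i is not 0, the other 2k - 1 coordinates determine [P p]; its length then determines [t p],
    hence [f p]. *)
Lemma projective_not_in_sphere (R : realType) k
    (f : projective_space R k -> sphere R k.*2) :
  (2 <= k)%N -> odd 'C(k.*2.-1, k) -> smooth_embedding f -> False.
Proof.
move=> k2 Ck fe; have [s sP] := embedding_misses_point k2 fe.
have [[[cf _] _] f_inj _] := fe.
have unit (x : @sphere_set R k.*2) : dotv (val x) (val x) = 1 by have /set_mem := valP x.
pose t p : R := dotv (val s) (val (f p)).
have t1 p : 1 - t p != 0.
  apply/eqP => tp; apply: (sP p); apply/val_inj/eqP; rewrite -subr_eq0 -dotv_eq0.
  by rewrite !dotvBl !dotvBr !unit (dotvC (val (f p))) -/(t p) opprB tp addr0.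
pose P p : 'rV[R]_k.*2 := (1 - t p)^-1 *: (val (f p) - t p *: val s).
have Ps p : dotv (val s) (P p) = 0 by rewrite dotvZr dotvBr dotvZr unit mulr1 subrr mulr0.
have PP p : dotv (P p) (P p) = (1 + t p) / (1 - t p).
  have -> : dotv (P p) (P p) = (1 - t p)^-1 ^+ 2 * (1 - t p ^+ 2).
    rewrite dotvZ; congr (_ * _); rewrite !dotvBl !dotvBr !dotvZl !dotvZr !unit.
    by rewrite (dotvC (val (f p))) -/(t p); ring.
  by field.
have [i si] : exists i, val s 0 i != 0.
  apply: contrapT => E; have /eqP := unit s.
  rewrite (_ : val s = 0) ?dotv0l ?(eq_sym 0) ?oner_eq0 //.
  by apply/rowP => j; rewrite mxE; apply: contrapT => /eqP sj; apply: E; exists j.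
pose g l p : R := if insub l is Some m then P p 0 (lift i m) else 0.
have cz : continuous (fun p => val (f p) : 'rV[R]_k.*2).
  move=> p; apply: (@continuous_comp (projective R k) (@sphere_set R k.*2) _ f (fun x => val x) p).
    exact: cf.
  exact: initial_continuous.
have ct : continuous t.
  move=> p; apply: (@dotv_continuous_comp R _ (projective R k) (fun=> val s) (fun p => val (f p)) p).
    exact: cst_continuous.
  exact: cz.
apply: (@no_injection_2km1 R k g) => //; first exact: ltnW.
  move=> l p; rewrite /g; case: insub => [m|]; last exact: cst_continuous.
  rewrite (_ : (fun q => _) = fun q => (1 - t q)^-1 *
      (val (f q) 0 (lift i m) - t q * val s 0 (lift i m))); last first.
    by apply/funext => q; rewrite !mxE.
  have cd : {for p, continuous (fun q => 1 - t q)}.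
    by apply: (@continuousB R R _ (fun=> 1) t); [exact: cst_continuous|exact: ct].
  apply: (@continuousM R (projective R k) (fun q => (1 - t q)^-1)
      (fun q => val (f q) 0 (lift i m) - t q * val s 0 (lift i m))).
    exact: (@continuousV R (projective R k) (fun q => 1 - t q)).
  apply: (@continuousB R R (projective R k) (fun q => val (f q) 0 (lift i m))).
    apply: (@continuous_comp (projective R k) _ _ (fun p => val (f p))
      (fun w : 'rV[R]_k.*2 => w 0 (lift i m) : R)); first exact: cz.
    exact: coord_continuous.
  apply: (@continuousM R (projective R k) t (fun=> _)); [exact: ct|exact: cst_continuous].
move=> p q gpq; have Plift m : P p 0 (lift i m) = P q 0 (lift i m).
  by have := gpq m (ltn_ord m); rewrite /g valK.
have Pi : P p 0 i = P q 0 i.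
  have := Ps p; rewrite -(Ps q) /dotv !(bigD1_ord i) //=.
  under eq_bigr do rewrite Plift.
  by move/addIr/(mulfI si).
have {Plift Pi} PE : P p = P q.
  by apply/rowP => j; case: (unliftP i j) => [m ->|->].
have tE : t p = t q.
  have := PP p; rewrite PE PP => /eqP; rewrite eqr_div // => /eqP E.
  have : 2 * (t p - t q) = 0.
    by apply: (@eq_trans _ _ ((1 + t p) * (1 - t q) - (1 + t q) * (1 - t p))); [ring|rewrite E subrr].
  by lra.
apply/f_inj/val_inj; move: PE; rewrite /P tE => /(scalerI _) H.
by apply: (addIr (- (t q *: val s))); apply: H; rewrite invr_eq0.
Qed.

(** * Smooth maps in charts *)

Section Ck.
Context {R : realType}.
Implicit Types V W : normedModType R.

Lemma Ck_on_subset V W k (U U' : set V) (f : V -> W) :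
  U' `<=` U -> Ck_on k U f -> Ck_on k U' f.
Proof.
move=> UU; elim: k f => [|k IH] f /= => [cf x /UU|[df Df]]; first exact: cf.
by split=> [x /UU|v]; [exact: df|exact: IH].
Qed.

Lemma Ck_on_local V W k (U : set V) (f : V -> W) :
  (forall x, U x -> exists2 U', U' x & Ck_on k U' f) -> Ck_on k U f.
Proof.
elim: k f => [|k IH] f H /=; first by move=> x Ux; have [U' U'x] := H x Ux; exact.
split=> [x Ux|v]; first by have [U' U'x [df _]] := H x Ux; exact: df.
by apply: IH => x Ux; have [U' U'x [_ Df]] := H x Ux; exists U' => //; exact: Df.
Qed.

Lemma Ck_on_entry V n k (U : set V) (f : V -> 'rV[R]_n) i :
  open U -> Ck_on k U f -> Ck_on k U (fun x => f x 0 i : R).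
Proof.
move=> oU; elim: k f => [|k IH] f.
  move=> cf x Ux; apply: (@continuous_comp _ _ _ f (fun z : 'rV[R]_n => z 0 i : R)).
    exact: cf.
  exact: coord_continuous.
move=> [df Df]; split=> [x Ux|v].
  apply: (@differentiable_comp _ _ _ _ f (fun z : 'rV[R]_n => z 0 i : R)).
    exact: df.
  exact: differentiable_coord.
apply: (@Ck_on_ext _ _ _ _ _ (fun x => 'D_v f x 0 i : R)) => //; last first.
  by apply: IH; exact: Df.
move=> x Ux; rewrite derive_mx ?mxE//.
by apply: diff_derivable; exact: df.
Qed.

Lemma Ck_on_bigsum V k (U : set V) (I : Type) (r : seq I) (f : I -> V -> R) :
  open U -> (forall i, Ck_on k U (f i)) -> Ck_on k U (fun x => \sum_(i <- r) f i x).
Proof.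
move=> oU Cf; elim: r => [|i r IH].
  rewrite (_ : (fun x => _) = fun=> 0); first exact: smooth_cst.
  by apply/funext => x; rewrite big_nil.
rewrite (_ : (fun x => _) = fun x => f i x + \sum_(i <- r) f i x).
  by apply: Ck_onD => //; exact: Cf.
by apply/funext => x; rewrite big_cons.
Qed.

Lemma Ck_on_bigprod V k (U : set V) (I : Type) (r : seq I) (f : I -> V -> R) :
  open U -> (forall i, Ck_on k U (f i)) -> Ck_on k U (fun x => \prod_(i <- r) f i x).
Proof.
move=> oU Cf; elim: r => [|i r IH].
  rewrite (_ : (fun x => _) = fun=> 1); first exact: smooth_cst.
  by apply/funext => x; rewrite big_nil.
rewrite (_ : (fun x => _) = fun x => f i x * \prod_(i <- r) f i x).
  by apply: Ck_onM => //; exact: Cf.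
by apply/funext => x; rewrite big_cons.
Qed.

Lemma derive_basis n W (f : 'rV[R]_n -> W) x v : differentiable f x ->
  'D_v f x = \sum_j v 0 j *: 'D_(delta_mx 0 j) f x.
Proof.
move=> df; rewrite deriveE // {1}[v]row_sum_delta linear_sum; apply: eq_bigr => j _.
by rewrite linearZ deriveE.
Qed.

Lemma derive_comp V n W (f : 'rV[R]_n -> W) (g : V -> 'rV[R]_n) x v :
  differentiable g x -> differentiable f (g x) ->
  'D_v (f \o g) x = \sum_j ('D_v g x) 0 j *: 'D_(delta_mx 0 j) f (g x).
Proof.
move=> dg df; have <- := derive_basis ('D_v g x) df.
rewrite (deriveE v (differentiable_comp dg df)) (diff_comp dg df) /=.
by rewrite (deriveE _ df) (deriveE v dg).
Qed.

(** Scalar values come first because the chain rule then writes the derivative as a sum of products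
    of scalar functions, to which the induction applies. *)
Lemma Ck_on_comp_scalar V n k (U : set V) (U' : set 'rV[R]_n) (f : 'rV[R]_n -> R)
    (g : V -> 'rV[R]_n) : open U -> (forall x, U x -> U' (g x)) ->
  Ck_on k U' f -> Ck_on k U g -> Ck_on k U (f \o g).
Proof.
move=> oU UU'; elim: k f => [|k IH] f Cf Cg.
  by move=> x Ux; apply: continuous_comp; [exact: Cg|exact/Cf/UU'].
have [df Df] := Cf; have [dg Dg] := Cg; split=> [x Ux|v].
  by apply: differentiable_comp; [exact: dg|exact/df/UU'].
apply: (@Ck_on_ext _ _ _ _ _ (fun x => \sum_j ('D_v g x) 0 j * 'D_(delta_mx 0 j) f (g x))) => //.
  by move=> x Ux; rewrite (derive_comp v (dg x Ux) (df _ (UU' _ Ux))).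
apply: Ck_on_bigsum => // j; apply: Ck_onM => //.
  by apply: (Ck_on_entry (f := 'D_v g)) => //; exact: Dg.
exact: (IH _ (Df _) (Ck_onW Cg)).
Qed.

Lemma Ck_on_comp V n m k (U : set V) (U' : set 'rV[R]_n) (f : 'rV[R]_n -> 'rV[R]_m)
    (g : V -> 'rV[R]_n) : open U -> open U' -> (forall x, U x -> U' (g x)) ->
  Ck_on k U' f -> Ck_on k U g -> Ck_on k U (f \o g).
Proof.
move=> oU oU' UU' Cf Cg; apply: Ck_on_row => // i.
exact: (Ck_on_comp_scalar oU UU' (Ck_on_entry i oU' Cf)).
Qed.

Lemma Ck_on_comp1 V k (U : set V) (f : R -> R) (g : V -> R) : open U ->
  Ck_on k setT f -> Ck_on k U g -> Ck_on k U (f \o g).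
Proof.
move=> oU; elim: k f => [|k IH] f Cf Cg.
  by move=> x Ux; apply: continuous_comp; [exact: Cg|exact: Cf].
have [df Df] := Cf; have [dg Dg] := Cg; split=> [x Ux|v].
  by apply: differentiable_comp; [exact: dg|exact: df].
apply: (@Ck_on_ext _ _ _ _ _ (fun x => 'D_v g x * 'D_1 f (g x))) => //.
  move=> x Ux; have dfx := df (g x) I; have dgx := dg x Ux.
  rewrite [RHS](deriveE v (differentiable_comp dgx dfx)) (diff_comp dgx dfx) /=.
  by rewrite (deriveE v dgx) (diff1E dfx) /= derive1E.
apply: Ck_onM => //; first exact: Dg.
exact: (IH _ (Df _) (Ck_onW Cg)).
Qed.

Lemma differentiable_sqrt (x : R) : 0 < x -> differentiable (Num.sqrt : R -> R) x.
Proof. by move=> x0; apply/derivable1_diffP; have [] := is_derive1_sqrt x0. Qed.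

Lemma Ck_on_sqrt V k (U : set V) (f : V -> R) : open U -> (forall x, U x -> 0 < f x) ->
  Ck_on k U f -> Ck_on k U (fun x => Num.sqrt (f x)).
Proof.
move=> oU f0; elim: k => [|k IH] Cf.
  by move=> x Ux; apply: (@continuous_comp _ _ _ f); [exact: Cf|exact: sqrt_continuous].
have [df Df] := Cf.
have dsf x : U x -> differentiable (fun x => Num.sqrt (f x)) x.
  move=> Ux; apply: (@differentiable_comp _ _ _ _ f); first exact: df.
  by apply: differentiable_sqrt; exact: f0.
split=> // v.
apply: (@Ck_on_ext _ _ _ _ _ (fun x => (2 * Num.sqrt (f x))^-1 * 'D_v f x)) => //.
  move=> x Ux; have fx := f0 x Ux.
  have ds := differentiable_sqrt fx.
  rewrite (deriveE v (dsf x Ux)) (@diff_comp _ _ _ _ f _ x (df x Ux) ds) /=.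
  rewrite (deriveE v (df x Ux)) (diff1E ds) /= derive1E.
  have [_ ->] := is_derive1_sqrt fx.
  by rewrite mulrC.
apply: Ck_onM => //; last exact: Df.
apply: (Ck_onV (f := fun x => 2 * Num.sqrt (f x))) => //.
  by move=> x Ux; rewrite mulf_neq0 // gt_eqF // sqrtr_gt0 f0.
by apply: Ck_onM => //; [exact: smooth_cst|exact/IH/Ck_onW].
Qed.

End Ck.

Lemma open_preimage_on (S T : topologicalType) (f : S -> T) (U : set S) (V : set T) :
  open U -> (forall x, U x -> {for x, continuous f}) -> open V ->
  open (U `&` f @^-1` V).
Proof.
move=> oU cf oV; rewrite openE => x [Ux Vfx]; apply: filterI.
  exact: open_nbhs_nbhs.
by apply: (cf x Ux V); exact: open_nbhs_nbhs.
Qed.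

Lemma near_derive_eq (R : realType) (V W : normedModType R) (U : set V) (f g : V -> W) x v :
  open U -> U x -> (forall y, U y -> f y = g y) -> 'D_v f x = 'D_v g x.
Proof.
move=> oU Ux fg; apply: near_eq_derive.
by apply: filterS (open_nbhs_nbhs (conj oU Ux)) => y /fg.
Qed.

Lemma linear_inj (R : pzRingType) (V W : lmodType R) (f : {linear V -> W}) :
  (forall v, f v = 0 -> v = 0) -> injective f.
Proof. by move=> f0 u v uv; apply/eqP; rewrite -subr_eq0; apply/eqP/f0; rewrite linearB uv subrr. Qed.

(** * Embeddings in Euclidean spaces and in spheres *)

Section EuclideanTarget.
Context {R : realType} {n : nat} {M : manifold R n}.
Implicit Types (c d : chart R n M).

Definition smooth_charts N (g : M -> 'rV[R]_N) : Prop :=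
  forall c, atlas c -> smooth_on (chart_codom c) (g \o chart_param c).

Lemma smooth_charts_differentiable N (g : M -> 'rV[R]_N) c y : smooth_charts g ->
  atlas c -> chart_codom c y -> differentiable (g \o chart_param c) y.
Proof. by move=> sg ac yc; have [+ _] := sg c ac 1%N; apply. Qed.

Lemma smooth_charts_continuous N (g : M -> 'rV[R]_N) : smooth_charts g -> continuous g.
Proof.
move=> sg x; have [c ac cx] := atlas_cover x.
have [yc yx] := chart_coordP cx.
have cgc : {for x, continuous ((g \o chart_param c) \o chart_coord c)}.
  apply: continuous_comp; first exact: chart_coord_continuous.
  exact: (sg c ac 0%N).
have E : {near x, (g \o chart_param c) \o chart_coord c =1 g}.
  apply: filterS (open_nbhs_nbhs (conj (open_chart_dom c) cx)) => z cz.
  by rewrite /= (chart_coordP cz).2.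
rewrite /continuous_at -{2}yx; exact: cvg_trans (near_eq_cvg E) cgc.
Qed.

Lemma overlap_open c d : open (chart_codom c `&` chart_param c @^-1` chart_dom d).
Proof.
apply: open_preimage_on; [exact: open_chart_codom| |exact: open_chart_dom].
exact: chart_param_continuous.
Qed.

(** [w'] is the image of [w] under the differential of the transition map and serves all [g] at
    once. It allows immersivity to be checked in a single chart around each point. *)
Lemma chart_change c d y w : atlas c -> atlas d -> chart_codom c y ->
  chart_dom d (chart_param c y) ->
  exists w', (w' = 0 -> w = 0) /\ forall N (g : M -> 'rV[R]_N), smooth_charts g ->
    'D_w (g \o chart_param c) y =
    'D_w' (g \o chart_param d) (chart_coord d (chart_param c y)).
Proof.
move=> ac ad yc yd; pose t := chart_coord d \o chart_param c.
pose U := chart_codom c `&` chart_param c @^-1` chart_dom d.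
have oU : open U by exact: overlap_open.
have Uy : U y by [].
have dt : differentiable t y by have [+ _] := atlas_compatible ac ad 1%N; exact.
have [tyd tyE] := chart_coordP yd.
exists ('D_w t y); split.
  move=> w0; pose t' := chart_coord c \o chart_param d.
  have dt' : differentiable t' (t y).
    have [+ _] := atlas_compatible ad ac 1%N; apply; split => //.
    by rewrite /= tyE; have [] := chart_paramP yc.
  have : 'D_w (t' \o t) y = 0.
    rewrite derive_comp // w0; apply: big1 => j _.
    by rewrite mxE scale0r.
  rewrite (@near_derive_eq _ _ _ U _ id y w oU) ?derive_id //.
  move=> z [zc zd]; rewrite /t' /t /=.
  by have [_ ->] := chart_coordP zd; have [_ ->] := chart_paramP zc.
move=> N g sg; rewrite (@near_derive_eq _ _ _ U _ ((g \o chart_param d) \o t) y w oU) //.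
  have dg := smooth_charts_differentiable sg ad tyd.
  by rewrite derive_comp // -derive_basis.
by move=> z [zc zd] /=; have [_ ->] := chart_coordP zd.
Qed.

Definition chart_immersive N (g : M -> 'rV[R]_N) : Prop :=
  forall c y w, atlas c -> chart_codom c y -> 'D_w (g \o chart_param c) y = 0 -> w = 0.

Lemma compact_topological_embedding N (g : M -> 'rV[R]_N) :
  compact [set: M] -> continuous g -> injective g ->
  forall U : set M, open U -> exists2 V : set 'rV[R]_N, open V & U = g @^-1` V.
Proof.
move=> cM cg g_inj U oU; exists (~` (g @` (~` U))).
  rewrite openC; apply: compact_closed; first exact: norm_hausdorff.
  apply: continuous_compact; first exact: continuous_subspaceT.
  by apply: (subclosed_compact _ cM) => //; rewrite closedC.
apply/seteqP; split=> x /= => [Ux [z nUz /g_inj zx]|H]; first by apply: nUz; rewrite zx.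
by apply: contrapT => nUx; apply: H; exists x.
Qed.

Lemma euclidean_atlas N (d : chart R N (euclidean R N)) : atlas d -> d = id_chart R N.
Proof. by []. Qed.

Lemma smooth_map_euclideanP N (f : M -> euclidean R N) : smooth_map f <-> smooth_charts f.
Proof.
split=> [[cf sf] c ac|sf].
  have := sf c (id_chart R N) ac erefl.
  by rewrite /local_dom /= preimage_setT setIT.
split; first exact: smooth_charts_continuous.
move=> c d ac /euclidean_atlas ->; rewrite /local_dom /= preimage_setT setIT.
exact: sf.
Qed.

Lemma smooth_embedding_euclideanP N (f : M -> euclidean R N) : compact [set: M] ->
  smooth_embedding f <-> [/\ smooth_charts f, chart_immersive f & injective f].
Proof.
move=> cM; split=> [[[/smooth_map_euclideanP sf imf] f_inj _]|[sf imf f_inj]].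
  split=> // c y w ac yc; have := imf c (id_chart R N) ac erefl y.
  rewrite /local_dom /= => /(_ (conj yc I)) inj.
  have df := smooth_charts_differentiable sf ac yc.
  by rewrite deriveE // => dw; apply: inj; rewrite linear0 -[RHS]dw.
split=> //; last by apply: compact_topological_embedding => //; exact: smooth_charts_continuous.
split; first exact/smooth_map_euclideanP.
move=> c d ac /euclidean_atlas -> y [yc _].
have df := smooth_charts_differentiable sf ac yc.
apply: linear_inj => w dw; apply: (imf c y w ac yc).
by rewrite deriveE.
Qed.

End EuclideanTarget.

Section SphereTarget.
Context {R : realType} {n : nat} {M : manifold R n}.
Hypothesis cM : compact [set: M].
Variable N : nat.

Definition pole_dist (s : bool) (i : 'I_N) (x : 'rV[R]_N) : R := 1 + - 1 * ((-1) ^+ s * x 0 i).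

(** Stereographic projection extended to an open subset of the ambient space, where the calculus on
    R^N applies. *)
Definition stereo_ambient s i (x : 'rV[R]_N) : 'rV[R]_N.-1 := (pole_dist s i x)^-1 *: col' i x.

Definition off_pole s i : set 'rV[R]_N := [set x | pole_dist s i x != 0].

Lemma smooth_pole_dist k s i : Ck_on k setT (pole_dist s i).
Proof.
by do ?[apply: Ck_onD|apply: Ck_onM|exact: openT|exact: smooth_cst|exact: smooth_coord].
Qed.

Lemma open_off_pole s i : open (off_pole s i).
Proof.
rewrite (_ : off_pole s i = pole_dist s i @^-1` [set r | r != 0]) //.
apply: open_comp; last exact: open_neq.
by move=> x _; exact: (smooth_pole_dist 0 s i).
Qed.

Lemma smooth_stereo_ambient s i : smooth_on (off_pole s i) (stereo_ambient s i).
Proof.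
move=> k; apply: Ck_on_row => [|l]; first exact: open_off_pole.
rewrite (_ : (fun y => _) = fun y => (pole_dist s i y)^-1 * y 0 (lift i l)); last first.
  by apply/funext => y; rewrite !mxE.
apply: Ck_onM; [exact: open_off_pole| |exact: smooth_coord].
apply: Ck_onV => //; first exact: open_off_pole.
exact: Ck_onS (smooth_pole_dist k s i).
Qed.

Lemma stereo_coordE s i (x : @sphere_set R N) : stereo_coord s i x = stereo_ambient s i (val x).
Proof. by rewrite /stereo_coord /stereo_ambient /pole_dist mulN1r. Qed.

Lemma chart_dom_stereo s i (x : @sphere_set R N) :
  chart_dom (stereo_chart R s i) x <-> off_pole s i (val x).
Proof.
rewrite /off_pole /pole_dist /= mulN1r subr_eq0 eq_sym.
by split.
Qed.

(** Local expressions are [stereo_ambient] after [g], hence smooth; conversely [g] is [stereo_point]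
    after a local expression, so a direction killed by the latter is killed by the differential of
    [g]. *)
Lemma sphere_corestriction (g : M -> 'rV[R]_N) :
  (forall p, dotv (g p) (g p) = 1) -> smooth_charts g -> chart_immersive g ->
  injective g -> exists f : M -> sphere R N, smooth_embedding f.
Proof.
move=> g1 sg img g_inj; have gS p : g p \in @sphere_set R N by rewrite inE; exact: g1.
pose f p : sphere R N := SigSub (gS p); exists f.
have cg := smooth_charts_continuous sg.
have cf : continuous f by move=> p; apply: continuous_set_type; exact: cg.
have oD c s i : atlas c -> open (local_dom f c (stereo_chart R s i)).
  move=> ac; rewrite (_ : local_dom _ _ _ = chart_codom c `&` (g \o chart_param c) @^-1` off_pole s i).
    apply: open_preimage_on; [exact: open_chart_codom|exact: (sg c ac 0%N)|exact: open_off_pole].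
  apply/seteqP; split=> y [yc h]; split=> //.
    exact: (chart_dom_stereo s i (f (chart_param c y))).1.
  exact: (chart_dom_stereo s i (f (chart_param c y))).2.
have sE c s i : atlas c -> smooth_on (local_dom f c (stereo_chart R s i))
    (local_expr f c (stereo_chart R s i)).
  move=> ac k; have oU := oD c s i ac.
  apply: (@Ck_on_ext _ _ _ _ _ (stereo_ambient s i \o (g \o chart_param c))) => //.
    by move=> y _; rewrite /local_expr /= stereo_coordE.
  apply: (@Ck_on_comp _ _ _ _ _ _ (off_pole s i)) => //.
  - exact: open_off_pole.
  - by move=> y [_ h]; exact: (chart_dom_stereo s i (f (chart_param c y))).1.
  - exact: smooth_stereo_ambient.
  - by apply: Ck_on_subset (sg c ac k); move=> y [].
split.
- split.
    by split=> // c _ ac [s [i ->]]; exact: sE.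
  move=> c _ ac [s [i ->]] y yD; have oU := oD c s i ac.
  have dE : differentiable (local_expr f c (stereo_chart R s i)) y.
    by have [+ _] := sE c s i ac 1%N; exact.
  apply: linear_inj => w dw; apply: (img c y w ac yD.1).
  rewrite (@near_derive_eq _ _ _ _ _
    (stereo_point s i \o local_expr f c (stereo_chart R s i)) y w oU) //; last first.
    move=> z [zc zD]; have [_ E] := @chart_coordP _ _ _ (stereo_chart R s i) _ zD.
    by have := congr1 val E => /= <-.
  have dP : differentiable (stereo_point s i) (local_expr f c (stereo_chart R s i) y).
    by have [+ _] := @smooth_stereo_point R N s i 1%N; exact.
  rewrite derive_comp // deriveE // dw.
  by apply: big1 => j _; rewrite mxE scale0r.
- by move=> p q pq; apply: g_inj; have := congr1 val pq.
- move=> U oU; have [V oV ->] := compact_topological_embedding cM cg g_inj oU.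
  exists (val @^-1` V) => //.
  by exists V.
Qed.

Lemma sphere_extension (f : M -> sphere R N) : smooth_embedding f ->
  let g := fun p => val (f p) : 'rV[R]_N in
  [/\ forall p, dotv (g p) (g p) = 1, smooth_charts g, chart_immersive g & injective g].
Proof.
move=> [[[cf sf] imf] f_inj _] g.
have cg : continuous g.
  move=> p; apply: (@continuous_comp M (@sphere_set R N) _ f (fun x => val x) p).
    exact: cf.
  exact: initial_continuous.
have oD c s i : open (local_dom f c (stereo_chart R s i)).
  apply: open_preimage_on; [exact: open_chart_codom| |exact: open_chart_dom].
  move=> y yc; apply: continuous_comp; [exact: chart_param_continuous|exact: cf].
have key c y : atlas c -> chart_codom c y -> exists s i,
    local_dom f c (stereo_chart R s i) y.
  move=> ac yc; have [_ [s [i ->]] fd] := atlas_cover (f (chart_param c y)).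
  by exists s, i.
have gE c s i z : local_dom f c (stereo_chart R s i) z ->
    (g \o chart_param c) z = stereo_point s i (local_expr f c (stereo_chart R s i) z).
  move=> [_ zD]; have [_ E] := @chart_coordP _ _ _ (stereo_chart R s i) _ zD.
  exact: esym (congr1 val E).
have sg : smooth_charts g.
  move=> c ac k; apply: Ck_on_local => y yc; have [s [i yD]] := key c y ac yc.
  exists (local_dom f c (stereo_chart R s i)) => //.
  apply: (@Ck_on_ext _ _ _ _ _ (stereo_point s i \o local_expr f c (stereo_chart R s i))) => //.
    by move=> z /gE.
  apply: (@Ck_on_comp _ _ _ _ _ _ setT) => //; first exact: openT.
    exact: smooth_stereo_point.
  by apply: sf => //; exists s, i.
split=> //; first by move=> p; have /set_mem := valP (f p).
  move=> c y w ac yc dw; have [s [i yD]] := key c y ac yc.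
  have ad : atlas (stereo_chart R s i : chart R N.-1 (sphere R N)) by exists s, i.
  have dE : differentiable (local_expr f c (stereo_chart R s i)) y.
    by have [+ _] := sf c _ ac ad 1%N; exact.
  apply: (imf c _ ac ad y yD); rewrite linear0 -deriveE //.
  rewrite (@near_derive_eq _ _ _ _ _ (stereo_ambient s i \o (g \o chart_param c)) y w (oD c s i)) //.
    have dg := smooth_charts_differentiable sg ac yc.
    have dP : differentiable (stereo_ambient s i) ((g \o chart_param c) y).
      by have [+ _] := @smooth_stereo_ambient s i 1%N; apply; apply/chart_dom_stereo; case: yD.
    rewrite derive_comp // dw; apply: big1 => j _; by rewrite mxE scale0r.
  by move=> z _; rewrite /local_expr /= stereo_coordE.
by move=> p q pq; apply/f_inj/val_inj.
Qed.

(** The map g/|g| is injective when distinct points have distinct rays, and immersive when no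
    nonzero tangent vector is sent to a multiple of [g p]. *)
Lemma ray_embedding (g : M -> 'rV[R]_N) : smooth_charts g -> (forall p, g p != 0) ->
  (forall p q s, 0 < s -> g p = s *: g q -> p = q) ->
  (forall p, exists c, [/\ atlas c, chart_dom c p & forall w a,
     'D_w (g \o chart_param c) (chart_coord c p) = a *: g p -> w = 0]) ->
  exists f : M -> sphere R N, smooth_embedding f.
Proof.
move=> sg g0 g_ray img; pose u p := unitize (g p).
pose r (x : 'rV[R]_N) := (Num.sqrt (dotv x x))^-1.
have r0 x : x != 0 -> 0 < r x by move=> x0; exact: norm_sqrt_gt0.
have sr c : atlas c -> smooth_on (chart_codom c) (fun y => r (g (chart_param c y))).
  move=> ac k; have oc := @open_chart_codom _ _ _ c.
  have sd : Ck_on k (chart_codom c) (fun y => dotv (g (chart_param c y)) (g (chart_param c y))).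
    apply: Ck_on_bigsum => // i; apply: Ck_onM => //; exact: (Ck_on_entry i oc (sg c ac k)).
  apply: (Ck_onV (f := fun y => Num.sqrt (dotv (g (chart_param c y)) (g (chart_param c y))))) => //.
    by move=> y yc; rewrite gt_eqF // sqrtr_gt0 dotv_gt0.
  by apply: Ck_on_sqrt => // y yc; rewrite dotv_gt0.
have su : smooth_charts u.
  move=> c ac k; have oc := @open_chart_codom _ _ _ c; apply: Ck_on_row => // i.
  rewrite (_ : (fun y => _) = fun y => r (g (chart_param c y)) * g (chart_param c y) 0 i).
    by apply: Ck_onM => //; [exact: sr|exact: (Ck_on_entry i oc (sg c ac k))].
  by apply/funext => y; rewrite mxE.
apply: (@sphere_corestriction u) => //.
- by move=> p; have := unitize_sphere (g0 p); rewrite inE.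
- move=> c y w ac yc dw; set p := chart_param c y.
  have [d [ad pd imd]] := img p.
  have [w' [w'0 DE]] := chart_change w ac ad yc pd.
  apply/w'0; have [yd ydE] := chart_coordP pd; set y' := chart_coord d p in yd ydE DE *.
  have {}dw : 'D_w' (u \o chart_param d) y' = 0 by rewrite -DE.
  have dr : differentiable (fun y => r (g (chart_param d y))) y'.
    by have [+ _] := sr d ad 1%N; exact.
  have dg := smooth_charts_differentiable sg ad yd.
  have du := smooth_charts_differentiable su ad yd.
  pose a := 'D_w' (fun y => r (g (chart_param d y))) y'.
  have rp := r0 _ (g0 p).
  (* The product rule for u = r g, with Du = 0, gives Dg = - (Dr / r) g. *)
  apply: (imd w' (- (r (g p))^-1 * a)); rewrite -/y'.
  apply/rowP => i; have := congr1 (fun v : 'rV[R]_N => v 0 i) dw.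
  rewrite derive_mx ?mxE; last exact: diff_derivable.
  rewrite (_ : (fun y => _) = fun y => r (g (chart_param d y)) * (g \o chart_param d) y 0 i); last first.
    by apply/funext => z; rewrite mxE.
  have dgi : differentiable (fun y => (g \o chart_param d) y 0 i : R) y'.
    apply: (@differentiable_comp _ _ _ _ (g \o chart_param d) (fun z : 'rV[R]_N => z 0 i : R)) => //.
    exact: differentiable_coord.
  rewrite (deriveM (diff_derivable dr) (diff_derivable dgi)) -/a.
  rewrite [in X in _ -> X]derive_mx ?mxE; last exact: diff_derivable.
  rewrite /= ydE => E.
  have : r (g p) *: 'D_w' (fun y => g (chart_param d y) 0 i : R) y' + g p 0 i *: a = 0 by [].
  rewrite /GRing.scale /= => {}E.
  apply: (mulfI (lt0r_neq0 rp)); rewrite mulrA mulNr mulrN mulrA divff ?lt0r_neq0 // mul1r mulNr.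
  by rewrite [a * _]mulrC; apply/eqP; rewrite -addr_eq0; apply/eqP.
- move=> p q /(unitize_ray (g0 p) (g0 q))[s s0]; exact: g_ray.
Qed.

End SphereTarget.

(** * Bump functions and embeddings in spheres *)

Section FlatFunction.
Variable R : realType.
Implicit Types (t : R) (m : nat).

(** The powers of 1/t make the family stable under differentiation; [flat 0] is the usual
    exp(-1/t). *)
Definition flat m t : R := if 0 < t then t^-1 ^+ m * expR (- t^-1) else 0.

Lemma flat_ge0 m t : 0 <= flat m t.
Proof.
rewrite /flat; case: ifP => // t0.
by rewrite mulr_ge0 ?expR_ge0 // exprn_ge0 // invr_ge0 ltW.
Qed.

Lemma flat0_gt0 t : (0 < flat 0 t) = (0 < t).
Proof. by rewrite /flat; case: ifP => _; rewrite ?ltxx // expr0 mul1r expR_gt0. Qed.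

(** From exp(1/t) >= t^-(m+2) / (m+2)!. A quadratic bound makes the difference quotient at 0 tend to
    0. *)
Lemma flat_le m t : flat m t <= m.+2`!%:R * t ^+ 2.
Proof.
rewrite /flat; case: ifP => [t0|_]; last by rewrite mulr_ge0 ?ler0n ?sqr_ge0.
have ti : 0 < t^-1 by rewrite invr_gt0.
have fp : 0 < m.+2`!%:R :> R by rewrite ltr0n fact_gt0.
have := expR_ge1Dxn m.+1 (ltW ti).
rewrite expRN => H; have {}H : t^-1 ^+ m.+2 / m.+2`!%:R <= expR t^-1.
  by apply: le_trans H; rewrite lerDr.
rewrite ler_pdivrMr ?expR_gt0 //; move: H; rewrite ler_pdivrMr // => H.
have t2 : t ^+ 2 * t^-1 ^+ m.+2 = t^-1 ^+ m.
  by rewrite -[m.+2]addn2 exprD mulrCA -exprMn divff ?expr1n ?mulr1 // gt_eqF.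
rewrite -t2 [X in _ <= X](_ : _ = t ^+ 2 * (expR t^-1 * m.+2`!%:R)); last by ring.
by rewrite ler_wpM2l ?sqr_ge0.
Qed.

Lemma is_derive_flat m t : is_derive t 1 (flat m) (- m%:R * flat m.+1 t + flat m.+2 t).
Proof.
have [t0|t0|t0] := ltrgtP t 0.
- have E : \forall x \near t, cst 0 x = flat m x.
    have : nbhs t [set x | x < 0] by apply: open_nbhs_nbhs; split=> //; exact: open_lt.
    by apply: filterS => x /= x0; rewrite /flat ltNge (ltW x0).
  have -> : - m%:R * flat m.+1 t + flat m.+2 t = 0.
    by rewrite /flat ltNge (ltW t0) /= mulr0 addr0.
  by apply: (near_eq_is_derive E).
- have t_neq0 : t != 0 by rewrite gt_eqF.
  have i1 : is_derive t 1 (fun x : R => x^-1) (- (t^-1 ^+ 2)).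
    apply: DeriveDef.
      by apply: (@derivableV R R id) => //.
    rewrite (@deriveV R R id) ?derive_id //.
    by rewrite /GRing.scale /= mulr1 exprVn.
  have i2 := is_deriveN i1.
  have i3 := is_derive1_comp (is_derive_expR _) i2.
  have i5 := is_deriveM (is_deriveX m i1) i3.
  have E : \forall x \near t, ((fun x : R => x^-1) ^+ m * (expR \o (- (fun x : R => x^-1)))) x = flat m x.
    have : nbhs t [set x | 0 < x] by apply: open_nbhs_nbhs; split=> //; exact: open_gt.
    by apply: filterS => x /= x0; rewrite /flat x0 !fctE.
  apply: is_derive_eq; first exact: (near_eq_is_derive E i5).
  rewrite /flat t0 /GRing.scale /= !fctE /=.
  case: m {E i5} => [|m]; first by rewrite mul0r !mul0r; ring.
  by rewrite /= !exprS -[X in expR X]/(- t^-1); ring.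
- subst t; have -> : - m%:R * flat m.+1 0 + flat m.+2 0 = 0 by rewrite /flat ltxx mulr0 addr0.
  have H : (fun h : R => h^-1 *: ((flat m \o shift 0) (h *: 1) - flat m 0)) @ 0^' --> 0.
    apply/cvgrPdist_lt => e e0; pose C : R := m.+2`!%:R.
    have C0 : 0 < C by rewrite ltr0n fact_gt0.
    near=> h; rewrite sub0r normrN /= addr0 [flat m 0]/flat ltxx subr0.
    have h0 : h != 0 by near: h; exact: nbhs_dnbhs_neq.
    have he : `|h| < e / C.
      near: h; apply: dnbhs0_lt; by rewrite divr_gt0.
    rewrite /GRing.scale /= mulr1 normrM normfV (ger0_norm (flat_ge0 m h)).
    apply: le_lt_trans (_ : `|h|^-1 * (C * `|h| ^+ 2) < e).
      rewrite ler_wpM2l ?invr_ge0 ?normr_ge0 //.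
      by rewrite -normrX ger0_norm ?sqr_ge0 //; exact: flat_le.
    by rewrite expr2 mulrCA mulKf ?normr_eq0 // -ltr_pdivlMl // mulrC.
  by apply: DeriveDef; [exact: cvgP H|exact: cvg_lim H].
Unshelve. all: by end_near.
Qed.

Lemma smooth_flat m : smooth_on setT (flat m : R -> R).
Proof.
move=> k; elim: k m => [|k IH] m.
  by move=> x _; apply/differentiable_continuous/derivable1_diffP; have [] := is_derive_flat m x.
have df x : differentiable (flat m : R -> R) x.
  by apply/derivable1_diffP; have [] := is_derive_flat m x.
split=> [x _ //|v].
apply: (@Ck_on_ext _ _ _ _ _ (fun x => v * (- m%:R * flat m.+1 x + flat m.+2 x))).
- exact: openT.
- move=> x _; have [_ <-] := is_derive_flat m x; rewrite !deriveE //.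
  by rewrite -{2}[v]mulr1 -[v * 1]/(v *: (1 : R^o)) linearZ.
- apply: Ck_onM; [exact: openT|exact: smooth_cst|].
  apply: Ck_onD; [exact: openT| |exact: IH].
  by apply: Ck_onM; [exact: openT|exact: smooth_cst|exact: IH].
Qed.
End FlatFunction.

Lemma Ck_on_dotv (R : realType) (V : normedModType R) k (U : set V) n (f g : V -> 'rV[R]_n) :
  open U -> Ck_on k U f -> Ck_on k U g -> Ck_on k U (fun y => dotv (f y) (g y)).
Proof.
move=> oU Cf Cg; apply: Ck_on_bigsum => // i; apply: Ck_onM => //; exact: Ck_on_entry.
Qed.

Lemma Ck_on_scale (R : realType) (V : normedModType R) k (U : set V) n (a : V -> R)
    (f : V -> 'rV[R]_n) :
  open U -> Ck_on k U a -> Ck_on k U f -> Ck_on k U (fun y => a y *: f y).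
Proof.
move=> oU Ca Cf; apply: Ck_on_row => // i.
rewrite (_ : (fun y => _) = fun y => a y * f y 0 i).
  by apply: Ck_onM => //; exact: Ck_on_entry.
by apply/funext => y; rewrite mxE.
Qed.

Lemma Ck_on_id (R : realType) n k (U : set 'rV[R]_n) : open U -> Ck_on k U (@id 'rV[R]_n).
Proof. by move=> oU; apply: Ck_on_row => // i; exact: smooth_coord. Qed.

Lemma Ck_on_addv (R : realType) (V : normedModType R) k (U : set V) n (f g : V -> 'rV[R]_n) :
  open U -> Ck_on k U f -> Ck_on k U g -> Ck_on k U (fun y => f y + g y).
Proof. exact: Ck_onD. Qed.

Section Bump.
Variables (R : realType) (n : nat) (y0 : 'rV[R]_n) (r : R).
Hypothesis r0 : 0 < r.

(** The Euclidean distance is used because the norm of row vectors is the maximum norm, which is not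
    smooth. *)
Definition sqdist (y : 'rV[R]_n) : R := dotv (y - y0) (y - y0).

Definition disc : set 'rV[R]_n := [set y | sqdist y <= r ^+ 2].

Definition bump (y : 'rV[R]_n) : R := flat 0 (r ^+ 2 - sqdist y).

Lemma smooth_sqdist k : Ck_on k setT sqdist.
Proof.
have Cb : Ck_on k setT (fun y => y - y0).
  apply: Ck_onD; [exact: openT|exact: Ck_on_id openT|exact: smooth_cst].
by apply: Ck_on_dotv => //; exact: openT.
Qed.

Lemma smooth_bump k : Ck_on k setT bump.
Proof.
apply: (@Ck_on_comp1 _ _ _ _ (flat 0) (fun y => r ^+ 2 - sqdist y)).
- exact: openT.
- exact: smooth_flat.
- rewrite (_ : (fun y => _) = fun y => r ^+ 2 + (-1) * sqdist y); last first.
    by apply/funext => y; rewrite mulN1r.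
  apply: Ck_onD; [exact: openT|exact: smooth_cst|].
  by apply: Ck_onM; [exact: openT|exact: smooth_cst|exact: smooth_sqdist].
Qed.

Lemma bump_gt0 y : (0 < bump y) = (sqdist y < r ^+ 2).
Proof. by rewrite flat0_gt0 subr_gt0. Qed.

Lemma bump_ge0 y : 0 <= bump y.
Proof. exact: flat_ge0. Qed.

Lemma bump_eq0 y : ~ disc y -> bump y = 0.
Proof.
move=> dy; apply/eqP; rewrite eq_le bump_ge0 andbT leNgt bump_gt0.
by apply/negP => /ltW.
Qed.

Lemma sqdist_continuous : continuous sqdist.
Proof. by move=> y; exact: (smooth_sqdist 0). Qed.

Lemma disc_norm y : disc y -> `|y - y0| <= r.
Proof.
rewrite /disc /= => dy; apply: rV_norm_le => [|i]; first exact: ltW.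
rewrite -ler_sqr ?nnegrE ?normr_ge0 ?(ltW r0) // real_normK ?num_real //.
apply: le_trans dy; rewrite /sqdist /dotv (bigD1 i) //= -expr2 lerDl.
by apply: sumr_ge0 => j _; rewrite -expr2 sqr_ge0.
Qed.

Lemma compact_disc : compact disc.
Proof.
apply: (@subclosed_compact _ _ [set y : 'rV[R]_n | `|y - y0| <= r]).
- rewrite (_ : disc = sqdist @^-1` [set t | t <= r ^+ 2]) //.
  by apply: closed_comp; [move=> y _; exact: sqdist_continuous|exact: closed_le].
- exact: compact_norm_ball.
- exact: disc_norm.
Qed.
End Bump.

Section ExtendByZero.
Context {R : realType} {n : nat} {M : manifold R n}.
Variables (c : chart R n M) (y0 : 'rV[R]_n) (r : R) (N : nat) (U : set 'rV[R]_n).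
Variable s : 'rV[R]_n -> 'rV[R]_N.
Hypotheses (r0 : 0 < r) (ac : atlas c) (oU : open U) (Uc : U `<=` chart_codom c).
Hypotheses (dU : disc y0 r `<=` U) (ss : smooth_on U s).

Definition extend_by_zero (p : M) : 'rV[R]_N :=
  if `[< chart_dom c p >] then bump y0 r (chart_coord c p) *: s (chart_coord c p) else 0.

(** Two open sets cover the manifold: the points of the chart with coordinate in [U], and the
    complement of the image of the disc. This image is compact, hence closed since the manifold is
    Hausdorff, and the map is 0 off it. *)
Lemma smooth_extend_by_zero : smooth_charts extend_by_zero.
Proof.
move=> d ad k; apply: Ck_on_local => y yd; set p := chart_param d y.
have [[pc pU]|pK] := pselect (chart_dom c p /\ U (chart_coord c p)).
  pose t := chart_coord c \o chart_param d.
  pose V0 := chart_codom d `&` chart_param d @^-1` chart_dom c.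
  have st : smooth_on V0 t := atlas_compatible ad ac.
  pose V := V0 `&` t @^-1` U.
  have oV : open V.
    by apply: open_preimage_on; [exact: overlap_open|exact: (st 0%N)|].
  exists V => //.
  apply: (@Ck_on_ext _ _ _ _ _ (fun z => bump y0 r (t z) *: s (t z))) => //.
    by move=> z [[zd zc] _]; rewrite /= /extend_by_zero asboolT.
  have stV : Ck_on k V t by apply: Ck_on_subset (st k) => z [].
  apply: Ck_on_scale => //.
    exact: (Ck_on_comp_scalar oV (fun _ _ => I) (smooth_bump _ _ k) stV).
  apply: (@Ck_on_comp _ _ _ _ _ V U s t) => //.
  by move=> z [].
pose K := chart_param c @` disc y0 r.
have cK : closed K.
  apply: compact_closed; first exact: manifold_hausdorff.
  apply: continuous_compact; last exact: compact_disc.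
  apply: continuous_in_subspaceT => z /set_mem zd.
  by apply: chart_param_continuous; apply/Uc/dU.
exists (chart_codom d `&` chart_param d @^-1` (~` K)).
  split=> // -[z zd zp]; apply: pK; rewrite /p -zp.
  by have [zc ->] := chart_paramP (Uc (dU zd)); split=> //; exact: dU.
apply: (@Ck_on_ext _ _ _ _ _ (fun=> 0)); last exact: smooth_cst.
  apply: open_preimage_on; [exact: open_chart_codom|exact: chart_param_continuous|].
  by rewrite openC.
move=> z [zd zK]; rewrite /= /extend_by_zero; case: asboolP => // zc.
rewrite bump_eq0 ?scale0r // => zdisc; apply: zK.
by exists (chart_coord c (chart_param d z)) => //; have [] := chart_coordP zc.
Qed.
End ExtendByZero.

Lemma compact_finite_cover (T : topologicalType) (A : T -> set T) :
  compact [set: T] -> (forall p, open (A p)) -> (forall p, A p p) ->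
  exists m (t : 'I_m -> T), forall x, exists i, A (t i) x.
Proof.
(* Along the filter generated by the sequences containing a given finite one, the near-covering
   property becomes a finite subcover. *)
move=> cT oA Ap; pose F := filter_from setT (fun s : seq T => [set s' : seq T | {subset s <= s'}]).
have FF : Filter F.
  apply: filter_from_filter; first by exists [::].
  move=> s t _ _; exists (s ++ t) => // u stu; split=> x xs; apply: stu;
    by rewrite mem_cat xs ?orbT.
have := iffLR (compact_near_coveringP _) cT _ F (fun s x => exists2 p, p \in s & A p x) FF.
case=> [x _|s _ H]; last first.
  exists (size s), (tnth (in_tuple s)) => x; have [p ps px] := H s (fun _ => id) x I.
  have ip : (index p s < size s)%N by rewrite index_mem.
  by exists (Ordinal ip); rewrite (tnth_nth p) /= nth_index.
exists (A x, [set s : seq T | {subset [:: x] <= s}]) => /=.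
  split; first by apply: open_nbhs_nbhs; split.
  by exists [:: x].
by move=> [y s] /= [Axy xs]; exists x => //; apply: xs; rewrite inE.
Qed.

Lemma derive_entry (R : realType) (V : normedModType R) n (f : V -> 'rV[R]_n) x v i :
  differentiable f x -> ('D_v f x) 0 i = 'D_v (fun y => f y 0 i : R) x.
Proof. by move=> df; rewrite derive_mx ?mxE //; exact: diff_derivable. Qed.

Lemma differentiable_entry (R : realType) (V : normedModType R) n (f : V -> 'rV[R]_n) x i :
  differentiable f x -> differentiable (fun y => f y 0 i : R) x.
Proof.
move=> df; apply: (@differentiable_comp _ _ _ _ f (fun z : 'rV[R]_n => z 0 i : R)) => //.
exact: differentiable_coord.
Qed.

(** * Every closed manifold embeds in some sphere *)

Section Whitney.
Context {R : realType} {n : nat} {M : manifold R n}.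

Lemma ex_disc (c : chart R n M) (U : set 'rV[R]_n) y : open U -> U y ->
  exists2 r : R, 0 < r & disc y r `<=` U.
Proof.
move=> oU Uy; have : nbhs y U by exact: open_nbhs_nbhs.
move/nbhs_ballP => [e e0 eU]; exists (e / 2); first by rewrite divr_gt0.
move=> z /(disc_norm (divr_gt0 e0 (ltr0Sn R 1))) yz; apply: eU.
rewrite -ball_normE /= distrC (le_lt_trans yz) // ltr_pdivrMr // ltr_pMr //; lra.
Qed.

Lemma smooth_charts_rows N (g : M -> 'rV[R]_N) :
  (forall a, exists N' (h : M -> 'rV[R]_N') j,
     smooth_charts h /\ forall p, g p 0 a = h p 0 j) -> smooth_charts g.
Proof.
move=> H c ac k; have oc := @open_chart_codom _ _ _ c; apply: Ck_on_row => // a.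
have [N' [h [j [sh E]]]] := H a.
rewrite (_ : (fun y => _) = fun y => (h \o chart_param c) y 0 j).
  exact: (Ck_on_entry j oc (sh c ac k)).
by apply/funext => y; rewrite /= E.
Qed.

(** The entry 1 makes a bump factor visible: the ray of b (1, y) with b > 0 determines y. *)
Definition with_one (y : 'rV[R]_n) : 'rV[R]_n.+1 :=
  \row_j if unlift ord0 j is Some l then y 0 l else 1.

Lemma smooth_with_one U : open U -> smooth_on U with_one.
Proof.
move=> oU k; apply: Ck_on_row => // j; case: (unliftP ord0 j) => [l ->|->].
  rewrite (_ : (fun y => _) = fun y : 'rV[R]_n => y 0 l); first exact: smooth_coord.
  by apply/funext => y; rewrite mxE liftK.
rewrite (_ : (fun y => _) = fun=> 1); first exact: smooth_cst.
by apply/funext => y; rewrite mxE unlift_none.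
Qed.

Lemma ex_disc_chart (p : M) : exists cr : chart R n M * R,
  [/\ atlas cr.1, chart_dom cr.1 p, 0 < cr.2 &
      disc (chart_coord cr.1 p) cr.2 `<=` chart_codom cr.1].
Proof.
have [c ac cp] := atlas_cover p; have [yc _] := chart_coordP cp.
have [r r0 rc] := ex_disc c (@open_chart_codom _ _ _ c) yc.
by exists (c, r).
Qed.

Definition disc_nbhs (c : chart R n M) (y0 : 'rV[R]_n) (r : R) : set M :=
  chart_dom c `&` chart_coord c @^-1` [set y | sqdist y0 y < r ^+ 2].

Lemma open_disc_nbhs c y0 r : open (disc_nbhs c y0 r).
Proof.
apply: open_preimage_on; [exact: open_chart_dom|exact: chart_coord_continuous|].
rewrite (_ : [set _ | _] = sqdist y0 @^-1` [set t | t < r ^+ 2]) //.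
by apply: open_comp; [move=> y _; exact: sqdist_continuous|exact: open_lt].
Qed.

Lemma disc_nbhs_center c p r : chart_dom c p -> 0 < r ->
  disc_nbhs c (chart_coord c p) r p.
Proof. by move=> cp r0; split=> //=; rewrite /sqdist subrr dotv0l exprn_gt0. Qed.

(** The map collects the vectors b (1, y) over finitely many charts. If two values are on one ray, a
    factor b positive at one point is positive at the other, and the coordinates agree. If a
    derivative is radial, D b = a b and D (b y_l) = a b y_l, whence b w_l = 0. *)
Theorem whitney_sphere : compact [set: M] ->
  exists N (f : M -> sphere R N), smooth_embedding f.
Proof.
move=> cM; have [cr crP] := choice ex_disc_chart.
pose c p := (cr p).1; pose r p := (cr p).2.
pose y0 p := chart_coord (c p) p.
have [m [pt cov]] := compact_finite_cover cM (fun p => open_disc_nbhs (c p) (y0 p) (r p))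
  (fun p => let: And4 _ cp r0 _ := crP p in disc_nbhs_center cp r0).
pose e p := extend_by_zero (c p) (y0 p) (r p) with_one.
have se p : smooth_charts (e p).
  have [ac _ r0 dc] := crP p.
  have oc := @open_chart_codom _ _ _ (c p).
  exact: (smooth_extend_by_zero r0 ac oc (@subset_refl _ _) dc (smooth_with_one oc)).
pose g p : 'rV[R]_#|{: 'I_m * 'I_n.+1}| :=
  \row_a e (pt (enum_val a).1) p 0 (enum_val a).2.
have gE p i j : g p 0 (enum_rank (i, j)) = e (pt i) p 0 j by rewrite mxE enum_rankK.
have eE q p : chart_dom (c q) p ->
    e q p = bump (y0 q) (r q) (chart_coord (c q) p) *: with_one (chart_coord (c q) p).
  by move=> cp; rewrite /e /extend_by_zero asboolT.
have w0 y : with_one y 0 ord0 = 1 by rewrite mxE unlift_none.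
have wl y l : with_one y 0 (lift ord0 l) = y 0 l by rewrite mxE liftK.
exists #|{: 'I_m * 'I_n.+1}|; apply: (@ray_embedding R n M cM _ g).
- apply: smooth_charts_rows => a.
  by exists n.+1, (e (pt (enum_val a).1)), (enum_val a).2; split=> // p; rewrite mxE.
- move=> p; have [i [cp pi]] := cov p; apply/eqP => /rowP/(_ (enum_rank (i, ord0))).
  rewrite gE eE // [RHS]mxE mxE w0 mulr1 => /eqP.
  by rewrite gt_eqF // bump_gt0.
- move=> p q t t0 pq; have [i [cp pi]] := cov p.
  have E j : e (pt i) p 0 j = t * e (pt i) q 0 j by rewrite -!gE pq mxE.
  have bp : 0 < bump (y0 (pt i)) (r (pt i)) (chart_coord (c (pt i)) p) by rewrite bump_gt0.
  have := E ord0; rewrite eE // mxE w0 mulr1.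
  have [cq|ncq] := pselect (chart_dom (c (pt i)) q); last first.
    rewrite /e /extend_by_zero asboolF // mxE mulr0 => b0.
    by move: bp; rewrite b0 ltxx.
  rewrite eE // mxE w0 mulr1 => b0.
  suff cc : chart_coord (c (pt i)) p = chart_coord (c (pt i)) q.
    by have [_ <-] := chart_coordP cp; have [_ <-] := chart_coordP cq; rewrite cc.
  apply/rowP => l; have := E (lift ord0 l); rewrite !eE // !mxE !liftK mulrA -b0.
  by move/mulfI; apply; rewrite gt_eqF.
- move=> p; have [i [cp pi]] := cov p; have [ac _ r0 _] := crP (pt i).
  exists (c (pt i)); split=> // w a dw; have [yc yp] := chart_coordP cp.
  set y := chart_coord (c (pt i)) p in dw yc yp pi *.
  have sg : smooth_charts g.
    apply: smooth_charts_rows => b.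
    by exists n.+1, (e (pt (enum_val b).1)), (enum_val b).2; split=> // q; rewrite mxE.
  have dg := smooth_charts_differentiable sg ac yc.
  pose b := bump (y0 (pt i)) (r (pt i)).
  have b0 : 0 < b y by rewrite bump_gt0.
  have db : differentiable b y by have [+ _] := smooth_bump (y0 (pt i)) (r (pt i)) 1%N; exact.
  have oc := @open_chart_codom _ _ _ (c (pt i)).
  have E j : 'D_w (fun z => b z * with_one z 0 j) y = a * (b y * with_one y 0 j).
    have := congr1 (fun v : 'rV[R]__ => v 0 (enum_rank (i, j))) dw.
    rewrite derive_entry // mxE gE eE // mxE => <-.
    apply: (near_derive_eq w oc yc) => z zc; rewrite gE eE; last by have [] := chart_paramP zc.
    by rewrite (chart_paramP zc).2 [RHS]mxE.
  have D0 : 'D_w b y = a * b y.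
    have := E ord0; rewrite w0 mulr1 => <-; congr ('D_w _ y).
    by apply/funext => z; rewrite w0 mulr1.
  apply/rowP => l; rewrite mxE; have := E (lift ord0 l); rewrite wl.
  rewrite (_ : (fun z => _) = fun z : 'rV[R]_n => b z * z 0 l); last first.
    by apply/funext => z; rewrite wl.
  have dl : differentiable (fun z : 'rV[R]_n => z 0 l : R) y by exact: differentiable_coord.
  rewrite (deriveM (diff_derivable db) (diff_derivable dl)) D0.
  rewrite -(@derive_entry R _ _ id) // derive_id /GRing.scale /=.
  move=> H; apply: (mulfI (lt0r_neq0 b0)); rewrite mulr0.
  by apply: (addIr (y 0 l * (a * b y))); rewrite H add0r; ring.
Qed.

End Whitney.

(** * Second order supports *)

Lemma is_derive_line (R : realType) (V W : normedModType R) (f : V -> W) y v (t : R) :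
  derivable f (y + t *: v) v ->
  is_derive t (1 : R) (fun s : R => f (y + s *: v)) ('D_v f (y + t *: v)).
Proof.
move=> df; have E : (fun h : R => h^-1 *: (((fun s : R => f (y + s *: v)) \o shift t) (h *: (1 : R)) -
    f (y + t *: v))) = (fun h => h^-1 *: ((f \o shift (y + t *: v)) (h *: v) - f (y + t *: v))).
  apply/funext => h; congr (_ *: (_ - _)) => /=; congr f.
  by rewrite -[h *: 1]/(h * 1) mulr1 scalerDl addrCA.
by apply: DeriveDef; [move: df; rewrite /derivable -E|rewrite /derive -E].
Qed.

(** The mean value theorem applied twice along the segment. *)
Lemma segment_increase (R : realType) (V : normedModType R) (psi : V -> R) y v (s : R) :
  0 < s ->
  (forall t : R, 0 <= t <= s -> derivable psi (y + t *: v) v) ->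
  (forall t : R, 0 <= t <= s -> derivable ('D_v psi) (y + t *: v) v) ->
  'D_v psi y = 0 ->
  (forall t : R, 0 <= t <= s -> 0 < 'D_v ('D_v psi) (y + t *: v)) ->
  psi y < psi (y + s *: v).
Proof.
move=> s0 d1 d2 D0 D2.
have cont (f : V -> R) b : (forall t : R, 0 <= t <= s -> derivable f (y + t *: v) v) -> b <= s ->
    {within `[0, b], continuous (fun t : R => f (y + t *: v))}.
  move=> df bs; apply: continuous_in_subspaceT => t /set_mem /=; rewrite in_itv /= => /andP[t0 tb].
  apply/differentiable_continuous/derivable1_diffP.
  by have [] := is_derive_line (df t _) => //; rewrite t0 (le_trans tb).
have MVTl (f : V -> R) b : (forall t : R, 0 <= t <= s -> derivable f (y + t *: v) v) -> 0 < b -> b <= s ->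
    exists2 x : R, 0 < x < b & f (y + b *: v) - f y = 'D_v f (y + x *: v) * b.
  move=> df b0 bs; have [x|x xb E] := @MVT R (fun t => f (y + t *: v)) (fun t => 'D_v f (y + t *: v)) 0 b b0 _ (cont f b df bs).
    rewrite in_itv /= => /andP[x0 xb]; apply: is_derive_line; apply: df.
    by rewrite ltW //= (le_trans (ltW xb)).
  exists x; first by move: xb; rewrite in_itv.
  by move: E; rewrite scale0r addr0 subr0.
have [x /andP[x0 xs] E] := MVTl psi s d1 s0 (lexx _).
have [z /andP[z0 zx] E'] := MVTl ('D_v psi) x d2 x0 (ltW xs).
rewrite -subr_gt0 E; apply: mulr_gt0 => //; move: E'; rewrite D0 subr0 => ->.
apply: mulr_gt0 => //; apply: D2.
by rewrite ltW //= ltW // (lt_trans zx).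
Qed.

Section SecondDerivatives.
Context {R : realType} {n : nat}.
Implicit Types (U : set 'rV[R]_n) (v y : 'rV[R]_n).

Lemma Ck2_derivable (W : normedModType R) U (f : 'rV[R]_n -> W) y v : Ck_on 2 U f -> U y ->
  derivable f y v /\ forall w, derivable ('D_w f) y v.
Proof.
move=> [df Df] Uy; split; first exact: diff_derivable (df y Uy).
by move=> w; have [dDf _] := Df w; exact: diff_derivable (dDf y Uy).
Qed.

Lemma second_derivative_min U (psi : 'rV[R]_n -> R) y v : open U -> U y -> Ck_on 2 U psi ->
  (forall z, U z -> psi y <= psi z) -> 'D_v psi y = 0 /\ 0 <= 'D_v ('D_v psi) y.
Proof.
move=> oU Uy Cp pmin.
have near_line w : exists2 s : R, 0 < s & forall t : R, `|t| <= s -> U (y + t *: w).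
  have /nbhs_ballP[e e0 eU] : nbhs y U by exact: open_nbhs_nbhs.
  exists (e / 2 / (1 + `|w|)) => [|t te]; first by rewrite !divr_gt0 // ltr_pwDl.
  apply: eU; rewrite -ball_normE /= opprD addNKr normrN normrZ.
  have w1 : 0 < 1 + `|w| by rewrite ltr_pwDl.
  apply: (@le_lt_trans _ _ (e / 2)); last by rewrite ltr_pdivrMr // ltr_pMr //; lra.
  apply: le_trans (_ : `|t| * (1 + `|w|) <= _); first by rewrite ler_wpM2l // lerDr.
  by rewrite -ler_pdivlMr.
have D0 : 'D_v psi y = 0.
  have [s s0 sU] := near_line v.
  have := @derive1_at_max R (fun t => - psi (y + t *: v)) (- s) s 0.
  have dl t : `|t| <= s -> is_derive t (1 : R) (fun t => - psi (y + t *: v)) (- 'D_v psi (y + t *: v)).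
    move=> ts; apply: (@is_deriveN R R R (fun t => psi (y + t *: v))).
    by apply: is_derive_line; have [] := Ck2_derivable v Cp (sU t ts).
  case=> [|t|||]; rewrite ?in_itv /=.
  - by lra.
  - move=> /andP[t1 t2]; have ts : `|t| <= s by rewrite ler_norml !ltW.
    by have [] := dl t ts.
  - by rewrite oppr_lt0 s0.
  - move=> t; rewrite in_itv /= => /andP[t1 t2]; rewrite lerN2 scale0r addr0.
    by apply/pmin/sU; rewrite ler_norml !ltW.
  move=> _ E; have s0' : `|0 : R| <= s by rewrite normr0 ltW.
  have [_] := dl 0 s0'; rewrite E scale0r addr0 => /eqP; rewrite eq_sym oppr_eq0.
  by move/eqP.
split => //; rewrite leNgt; apply/negP => D2.
have [_ D2p] := Cp; have [_ /(_ v) cD2] := D2p v.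
have [e e0 eP] : exists2 e : R, 0 < e & forall z, `|z - y| < e -> U z -> 'D_v ('D_v psi) z < 0.
  have D2' : 0 < - 'D_v ('D_v psi) y by rewrite oppr_gt0.
  have [e e0 eP] := near_closeP (cD2 y Uy) D2'.
  exists e; first exact: e0.
  move=> z ze _; have H := eP z ze; move: H.
  move: ('D_v ('D_v psi) z) ('D_v ('D_v psi) y) => a b.
  by rewrite ltr_distl subrr => /andP[].
have [s s0 sU] := near_line v.
have w1 : 0 < 1 + `|v| by rewrite ltr_pwDl.
pose t0 := Order.min s (e / 2 / (1 + `|v|)).
have t00 : 0 < t0 by rewrite lt_min s0 !divr_gt0.
have tU t : 0 <= t <= t0 -> U (y + t *: v) /\ `|y + t *: v - y| < e.
  move=> /andP[ta tb]; move: tb; rewrite le_min => /andP[ts te].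
  split; first by apply: sU; rewrite ger0_norm.
  rewrite addrC addKr normrZ ger0_norm //.
  apply: (@le_lt_trans _ _ (e / 2)); last by rewrite ltr_pdivrMr // ltr_pMr //; lra.
  apply: le_trans (_ : t * (1 + `|v|) <= _); first by rewrite ler_wpM2l // lerDr.
  by rewrite -ler_pdivlMr.
have DN z : U z -> 'D_v (- psi) z = - 'D_v psi z.
  by move=> Uz; rewrite deriveN //; have [] := Ck2_derivable v Cp Uz.
have DDN z : U z -> 'D_v ('D_v (- psi)) z = - 'D_v ('D_v psi) z.
  move=> Uz; rewrite (near_derive_eq v oU Uz (g := - 'D_v psi)); last by move=> x /DN.
  by rewrite deriveN //; have [_] := Ck2_derivable v Cp Uz.
have CN : Ck_on 2 U (- psi).
  apply: (Ck_on_ext (f := fun z => -1 * psi z) oU); last first.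
    by apply: Ck_onM; [exact: oU|exact: smooth_cst|exact: Cp].
  by move=> z _; rewrite mulN1r.
have H : (- psi) y < (- psi) (y + t0 *: v).
  apply: segment_increase; first exact: t00.
  - by move=> t /tU[tu _]; have [] := Ck2_derivable v CN tu.
  - by move=> t /tU[tu _]; have [_] := Ck2_derivable v CN tu.
  - by rewrite DN // D0 oppr0.
  - by move=> t /tU[tu te]; rewrite DDN // oppr_gt0; exact: eP.
have Ut0 : U (y + t0 *: v) by have [] := tU t0 _; rewrite ?lexx ?ltW.
by move: H; rewrite [X in X < _]/(- psi y) [X in _ < X]/(- psi _) ltNge lerN2 pmin.
Qed.

End SecondDerivatives.

Lemma derive_dotv (R : realType) (V : normedModType R) n (f g : V -> 'rV[R]_n) x v :
  differentiable f x -> differentiable g x ->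
  'D_v (fun y => dotv (f y) (g y)) x = dotv ('D_v f x) (g x) + dotv (f x) ('D_v g x).
Proof.
move=> df dg.
have dfi i := diff_derivable (v := v) (differentiable_entry i df).
have dgi i := diff_derivable (v := v) (differentiable_entry i dg).
rewrite (_ : (fun y => _) = \sum_i ((fun y => f y 0 i : R) * (fun y => g y 0 i : R))); last first.
  by apply/funext => y; rewrite fct_sumE.
rewrite derive_sum; last by move=> i; apply: derivableM.
rewrite /dotv -big_split; apply: eq_bigr => i _ /=.
rewrite (deriveM (dfi i) (dgi i)) (derive_entry v i df) (derive_entry v i dg).
rewrite /GRing.scale /= addrC; congr (_ + _).
exact: mulrC.
Qed.

Section SupportFunction.
Context {R : realType} {n N : nat}.
Variables (a : 'rV[R]_N) (k : R) (z0 : 'rV[R]_N) (G : 'rV[R]_n -> 'rV[R]_N).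

(** The slack of the quadratic support inequality at [z0]; where [G y = z0] it is 0, hence minimal
    when the inequality holds. *)
Definition sup_fun (y : 'rV[R]_n) : R :=
  dotv a (z0 - G y) - k * dotv (z0 - G y) (z0 - G y).

Lemma Ck_sup_fun m (U : set 'rV[R]_n) : open U -> Ck_on m U G -> Ck_on m U sup_fun.
Proof.
move=> oU CG; have CQ : Ck_on m U (fun y => z0 - G y).
  apply: (Ck_on_ext (f := fun y => z0 + (-1) *: G y) oU).
    by move=> y _; rewrite scaleN1r.
  by apply: Ck_onD => //; [exact: smooth_cst|apply: Ck_on_scale => //; exact: smooth_cst].
apply: (Ck_on_ext (f := fun y => dotv a (z0 - G y) + (- k) * dotv (z0 - G y) (z0 - G y)) oU).
  by move=> y _; rewrite mulNr.
apply: Ck_onD => //; first by apply: Ck_on_dotv => //; exact: smooth_cst.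
by apply: Ck_onM => //; [exact: smooth_cst|exact: Ck_on_dotv].
Qed.

Lemma sup_fun_D1 y v : differentiable G y ->
  'D_v sup_fun y = - dotv a ('D_v G y) + 2 * k * dotv (z0 - G y) ('D_v G y).
Proof.
move=> dG; have dQ : differentiable (fun y => z0 - G y) y.
  by apply: differentiableB => //; exact: differentiable_cst.
have DQ : 'D_v (fun y => z0 - G y) y = - 'D_v G y.
  have -> := @deriveB R _ _ (fun=> z0) G y v (derivable_cst z0 y v) (diff_derivable dG).
  by rewrite derive_cst sub0r.
have da : differentiable (fun y => dotv a (z0 - G y)) y.
  rewrite (_ : (fun y => _) = \sum_i (fun y => a 0 i * (z0 - G y) 0 i)); last first.
    by apply/funext => z; rewrite fct_sumE.
  apply: differentiable_sum => i; apply: differentiableM; first exact: differentiable_cst.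
  exact: (differentiable_entry i dQ).
have dq : differentiable (fun y => dotv (z0 - G y) (z0 - G y)) y.
  rewrite (_ : (fun y => _) = \sum_i (fun y => (z0 - G y) 0 i * (z0 - G y) 0 i)); last first.
    by apply/funext => z; rewrite fct_sumE.
  by apply: differentiable_sum => i; apply: differentiableM; exact: (differentiable_entry i dQ).
rewrite (_ : sup_fun = (fun y => dotv a (z0 - G y)) - k \*: (fun y => dotv (z0 - G y) (z0 - G y))) //.
rewrite deriveB; [|exact: diff_derivable|exact/derivableZ/diff_derivable].
rewrite deriveZ; last exact: diff_derivable.
rewrite (derive_dotv v (differentiable_cst a y) dQ) (derive_dotv v dQ dQ).
rewrite DQ derive_cst dotv0l add0r !dotvNr dotvNl (dotvC ('D_v G y)) /GRing.scale /=.
by ring.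
Qed.

Lemma sup_fun_D2 (U : set 'rV[R]_n) y v : open U -> U y -> Ck_on 2 U G ->
  'D_v ('D_v sup_fun) y = - dotv a ('D_v ('D_v G) y) +
    2 * k * (dotv (z0 - G y) ('D_v ('D_v G) y) - dotv ('D_v G y) ('D_v G y)).
Proof.
move=> oU Uy CG; have [dG DG] := CG; have [dDG _] := DG v.
have dQ : differentiable (fun y => z0 - G y) y.
  by apply: differentiableB; [exact: differentiable_cst|exact: dG].
have DQ : 'D_v (fun y => z0 - G y) y = - 'D_v G y.
  have -> := @deriveB R _ _ (fun=> z0) G y v (derivable_cst z0 y v) (diff_derivable (dG y Uy)).
  by rewrite derive_cst sub0r.
pose f1 z := dotv a ('D_v G z); pose f2 z := dotv (z0 - G z) ('D_v G z).
rewrite (near_derive_eq v oU Uy (g := (- f1) + (2 * k) \*: f2)); last first.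
  by move=> z Uz; rewrite sup_fun_D1 //; exact: dG.
have dD := dDG y Uy.
have df1 : differentiable f1 y.
  rewrite (_ : f1 = \sum_i (fun y => a 0 i * ('D_v G y) 0 i)); last first.
    by apply/funext => z; rewrite fct_sumE.
  apply: differentiable_sum => i; apply: differentiableM; first exact: differentiable_cst.
  exact: (differentiable_entry i dD).
have df2 : differentiable f2 y.
  rewrite (_ : f2 = \sum_i (fun y => (z0 - G y) 0 i * ('D_v G y) 0 i)); last first.
    by apply/funext => z; rewrite fct_sumE.
  apply: differentiable_sum => i; apply: differentiableM; first exact: (differentiable_entry i dQ).
  exact: (differentiable_entry i dD).
rewrite deriveD; [|exact/derivableN/diff_derivable|exact/derivableZ/diff_derivable].
rewrite deriveN; last exact: diff_derivable.
rewrite deriveZ; last exact: diff_derivable.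
rewrite (derive_dotv v (differentiable_cst a y) dD) (derive_dotv v dQ dD).
rewrite DQ derive_cst dotv0l add0r dotvNl /GRing.scale /=.
by congr (_ + _ * _); rewrite addrC.
Qed.
End SupportFunction.

Lemma derive2_basis (R : realType) n (W : normedModType R) (U : set 'rV[R]_n)
    (G : 'rV[R]_n -> W) y u v : open U -> U y -> Ck_on 2 U G ->
  'D_u ('D_v G) y = \sum_i \sum_j
    (u 0 i * v 0 j) *: 'D_(delta_mx 0 i) ('D_(delta_mx 0 j) G) y.
Proof.
move=> oU Uy CG; have [dG DG] := CG.
rewrite (near_derive_eq u oU Uy (g := \sum_j (v 0 j \*: 'D_(delta_mx 0 j) G))); last first.
  by move=> z Uz; rewrite (derive_basis _ (dG z Uz)) fct_sumE.
have dj j : differentiable ('D_(delta_mx 0 j) G) y by have [+ _] := DG (delta_mx 0 j); exact.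
rewrite derive_sum; last by move=> j; exact/derivableZ/diff_derivable.
rewrite exchange_big; apply: eq_bigr => j _ /=.
rewrite deriveZ; last exact: diff_derivable.
rewrite derive_basis // scaler_sumr; apply: eq_bigr => i _.
by rewrite scalerA mulrC.
Qed.

Lemma derive2_dotv_zero (R : realType) n N (U : set 'rV[R]_n) (P Q : 'rV[R]_n -> 'rV[R]_N) y w :
  open U -> U y -> Ck_on 2 U P -> Ck_on 2 U Q -> P y = 0 -> Q y = 0 ->
  'D_w ('D_w (fun z => dotv (P z) (Q z))) y = 2 * dotv ('D_w P y) ('D_w Q y).
Proof.
move=> oU Uy CP CQ P0 Q0; have [dP DP] := CP; have [dQ DQ] := CQ.
have [dDP _] := DP w; have [dDQ _] := DQ w.
pose f1 z := dotv ('D_w P z) (Q z); pose f2 z := dotv (P z) ('D_w Q z).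
rewrite (near_derive_eq w oU Uy (g := f1 + f2)); last first.
  by move=> z Uz; rewrite (derive_dotv w (dP z Uz) (dQ z Uz)).
have Cf1 : Ck_on 1 U f1.
  by apply: Ck_on_dotv; [exact: oU|exact: (DP w)|exact: Ck_onW CQ].
have Cf2 : Ck_on 1 U f2.
  by apply: Ck_on_dotv; [exact: oU|exact: Ck_onW CP|exact: (DQ w)].
rewrite deriveD; [|exact: diff_derivable (Cf1.1 y Uy)|exact: diff_derivable (Cf2.1 y Uy)].
rewrite (derive_dotv w (dDP y Uy) (dQ y Uy)) (derive_dotv w (dP y Uy) (dDQ y Uy)).
by rewrite P0 Q0 dotv0l dotv0r add0r addr0 mulr2n mulrDl mul1r.
Qed.

(** * Projection to the normal space and uniform positivity *)

Section NormalPart.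
Variables (R : realType) (n N : nat).
Implicit Types (a : 'rV[R]_N) (J : 'M[R]_(n, N)).

Definition gram J : 'M[R]_n := J *m J^T.

(* Orthogonal projection of [a] to the complement of the row space of [J], when the rows
   of [J] are independent. *)
Definition normal_part a J : 'rV[R]_N :=
  a - (\det (gram J))^-1 *: (a *m J^T *m \adj (gram J) *m J).

Lemma normal_part_orth a J : \det (gram J) != 0 -> normal_part a J *m J^T = 0.
Proof.
move=> d0; rewrite mulmxBl -scalemxAl -!mulmxA -/(gram J) mul_adj_mx.
by rewrite mulmxA mul_mx_scalar scalerA mulVf // scale1r subrr.
Qed.

Lemma normal_part_id a J : a *m J^T = 0 -> normal_part a J = a.
Proof. by move=> aJ; rewrite /normal_part aJ !mul0mx scaler0 subr0. Qed.

Lemma gram_det_neq0 J : (forall v : 'rV[R]_n, v *m J = 0 -> v = 0) -> \det (gram J) != 0.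
Proof.
move=> J_inj; apply/negP => /det0P[v v0 vJ]; case/eqP: v0; apply: J_inj.
apply/eqP; rewrite -dotv_eq0; apply/eqP.
have : (v *m gram J) *m v^T = 0 by rewrite vJ mul0mx.
rewrite /gram mulmxA -mulmxA -trmx_mul => /matrixP/(_ 0 0); rewrite [LHS]mxE [RHS]mxE => <-.
by apply: eq_bigr => i _; congr (_ * _); rewrite [RHS]mxE.
Qed.

Section Smooth.
Variables (V : normedModType R) (k : nat) (U : set V) (J : V -> 'M[R]_(n, N)).
Hypotheses (oU : open U) (CJ : forall i j, Ck_on k U (fun x => J x i j : R)).

Lemma Ck_on_det m (A : V -> 'M[R]_m) : (forall i j, Ck_on k U (fun x => A x i j : R)) ->
  Ck_on k U (fun x => \det (A x)).
Proof.
move=> CA; apply: Ck_on_bigsum => // s; apply: Ck_onM => //; first exact: smooth_cst.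
exact: Ck_on_bigprod.
Qed.

Lemma Ck_on_mul m p q (A : V -> 'M[R]_(m, p)) (B : V -> 'M[R]_(p, q)) :
  (forall i j, Ck_on k U (fun x => A x i j : R)) ->
  (forall i j, Ck_on k U (fun x => B x i j : R)) ->
  forall i j, Ck_on k U (fun x => (A x *m B x) i j : R).
Proof.
move=> CA CB i j.
rewrite (_ : (fun x => _) = fun x => \sum_l A x i l * B x l j).
  by apply: Ck_on_bigsum => // l; exact: Ck_onM.
by apply/funext => x; rewrite mxE.
Qed.

Lemma Ck_on_tr m p (A : V -> 'M[R]_(m, p)) : (forall i j, Ck_on k U (fun x => A x i j : R)) ->
  forall i j, Ck_on k U (fun x => (A x)^T i j : R).
Proof.
move=> CA i j; rewrite (_ : (fun x => _) = fun x => A x j i); first exact: CA.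
by apply/funext => x; rewrite mxE.
Qed.

Lemma Ck_on_gram i j : Ck_on k U (fun x => gram (J x) i j : R).
Proof. by apply: Ck_on_mul => //; exact: Ck_on_tr. Qed.

(** The cofactors are polynomial in the entries, so writing the inverse of the Gram matrix with its
    adjugate shows the smoothness of the projection. *)
Lemma Ck_on_adj m (A : V -> 'M[R]_m) : (forall i j, Ck_on k U (fun x => A x i j : R)) ->
  forall i j, Ck_on k U (fun x => \adj (A x) i j : R).
Proof.
move=> CA i j.
rewrite (_ : (fun x => _) = fun x => (-1) ^+ (j + i) * \det (row' j (col' i (A x)))).
  apply: Ck_onM => //; first exact: smooth_cst.
  apply: Ck_on_det => l l'.
  rewrite (_ : (fun x => _) = fun x => A x (lift j l) (lift i l')); first exact: CA.
  by apply/funext => x; rewrite !mxE.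
by apply/funext => x; rewrite mxE.
Qed.

Lemma Ck_on_normal_part a : (forall x, U x -> \det (gram (J x)) != 0) ->
  Ck_on k U (fun x => normal_part a (J x)).
Proof.
move=> d0; apply: Ck_on_row => // i.
rewrite (_ : (fun x => _) = fun x => a 0 i + (- (\det (gram (J x)))^-1) *
    (a *m (J x)^T *m \adj (gram (J x)) *m J x) 0 i); last first.
  by apply/funext => x; rewrite !mxE mulNr.
apply: Ck_onD => //; first exact: smooth_cst.
apply: Ck_onM => //.
  rewrite (_ : (fun x => _) = fun x => -1 * (\det (gram (J x)))^-1); last first.
    by apply/funext => x; rewrite mulN1r.
  apply: Ck_onM => //; first exact: smooth_cst.
  by apply: Ck_onV => //; apply: Ck_on_det; exact: Ck_on_gram.
apply: Ck_on_mul => //; apply: Ck_on_mul; last by apply: Ck_on_adj; exact: Ck_on_gram.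
apply: Ck_on_mul; last exact: Ck_on_tr.
by move=> i' j; exact: smooth_cst.
Qed.
End Smooth.

Lemma normal_part_near a J e : 0 < e -> \det (gram J) != 0 -> a *m J^T = 0 ->
  exists2 d, 0 < d & forall J', `|J' - J| < d ->
    \det (gram J') != 0 /\ `|normal_part a J' - a| < e.
Proof.
move=> e0 d0 aJ.
have Cid (U : set 'M[R]_(n, N)) i j : Ck_on 0 U (fun x : 'M[R]_(n, N) => x i j : R).
  by move=> x _; exact: coord_continuous.
have cdet : continuous (fun x : 'M[R]_(n, N) => \det (gram x) : R).
  move=> x; apply: (@Ck_on_det 'M[R]_(n, N) 0 setT openT n gram) => // i j.
  exact: (@Ck_on_gram 'M[R]_(n, N) 0 setT id openT).
pose U := [set x : 'M[R]_(n, N) | \det (gram x) != 0].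
have oU : open U.
  rewrite (_ : U = (fun x : 'M[R]_(n, N) => \det (gram x)) @^-1` [set r | r != 0]) //.
  by apply: open_comp; [move=> x _; exact: cdet|exact: open_neq].
have cn : {for J, continuous (normal_part a)}.
  exact: (@Ck_on_normal_part 'M[R]_(n, N) 0 U id oU).
have [d1 d10 H1] := near_closeP cn e0.
have [|d2 d20 H2] := near_closeP (cdet J) (e := `|\det (gram J)|); first by rewrite normr_gt0.
exists (Order.min d1 d2); first by rewrite lt_min d10.
move=> J'; rewrite lt_min => /andP[J1 J2]; split.
  by apply/negP => /eqP dJ'; have := H2 J' J2; rewrite dJ' sub0r normrN ltxx.
by rewrite -[X in _ - X](normal_part_id aJ); exact: H1.
Qed.

End NormalPart.

Lemma continuous_pairT (S T U : topologicalType) (f : S -> T) (g : S -> U) x :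
  {for x, continuous f} -> {for x, continuous g} ->
  {for x, continuous (fun y => (f y, g y))}.
Proof.
move=> cf cg; rewrite /prop_for /continuous_at.
exact: (cvg_pair (G := nbhs (f x)) (H := nbhs (g x)) cf cg).
Qed.

(** The radius is uniform, and [w] may leave the compact set: this is what turns a pointwise strict
    inequality into a tolerance for perturbations. *)
Lemma robust_pos (R : realType) (W : normedModType R) (C : set W) (phi : W -> R) :
  compact C -> (forall x, C x -> {for x, continuous phi}) -> (forall x, C x -> 0 < phi x) ->
  exists2 e : R, 0 < e & forall x w, C x -> `|w - x| < e -> 0 < phi w.
Proof.
move=> cC cphi phi0.
have := iffLR (compact_near_coveringP C) cC _ _
  (fun e x => forall w, `|w - x| < e -> 0 < phi w) (at_right_proper_filter (0 : R)).
case=> [x Cx|e /= e0 He]; last first.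
  exists (e / 2); first by rewrite divr_gt0.
  move=> x w Cx; apply: He => //; rewrite ?divr_gt0 //= sub0r normrN gtr0_norm ?divr_gt0 //.
  by rewrite ltr_pdivrMr // ltr_pMr //; lra.
have [d d0 dP] := near_same_sign (cphi x Cx) (lt0r_neq0 (phi0 x Cx)).
have d2 : 0 < d / 2 by rewrite divr_gt0.
exists ([set x' | `|x' - x| < d / 2], [set e | 0 < e < d / 2]) => /=.
  split; first by apply/nbhs_ballP; exists (d / 2) => // x'; rewrite -ball_normE /= distrC.
  exists (d / 2) => // e /=; rewrite sub0r normrN => er e0.
  by rewrite e0 (le_lt_trans (ler_norm _) er).
move=> [x' e] /= [x'x /andP[e0 ed]] w wx'.
have : `|w - x| < d.
  rewrite -(subrK x' w) -addrA (le_lt_trans (ler_normD _ _)) //.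
  by rewrite (splitr d) ltrD // (lt_trans wx').
by move=> /dP; rewrite pmulr_rgt0 // phi0.
Qed.

Section Jacobian.
Variables (R : realType) (n N : nat).
Implicit Types (G : 'rV[R]_n -> 'rV[R]_N) (v y : 'rV[R]_n) (a : 'rV[R]_N).

Definition jac G y : 'M[R]_(n, N) := \matrix_(i, j) ('D_(delta_mx 0 i) G y) 0 j.

Lemma mul_jac G y v : differentiable G y -> v *m jac G y = 'D_v G y.
Proof.
move=> dG; rewrite derive_basis //; apply/rowP => j; rewrite mxE summxE.
by apply: eq_bigr => i _; rewrite !mxE.
Qed.

Lemma dotv_mul (u w : 'rV[R]_N) : dotv u w = (u *m w^T) 0 0.
Proof. by rewrite mxE; apply: eq_bigr => i _; rewrite [in RHS]mxE. Qed.

Lemma normal_part_derive a G y v : differentiable G y -> \det (gram (jac G y)) != 0 ->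
  dotv (normal_part a (jac G y)) ('D_v G y) = 0.
Proof.
move=> dG d0; rewrite dotv_mul -mul_jac // trmx_mul mulmxA normal_part_orth //.
by rewrite mul0mx mxE.
Qed.

Lemma norm_delta_le1 i : `|delta_mx 0 i : 'rV[R]_n| <= 1.
Proof.
apply: rV_norm_le => // j; rewrite mxE eqxx /=.
by case: (j == i); rewrite ?normr1 ?normr0.
Qed.

Lemma jac_dist G G' y y' e : 0 < e ->
  (forall i, `|'D_(delta_mx 0 i) G y - 'D_(delta_mx 0 i) G' y'| < e) ->
  `|jac G y - jac G' y'| < e.
Proof.
move=> e0 H; rewrite [ltLHS]/Num.Def.normr /= mx_normrE.
apply/bigmax_ltP; split=> // -[i j] _ /=; rewrite !mxE.
have := le_lt_trans (le_coord_norm _ j) (H i).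
by rewrite !mxE.
Qed.

Lemma norm_sum_coord_le v (f : 'I_n -> 'rV[R]_N) : `|v| <= 1 ->
  `|\sum_i v 0 i *: f i| <= \sum_i `|f i|.
Proof.
move=> v1; apply: le_trans (ler_norm_sum _ _ _) _; apply: ler_sum => i _.
by rewrite normrZ ler_piMl // (le_trans (le_coord_norm v i)).
Qed.

(** The expression is the second derivative of [sup_fun] with k/2 for k, where [z], [B] and [A]
    stand for the chord and for the first and second derivatives. Unit directions form a compact
    set, so one [e] serves them all. *)
Lemma quad_robust a0 (k : R) (B0 A0 : 'rV[R]_n -> 'rV[R]_N) :
  continuous B0 -> continuous A0 ->
  (forall v, `|v| = 1 -> 0 < - dotv a0 (A0 v) - k * dotv (B0 v) (B0 v)) ->
  exists2 e : R, 0 < e & forall v, `|v| = 1 -> forall a z B A, `|a - a0| < e -> `|z| < e ->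
    `|B - B0 v| < e -> `|A - A0 v| < e -> 0 < - dotv a A + k * (dotv z A - dotv B B).
Proof.
move=> cB cA pos.
pose W := (('rV[R]_N * 'rV[R]_N) * ('rV[R]_N * 'rV[R]_N))%type.
pose c v : W := ((a0, 0), (B0 v, A0 v)).
pose phi (w : W) := - dotv w.1.1 w.2.2 + k * (dotv w.1.2 w.2.2 - dotv w.2.1 w.2.1).
have cc : continuous c.
  move=> v; apply: continuous_pairT; first exact: cst_continuous.
  by apply: continuous_pairT; [exact: cB|exact: cA].
have c11 : continuous (fun w : W => w.1.1).
  by move=> w; apply: (@continuous_comp _ _ _ fst fst); exact: cvg_fst.
have c12 : continuous (fun w : W => w.1.2).
  by move=> w; apply: (@continuous_comp _ _ _ fst snd); [exact: cvg_fst|exact: cvg_snd].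
have c21 : continuous (fun w : W => w.2.1).
  by move=> w; apply: (@continuous_comp _ _ _ snd fst); [exact: cvg_snd|exact: cvg_fst].
have c22 : continuous (fun w : W => w.2.2).
  by move=> w; apply: (@continuous_comp _ _ _ snd snd); exact: cvg_snd.
have cphi : continuous phi.
  move=> w; apply: (@continuousD R R W (fun w => - dotv w.1.1 w.2.2)).
    apply: (@continuousN R R W (fun w => dotv w.1.1 w.2.2)).
    by apply: dotv_continuous_comp; [exact: c11|exact: c22].
  apply: (@continuousM R W (fun=> k)); first exact: cst_continuous.
  apply: (@continuousB R R W (fun w => dotv w.1.2 w.2.2)).
    by apply: dotv_continuous_comp; [exact: c12|exact: c22].
  by apply: dotv_continuous_comp; exact: c21.
have [|x _|x [v v1 <-]|e e0 eP] := @robust_pos R W (c @` [set v : 'rV[R]_n | `|v| = 1]) phi.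
- by apply: continuous_compact; [exact: continuous_subspaceT|exact: compact_norm_sphere].
- exact: cphi.
- by rewrite /phi /= dotv0l sub0r mulrN; exact: pos.
exists e => // v v1 a z B A aa zz BB AA.
apply: (eP (c v) ((a, z), (B, A))); first by exists v.
by rewrite !prod_normE /= !gt_max aa subr0 zz BB AA.
Qed.

Lemma far_robust a0 (k : R) (C : set 'rV[R]_N) : compact C ->
  (forall z, C z -> 0 < dotv a0 z - k * dotv z z) ->
  exists2 e : R, 0 < e & forall z a z', C z -> `|a - a0| < e -> `|z' - z| < e ->
    0 < dotv a z' - k * dotv z' z'.
Proof.
move=> cC pos; pose W := ('rV[R]_N * 'rV[R]_N)%type.
pose phi (w : W) := dotv w.1 w.2 - k * dotv w.2 w.2.
have c1 : continuous (fun w : W => w.1) by move=> w; exact: cvg_fst.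
have c2 : continuous (fun w : W => w.2) by move=> w; exact: cvg_snd.
have cphi : continuous phi.
  move=> w; apply: (@continuousB R R W (fun w => dotv w.1 w.2)).
    by apply: dotv_continuous_comp; [exact: c1|exact: c2].
  apply: (@continuousM R W (fun=> k)); first exact: cst_continuous.
  by apply: dotv_continuous_comp; exact: c2.
have [|x _|x [z Cz <-]|e e0 eP] := @robust_pos R W ((fun z => (a0, z)) @` C) phi.
- apply: continuous_compact => //; apply: continuous_subspaceT => z.
  by apply: continuous_pairT; [exact: cst_continuous|exact: cvg_id].
- exact: cphi.
- exact: pos.
exists e => // z a z' Cz aa zz; apply: (eP (a0, z) (a, z')); first by exists z.
by rewrite prod_normE /= gt_max aa zz.
Qed.

End Jacobian.

Lemma norm_add_lt (R : numDomainType) (V : normedZmodType R) (x y : V) (a b : R) :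
  `|x| < a -> `|y| < b -> `|x + y| < a + b.
Proof. by move=> xa yb; rewrite (le_lt_trans (ler_normD _ _)) // ltrD. Qed.

Lemma four_sixths_lt (R : realFieldType) (e : R) :
  0 < e -> e / 6 + e / 6 + e / 6 + e / 6 < e.
Proof. by move=> e0; lra. Qed.

(** * Persistence of a quadratic support under perturbation *)

Section LocalRobust.
Context {R : realType} {n N : nat} {M : manifold R n}.
Hypothesis cM : compact [set: M].
Variables (f : M -> 'rV[R]_N) (p0 : M) (a0 : 'rV[R]_N) (k : R) (c : chart R n M).
Hypotheses (sf : smooth_charts f) (imf : chart_immersive f) (f_inj : injective f).
Hypotheses (k0 : 0 < k) (ac : atlas c) (cp0 : chart_dom c p0).
Hypothesis supp : forall q, k * dotv (f p0 - f q) (f p0 - f q) <= dotv a0 (f p0 - f q).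

Let F := f \o chart_param c.
Let y0 := chart_coord c p0.
Let y0c : chart_codom c y0. Proof. by have [] := chart_coordP cp0. Qed.
Let Fy0 : F y0 = f p0. Proof. by rewrite /F /= (chart_coordP cp0).2. Qed.
Let oc : open (chart_codom c). Proof. exact: open_chart_codom. Qed.
Let CF m : Ck_on m (chart_codom c) F. Proof. exact: sf. Qed.
Let dF y : chart_codom c y -> differentiable F y.
Proof. by move=> yc; have [+ _] := CF 1; exact. Qed.

Let supp_min v : - dotv a0 ('D_v F y0) = 0 /\
  2 * k * dotv ('D_v F y0) ('D_v F y0) <= - dotv a0 ('D_v ('D_v F) y0).
Proof.
have Cs := Ck_sup_fun a0 k (f p0) oc (CF 2).
have [|D1 D2] := second_derivative_min v oc y0c Cs.
  move=> z zc; rewrite /sup_fun Fy0 subrr !dotv0r mulr0 subr0 subr_ge0; exact: supp.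
split; first by move: D1; rewrite (sup_fun_D1 a0 k (f p0) v (dF y0c)) Fy0 subrr dotv0l mulr0 addr0.
move: D2; rewrite (sup_fun_D2 a0 k (f p0) v oc y0c (CF 2)) Fy0 subrr dotv0l sub0r mulrN subr_ge0.
by [].
Qed.

Let immersed v : v != 0 -> 'D_v F y0 != 0.
Proof. by apply: contraNneq => Dv; apply/eqP; exact: (imf ac y0c Dv). Qed.

Let B0 v := 'D_v F y0.
Let A0 v := 'D_v ('D_v F) y0.

Let cB0 : continuous B0.
Proof.
move=> v; rewrite (_ : B0 = fun v => v *m jac F y0).
  apply: continuous_row => j; rewrite (_ : (fun w => _) =
      fun w : 'rV[R]_n => \sum_i w 0 i * jac F y0 i j); last first.
    by apply/funext => w; rewrite mxE.
  apply: continuous_bigsum => i; apply: continuousM; first exact: coord_continuous.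
  exact: cst_continuous.
by apply/funext => w; rewrite mul_jac //; exact: dF.
Qed.

Let cA0 : continuous A0.
Proof.
move=> v; rewrite (_ : A0 = fun v => \sum_i \sum_j
    (v 0 i * v 0 j) *: 'D_(delta_mx 0 i) ('D_(delta_mx 0 j) F) y0); last first.
  by apply/funext => w; exact: (derive2_basis _ _ oc y0c (CF 2)).
apply: continuous_row => l.
rewrite (_ : (fun w => _) = fun w : 'rV[R]_n => \sum_i \sum_j
    (w 0 i * w 0 j) * ('D_(delta_mx 0 i) ('D_(delta_mx 0 j) F) y0) 0 l); last first.
  apply/funext => w; rewrite summxE; apply: eq_bigr => i _; rewrite summxE.
  by apply: eq_bigr => j _; rewrite mxE.
apply: continuous_bigsum => i; apply: continuous_bigsum => j.
apply: continuousM; last exact: cst_continuous.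
by apply: continuousM; exact: coord_continuous.
Qed.

Let jac0 : \det (gram (jac F y0)) != 0 /\ a0 *m (jac F y0)^T = 0.
Proof.
have dy := dF y0c; split.
  apply: gram_det_neq0 => v; rewrite mul_jac // => Dv; exact: (imf ac y0c Dv).
apply/rowP => i; rewrite [RHS]mxE; have [+ _] := supp_min (delta_mx 0 i).
move/eqP; rewrite oppr_eq0 => /eqP E; rewrite -[RHS]E dotv_mul -mul_jac // trmx_mul mulmxA.
by rewrite trmx_delta -colE [RHS]mxE.
Qed.

(** Projecting [a0] makes the slack at [g p] critical for the tangent space of [g], so that a
    positive second derivative suffices on the ball of radius [r]. Base points stay in the ball of
    radius [r'], where the projection of [a0] is still close to [a0]. *)
Lemma local_robust : exists r r' e : R, [/\ 0 < r, 0 < r', 0 < e,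
  forall y, `|y - y0| <= r -> chart_codom c y &
  forall g : M -> euclidean R N, smooth_charts g -> (forall q, `|f q - g q| < e) ->
  C2_close c (chart_param c @` [set y | `|y - y0| <= r]) e f g ->
  forall p, chart_dom c p -> `|chart_coord c p - y0| < r' ->
    let J := jac (g \o chart_param c) (chart_coord c p) in
    \det (gram J) != 0 /\ forall q, k / 2 * dotv (g p - g q) (g p - g q) <=
      dotv (normal_part a0 J) (g p - g q)].
Proof.
have [e1 e10 near1] : exists2 e : R, 0 < e & forall v, `|v| = 1 -> forall a z B A, `|a - a0| < e ->
    `|z| < e -> `|B - B0 v| < e -> `|A - A0 v| < e ->
    0 < - dotv a A + k * (dotv z A - dotv B B).
  apply: quad_robust; [exact: cB0|exact: cA0|].
  (* The minimum gives the constant 2k in front of |B0 v|^2; asking for k only leaves the margin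
     spent on the perturbation. *)
  move=> v v1; have [_ Q] := supp_min v.
  have v0 : v != 0 by rewrite -normr_eq0 v1 oner_eq0.
  have : 0 < k * dotv (B0 v) (B0 v) by rewrite mulr_gt0 // dotv_gt0 immersed.
  move: Q; rewrite -/(B0 v) -/(A0 v) -mulrA.
  by move: (k * _) (- dotv _ _) => X Y XY X0; lra.
have e12 : 0 < e1 / 2 by rewrite divr_gt0.
have e13 : 0 < e1 / 3 by rewrite divr_gt0.
pose D1 j := 'D_(delta_mx 0 j) F.
pose D2 i j := 'D_(delta_mx 0 i) ('D_(delta_mx 0 j) F).
pose S1 y := \sum_j `|D1 j y - D1 j y0|.
pose S2 y := \sum_i \sum_j `|D2 i j y - D2 i j y0|.
have cdist (G : 'rV[R]_n -> 'rV[R]_N) : {for y0, continuous G} ->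
    {for y0, continuous (fun y => `|G y - G y0| : R)}.
  move=> cG; apply: (@continuous_norm_comp _ _ _ (fun y => G y - G y0)).
  by apply: continuousB; [exact: cG|exact: cst_continuous].
have cS1 : {for y0, continuous S1}.
  apply: continuous_bigsum => j; apply: cdist.
  by have [_ DF] := CF 1; exact: (DF (delta_mx 0 j)).
have cS2 : {for y0, continuous S2}.
  apply: continuous_bigsum => i; apply: continuous_bigsum => j; apply: cdist.
  by have [_ DF] := CF 2; have [_ DDF] := DF (delta_mx 0 j); exact: (DDF (delta_mx 0 i)).
have S10 : S1 y0 = 0 by apply: big1 => j _; rewrite subrr normr0.
have S20 : S2 y0 = 0 by apply: big1 => i _; apply: big1 => j _; rewrite subrr normr0.
have cF0 : {for y0, continuous F} by exact: (CF 0).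
have [r r0 rP] : exists2 r : R, 0 < r & forall y, `|y - y0| <= r ->
    [/\ chart_codom c y, `|F y - F y0| < e1 / 6, S1 y < e1 / 2 & S2 y < e1 / 2].
  have /nbhs_ballP[d1 d10 P1] : nbhs y0 (chart_codom c) by exact: open_nbhs_nbhs.
  have e16 : 0 < e1 / 6 by rewrite divr_gt0.
  have [d2 d20 P2] := near_closeP cF0 e16.
  have [d3 d30 P3] := near_closeP cS1 e12.
  have [d4 d40 P4] := near_closeP cS2 e12.
  pose d := Order.min (Order.min d1 d2) (Order.min d3 d4).
  have d0 : 0 < d by rewrite !lt_min d10 d20 d30.
  exists (d / 2); first by rewrite divr_gt0.
  move=> y yd; have : `|y - y0| < d.
    by apply: le_lt_trans yd _; rewrite ltr_pdivrMr // ltr_pMr //; lra.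
  rewrite !lt_min => /andP[/andP[H1 H2] /andP[H3 H4]]; split.
  - by apply: P1; rewrite -ball_normE /= distrC.
  - exact: P2.
  - by have := P3 y H3; rewrite S10 subr0; apply: le_lt_trans; exact: ler_norm.
  - by have := P4 y H4; rewrite S20 subr0; apply: le_lt_trans; exact: ler_norm.
have F1near y v : `|y - y0| <= r -> `|v| <= 1 -> `|'D_v F y - B0 v| < e1 / 2.
  move=> yr v1; have [yc _ S1y _] := rP y yr; apply: le_lt_trans S1y.
  rewrite /B0 (derive_basis v (dF yc)) (derive_basis v (dF y0c)) -sumrB.
  under eq_bigr do rewrite -scalerBr.
  exact: norm_sum_coord_le.
have F2near y v : `|y - y0| <= r -> `|v| <= 1 -> `|'D_v ('D_v F) y - A0 v| < e1 / 2.
  move=> yr v1; have [yc _ _ S2y] := rP y yr; apply: le_lt_trans S2y.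
  rewrite /A0 (derive2_basis v v oc yc (CF 2)) (derive2_basis v v oc y0c (CF 2)) -sumrB.
  apply: le_trans (ler_norm_sum _ _ _) _; apply: ler_sum => i _; rewrite -sumrB.
  apply: le_trans (ler_norm_sum _ _ _) _; apply: ler_sum => j _.
  rewrite -scalerBr normrZ ler_piMl // normrM mulr_ile1 //.
    exact: le_trans (le_coord_norm v i) v1.
  exact: le_trans (le_coord_norm v j) v1.
(* The points outside the chart or outside the ball; on this compact set the chords [f p0 - f q]
   stay away from 0. *)
pose Far := ~` (chart_dom c `&` chart_coord c @^-1` [set y | `|y - y0| < r]).
have cFar : compact Far.
  apply: (subclosed_compact _ cM) => //; rewrite closedC.
  apply: open_preimage_on; [exact: open_chart_dom|exact: chart_coord_continuous|].
  exact: open_norm_ball.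
have cf : continuous f by exact: smooth_charts_continuous.
have [e3 e30 far] : exists2 e : R, 0 < e & forall z a z', ((fun q => f p0 - f q) @` Far) z ->
    `|a - a0| < e -> `|z' - z| < e -> 0 < dotv a z' - k / 2 * dotv z' z'.
  apply: far_robust.
    apply: continuous_compact => //; apply: continuous_subspaceT => q.
    by apply: continuousB; [exact: cst_continuous|exact: cf].
  move=> z [q Fq <-]; have z0 : f p0 - f q != 0.
    rewrite subr_eq0; apply/eqP => /f_inj p0q; apply: Fq; rewrite -p0q; split=> //=.
    by rewrite subrr normr0.
  have : 0 < k * dotv (f p0 - f q) (f p0 - f q) by rewrite mulr_gt0 // dotv_gt0.
  by have := supp q; lra.
have [d0 aJ0] := jac0.
(* [a0] is already normal at [y0] by the first order condition, so its projection moves little with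
   the Jacobian. *)
have [e2 e20 nearJ] : exists2 d : R, 0 < d & forall J', `|J' - jac F y0| < d ->
    \det (gram J') != 0 /\ `|normal_part a0 J' - a0| < Order.min e1 e3.
  by apply: normal_part_near => //; rewrite lt_min e10.
have e22 : 0 < e2 / 2 by rewrite divr_gt0.
have e33 : 0 < e3 / 3 by rewrite divr_gt0.
have [r' r'0 r'P] : exists2 r' : R, 0 < r' & forall y, `|y - y0| < r' ->
    [/\ `|y - y0| < r, `|F y - F y0| < e3 / 3 & S1 y < e2 / 2].
  have [d2 d20 P2] := near_closeP cF0 e33.
  have [d3 d30 P3] := near_closeP cS1 e22.
  exists (Order.min r (Order.min d2 d3)); first by rewrite !lt_min r0 d20.
  move=> y; rewrite !lt_min => /andP[H1 /andP[H2 H3]]; split=> //; first exact: P2.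
  by have := P3 y H3; rewrite S10 subr0; apply: le_lt_trans; exact: ler_norm.
pose e := Order.min (Order.min (e1 / 6) (e1 / 2)) (Order.min (e2 / 2) (e3 / 3)).
have e0 : 0 < e by rewrite !lt_min !divr_gt0.
exists r, r', e; split; [exact: r0|exact: r'0|exact: e0|by move=> y /rP[]|].
move=> g sg fg C2 p cp pr'; set y := chart_coord c p in pr' *.
have [yr Fy S1y] := r'P y pr'.
have [yc py] := chart_coordP cp; rewrite -/y in yc py.
pose G := g \o chart_param c.
have Gy : G y = g p by rewrite /G /= py.
have CG m : Ck_on m (chart_codom c) G by exact: sg.
have dG z : chart_codom c z -> differentiable G z by move=> zc; have [+ _] := CG 1; exact.
have jets z : `|z - y0| <= r -> [/\ `|F z - G z| < e,
    forall u, `|u| <= 1 -> `|'D_u F z - 'D_u G z| < e &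
    forall u, `|u| <= 1 -> `|'D_u ('D_u F) z - 'D_u ('D_u G) z| < e].
  move=> zr; have [zc _ _ _] := rP z zr; have [_ zE] := chart_paramP zc.
  have [|] := C2 (chart_param c z); first by exists z.
  rewrite zE => H0 H1 H2; have DE w u : chart_codom c w -> 'D_u (F - G) w = 'D_u F w - 'D_u G w.
    by move=> wc; rewrite deriveB //; apply: diff_derivable; [exact: dF|exact: dG].
  split=> // u u1; first by have := H1 u u1; rewrite -DE.
  have := H2 u u u1 u1; congr (_ < _); congr (`|_|).
  rewrite (near_derive_eq u oc zc (g := 'D_u F - 'D_u G)); last by move=> w wc; exact: DE.
  rewrite deriveB //; apply: diff_derivable.
    by have [_ DF] := CF 2; have [dDF _] := DF u; exact: dDF.
  by have [_ DF] := CG 2; have [dDF _] := DF u; exact: dDF.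
have [dJ aJ] : \det (gram (jac G y)) != 0 /\ `|normal_part a0 (jac G y) - a0| < Order.min e1 e3.
  apply: nearJ; apply: jac_dist => // i.
  rewrite -(subrK ('D_(delta_mx 0 i) F y) ('D_(delta_mx 0 i) G y)) -addrA.
  apply: le_lt_trans (ler_normD _ _) _; rewrite (splitr e2) ltrD //.
    have ee : e <= e2 / 2 by rewrite !ge_min lexx !orbT.
    have [_ H _] := jets y (ltW yr); rewrite distrC.
    exact: lt_le_trans (H _ (norm_delta_le1 R i)) ee.
  apply: le_lt_trans S1y; rewrite /S1 (bigD1 i) //= lerDl.
  by apply: sumr_ge0 => j _; exact: normr_ge0.
split=> // q; set a := normal_part a0 (jac G y) in aJ *.
move: aJ; rewrite lt_min => /andP[aJ1 aJ3].
have [qnear|qfar] := pselect (chart_dom c q /\ `|chart_coord c q - y0| < r); last first.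
  rewrite -subr_ge0; apply: ltW.
  apply: (far (f p0 - f q)) => //; first by exists q.
  rewrite (_ : _ - _ = (g p - f p) + (f p - f p0) + (f q - g q)); last first.
    by apply/rowP => l; rewrite !mxE; ring.
  have ee3 : e <= e3 / 3 by rewrite !ge_min lexx !orbT.
  have h1 : `|g p - f p| < e3 / 3 by rewrite distrC (lt_le_trans (fg p)).
  have h2 : `|f p - f p0| < e3 / 3 by move: Fy; rewrite Fy0 /F /= py.
  have h3 : `|f q - g q| < e3 / 3 by rewrite (lt_le_trans (fg q)).
  rewrite (_ : e3 = e3 / 3 + e3 / 3 + e3 / 3); last by field.
  exact: norm_add_lt (norm_add_lt h1 h2) h3.
have [cq qr] := qnear; have [zc qz] := chart_coordP cq.
set z := chart_coord c q in qr zc qz.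
have Gz : G z = g q by rewrite /G /= qz.
have [yz|yz] := eqVneq z y.
  by rewrite -Gz yz Gy subrr !dotv0r mulr0.
pose s := `|z - y|; have s0 : 0 < s by rewrite normr_gt0 subr_eq0.
(* The segment from [y] to [z] is traversed with a unit direction, the only ones for which the
   tolerance [e1] is known. *)
pose u := s^-1 *: (z - y).
have su : z = y + s *: u by rewrite scalerA divff ?gt_eqF // scale1r addrC subrK.
have u1 : `|u| = 1 by rewrite normrZ normfV normr_id mulVf // gt_eqF.
have seg t : 0 <= t <= s -> `|y + t *: u - y0| <= r.
  move=> /andP[t0 ts]; have [l lE] : exists l, l = t / s by exists (t / s).
  have l0 : 0 <= l by rewrite lE divr_ge0 // ltW.
  have l1 : l <= 1 by rewrite lE ler_pdivrMr // mul1r.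
  have -> : y + t *: u - y0 = (1 - l) *: (y - y0) + l *: (z - y0).
    by apply/rowP => i; rewrite !mxE lE; ring.
  apply: le_trans (ler_normD _ _) _; rewrite !normrZ !ger0_norm ?subr_ge0 //.
  have l1' : 0 <= 1 - l by rewrite subr_ge0.
  rewrite (_ : r = (1 - l) * r + l * r); last by ring.
  apply: lerD; first by rewrite ler_wpM2l // ltW.
  by rewrite ler_wpM2l // ltW.
have Cs := Ck_sup_fun a (k / 2) (g p) oc (CG 2).
have segc t : 0 <= t <= s -> chart_codom c (y + t *: u) by move=> /seg /rP[].
have : sup_fun a (k / 2) (g p) G y < sup_fun a (k / 2) (g p) G (y + s *: u).
  apply: segment_increase; first exact: s0.
  - by move=> t /segc tc; have [] := Ck2_derivable u Cs tc.
  - by move=> t /segc tc; have [_] := Ck2_derivable u Cs tc.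
  - rewrite (sup_fun_D1 _ _ _ u (dG y yc)) Gy subrr dotv0l mulr0 addr0.
    by rewrite normal_part_derive ?oppr0 //; exact: dG.
  move=> t ts; have wc := segc t ts; have wr := seg t ts.
  set w := y + t *: u in wc wr *.
  rewrite (sup_fun_D2 _ _ _ u oc wc (CG 2)) (_ : 2 * (k / 2) = k); last by field.
  have [FGw FG1 FG2] := jets w wr; have [FGy _ _] := jets y (ltW yr).
  have u1' : `|u| <= 1 by rewrite u1.
  have ee1 : e <= e1 / 6 by rewrite !ge_min lexx.
  have ee2 : e <= e1 / 2 by rewrite !ge_min lexx orbT.
  have [_ Fw _ _] := rP w wr; have [_ Fy' _ _] := rP y (ltW yr).
  apply: (near1 u u1) => //.
  (* The chord of [g] is compared with 0 through [F y0]: four errors, each below e1 / 6. *)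
  - rewrite -Gy (_ : G y - G w = - (F y - G y) + (F y - F y0) - (F w - F y0) + (F w - G w)); last first.
      by apply/rowP => i; rewrite !mxE; ring.
    apply: (@lt_trans _ _ (e1 / 6 + e1 / 6 + e1 / 6 + e1 / 6)); last exact: four_sixths_lt.
    apply: norm_add_lt; last exact: lt_le_trans FGw ee1.
    apply: norm_add_lt; last by rewrite normrN.
    by apply: norm_add_lt => //; rewrite normrN; exact: lt_le_trans FGy ee1.
  - rewrite (_ : _ - _ = - ('D_u F w - 'D_u G w) + ('D_u F w - B0 u)); last first.
      by rewrite opprB addrA subrK.
    rewrite (splitr e1); apply: norm_add_lt; last exact: F1near.
    by rewrite normrN; apply: lt_le_trans (FG1 u u1') ee2.
  - rewrite (_ : _ - _ = - ('D_u ('D_u F) w - 'D_u ('D_u G) w) + ('D_u ('D_u F) w - A0 u)); last first.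
      by rewrite opprB addrA subrK.
    rewrite (splitr e1); apply: norm_add_lt; last exact: F2near.
    by rewrite normrN; apply: lt_le_trans (FG2 u u1') ee2.
rewrite -su /sup_fun Gy Gz subrr !dotv0r mulr0 subr0 subr_gt0.
exact: ltW.
Qed.

End LocalRobust.

(** * From neighborly embeddings to spheres and back *)

(** The factor n comes from the maximum norm. *)
Lemma dotv_norm_le (R : realType) n (x y : 'rV[R]_n) : `|dotv x y| <= n%:R * `|x| * `|y|.
Proof.
apply: le_trans (ler_norm_sum _ _ _) _.
apply: (@le_trans _ _ (\sum_(i < n) `|x| * `|y|)).
  by apply: ler_sum => i _; rewrite normrM ler_pM ?le_coord_norm.
by rewrite sumr_const card_ord -[leLHS]mulr_natl mulrA.
Qed.

Lemma compact_bound (R : realType) (T : topologicalType) (K : set T) (phi : T -> R) :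
  compact K -> (forall x, K x -> {for x, continuous phi}) ->
  exists2 C : R, 0 < C & forall x, K x -> `|phi x| <= C.
Proof.
move=> cK cphi.
have := iffLR (compact_near_coveringP K) cK _ (+oo%R) (fun C x => `|phi x| <= C) _.
case=> [x Kx|C [_ HC]]; last first.
  exists (Num.max C 0 + 1); first by rewrite ltr_wpDl // le_max lexx orbT.
  by move=> x Kx; apply: HC => //; rewrite ltr_pwDr // le_max lexx.
exists ([set x' | `|phi x'| < `|phi x| + 1], [set C | `|phi x| + 1 < C]) => /=.
  split; last by exists (`|phi x| + 1); split; [exact: num_real|].
  have c : {for x, continuous (fun x' => `|phi x'|)}.
    by apply: continuous_norm_comp; exact: cphi.
  apply: (c [set r | r < `|phi x| + 1]); apply: open_nbhs_nbhs; split; first exact: open_lt.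
  by rewrite /= ltrDl.
by move=> [x' C] /= [H1 H2]; rewrite ltW // (lt_trans H1).
Qed.

Section C2Bound.
Context {R : realType} {n N : nat} {M : manifold R n}.
Variables (S : M -> 'rV[R]_N) (c : chart R n M) (K : set M).
Hypotheses (sS : smooth_charts S) (ac : atlas c) (cK : compact K) (Kc : K `<=` chart_dom c).

(** Derivatives in directions of norm at most 1 are bounded by sums over the basis vectors, which
    are continuous in the point. With this bound a small multiple of a smooth map is small in the
    C^2-topology. *)
Lemma C2_bound : exists2 C : R, 0 < C & forall p, K p -> let y := chart_coord c p in
  let s := S \o chart_param c in
  [/\ `|s y| <= C, forall u, `|u| <= 1 -> `|'D_u s y| <= C &
      forall u v, `|u| <= 1 -> `|v| <= 1 -> `|'D_u ('D_v s) y| <= C].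
Proof.
pose s := S \o chart_param c; have Cs k : Ck_on k (chart_codom c) s := sS ac k.
pose phi0 y := `|s y|.
pose phi1 y := \sum_j `|'D_(delta_mx 0 j) s y|.
pose phi2 y := \sum_i \sum_j `|'D_(delta_mx 0 i) ('D_(delta_mx 0 j) s) y|.
have oc := @open_chart_codom _ _ _ c.
have [p Kp|C C0 CP] := @compact_bound R M K (fun p => phi0 (chart_coord c p) +
    phi1 (chart_coord c p) + phi2 (chart_coord c p)) cK.
  have [yc _] := chart_coordP (Kc Kp).
  apply: (@continuous_comp _ _ _ (chart_coord c) (fun y => phi0 y + phi1 y + phi2 y)).
    exact: chart_coord_continuous (Kc Kp).
  have c0 : {for chart_coord c p, continuous phi0} by apply: continuous_norm_comp; exact: (Cs 0).
  have c1 : {for chart_coord c p, continuous phi1}.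
    apply: continuous_bigsum => j; apply: continuous_norm_comp.
    by have [_ Ds] := Cs 1; exact: (Ds (delta_mx 0 j)).
  have c2 : {for chart_coord c p, continuous phi2}.
    apply: continuous_bigsum => i; apply: continuous_bigsum => j; apply: continuous_norm_comp.
    by have [_ Ds] := Cs 2; have [_ DDs] := Ds (delta_mx 0 j); exact: (DDs (delta_mx 0 i)).
  by apply: continuousD => //; exact: continuousD.
exists C => // p Kp y; rewrite -/s; have [yc _] := chart_coordP (Kc Kp).
have p0 : 0 <= phi0 y by exact: normr_ge0.
have p1 : 0 <= phi1 y by apply: sumr_ge0 => j _; exact: normr_ge0.
have p2 : 0 <= phi2 y by do 2 apply: sumr_ge0 => ? _; exact: normr_ge0.
have := CP p Kp; rewrite -/y ger0_norm ?addr_ge0 // => H.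
split=> [|u u1|u v u1 v1].
- by apply: le_trans H; rewrite -addrA lerDl addr_ge0.
- apply: (@le_trans _ _ (phi1 y)); last by apply: le_trans H; rewrite addrAC lerDr addr_ge0.
  have ds : differentiable s y by have [+ _] := Cs 1; exact.
  by rewrite (derive_basis u ds); exact: norm_sum_coord_le.
- apply: (@le_trans _ _ (phi2 y)); last by apply: le_trans H; rewrite lerDr addr_ge0.
  rewrite (derive2_basis u v oc yc (Cs 2)).
  apply: le_trans (ler_norm_sum _ _ _) _; apply: ler_sum => i _.
  apply: le_trans (ler_norm_sum _ _ _) _; apply: ler_sum => j _.
  rewrite normrZ ler_piMl // normrM mulr_ile1 //.
    exact: le_trans (le_coord_norm u i) u1.
  exact: le_trans (le_coord_norm v j) v1.
Qed.
End C2Bound.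

Section Family.
Context {R : realType} {n N : nat} {M : manifold R n}.

Lemma C2_close_scaled (S : M -> 'rV[R]_N) (f : M -> euclidean R N) r
    (c : 'I_r -> chart R n M) (K : 'I_r -> set M) (e : R) : smooth_charts S -> 0 < e ->
  (forall i, [/\ atlas (c i), compact (K i) & K i `<=` chart_dom (c i)]) ->
  exists2 d : R, 0 < d & forall t, 0 < t -> t < d -> forall i,
    C2_close (c i) (K i) e f (fun q => f q + t *: S q : euclidean R N).
Proof.
move=> sS e0 cK.
have /choice[C CP] i : exists C : R, 0 < C /\ forall p, K i p -> let y := chart_coord (c i) p in
    let s := S \o chart_param (c i) in
    [/\ `|s y| <= C, forall u, `|u| <= 1 -> `|'D_u s y| <= C &
      forall u v, `|u| <= 1 -> `|v| <= 1 -> `|'D_u ('D_v s) y| <= C].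
  by have [ac ck kc] := cK i; have [C C0 CP] := C2_bound sS ac ck kc; exists C.
exists (\big[Order.min/1]_i (e / C i)).
  elim/big_ind : _ => // [x y x0 y0|i _]; first by rewrite lt_min x0.
  by rewrite divr_gt0 //; have [] := CP i.
move=> t t0 td i h p Kp y; have [C0 /(_ p Kp)] := CP i; rewrite -/y => -[H0 H1 H2].
have tC : t * C i < e.
  rewrite -ltr_pdivlMr //; apply: lt_le_trans td _.
  by rewrite (bigD1 i) //= ge_min lexx.
have bound (v : 'rV[R]_N) : `|v| <= C i -> `|(- t) *: v| < e.
  move=> vC; rewrite normrZ normrN gtr0_norm //; apply: le_lt_trans tC.
  by rewrite ler_wpM2l // ltW.
have [ac _ kc] := cK i; have [yc _] := chart_coordP (kc p Kp).
have oc := @open_chart_codom _ _ _ (c i); have Cs k := sS _ ac k.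
pose s := S \o chart_param (c i).
have hE : h = (- t) \*: s.
  by apply/funext => z; rewrite /h /s /= opprD addrA subrr sub0r -scaleNr.
rewrite hE; split=> [|u u1|u v u1 v1]; first exact: bound.
  rewrite deriveZ; first exact: bound (H1 u u1).
  by apply: diff_derivable; exact: smooth_charts_differentiable.
rewrite (near_derive_eq u oc yc (g := (- t) \*: 'D_v s)); last first.
  move=> z zc; rewrite deriveZ //; apply: diff_derivable.
  exact: smooth_charts_differentiable.
rewrite deriveZ; first exact: bound (H2 u v u1 v1).
by apply: diff_derivable; have [_ Ds] := Cs 2; have [dDs _] := Ds v; exact: dDs.
Qed.

End Family.

Section Support.
Context {R : realType} {n N : nat} {M : manifold R n}.

Lemma neighborly1_support (g : M -> euclidean R N) : neighborly1 g ->
  forall p, exists2 a : 'rV[R]_N, a != 0 & forall q, q != p -> dotv a (g q) < dotv a (g p).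
Proof.
move=> [[_ g_inj _] ng] p; have [a [b [a0 ab /seteqP[ran_sub sub_ran]]]] := ng p.
have [_ pb] : (range g `&` hyperplane a b) (g p) by exact: sub_ran.
have neb q : q != p -> dotv a (g q) != b.
  move=> qp; apply: contra_neq qp => qb; apply: g_inj; apply: ran_sub.
  by split=> //; exists q.
case: ab => [ub|lb].
  by exists a => // q qp; rewrite lt_neqAle pb neb // ub.
exists (- a); first by rewrite oppr_eq0.
by move=> q qp; rewrite !dotvNl ltrN2 lt_neqAle pb eq_sym neb // lb.
Qed.

Lemma support_neighborly1 (g : M -> euclidean R N) : smooth_embedding g ->
  (forall p, exists2 a : 'rV[R]_N, a != 0 & forall q, q != p -> dotv a (g q) < dotv a (g p)) ->
  neighborly1 g.
Proof.
move=> eg ng; split=> // p; have [a a0 ap] := ng p; exists a, (dotv a (g p)); split=> //.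
  by left=> q; have [->|qp] := eqVneq q p; [|rewrite ltW // ap].
apply/seteqP; split=> [_ [[q _ <-] /=]|_ ->]; last by split=> //; exists p.
have [->//|qp E] := eqVneq q p.
by have := ap q qp; rewrite E ltxx.
Qed.

Variable f : M -> euclidean R N.
Hypotheses (cM : compact [set: M]) (stf : stably_neighborly1 f).

Lemma quadratic_support (p0 : M) : exists (a : 'rV[R]_N) (k : R), 0 < k /\ forall q,
  k * dotv (f p0 - f q) (f p0 - f q) <= dotv a (f p0 - f q).
Proof.
have [[/(smooth_embedding_euclideanP _ cM)[sf imf f_inj] _] [r [c [K [e [e0 cK W]]]]]] := stf.
have [[q0 q0p]|triv] := pselect (exists q, q != p0); last first.
  (* With a single point all chords are 0 and any pair works. *)
  exists 0, 1; split=> // q; have [->|qp] := eqVneq q p0; last by case: triv; exists q.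
  by rewrite subrr !dotv0r mulr0.
pose w : 'rV[R]_N := f p0 - f q0.
have w0 : w != 0 by rewrite subr_eq0; apply: contra_neq q0p => /f_inj.
pose D q : 'rV[R]_N := f q - f p0.
pose S q : 'rV[R]_N := dotv (D q) (D q) *: w.
have CD d k : atlas d -> Ck_on k (chart_codom d) (D \o chart_param d).
  move=> ad; apply: Ck_on_addv; [exact: open_chart_codom|exact: sf|exact: smooth_cst].
have sS : smooth_charts S.
  move=> d ad k; have od := @open_chart_codom _ _ _ d.
  apply: (@Ck_on_scale _ _ _ _ _ (fun y => dotv ((D \o chart_param d) y) ((D \o chart_param d) y)) (fun=> w)) => //.
    by apply: Ck_on_dotv => //; exact: CD.
  exact: smooth_cst.
have [q _|C C0 CP] := @compact_bound R M _ (fun q => `|D q|) cM.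
  have cD : {for q, continuous D}.
    by apply: continuousB; [exact: smooth_charts_continuous sf q|exact: cst_continuous].
  exact: continuous_norm_comp.
have {}CP q : `|D q| <= C by have := CP q I; rewrite normr_id.
have [d d0 dP] := C2_close_scaled f sS e0 cK.
(* The bound t L < 1 serves two purposes: its first term makes the perturbation a contraction, its
   second gives t |w|^2 < 1. The 1 ensures L > 0. *)
pose L := N%:R * (C + C) * `|w| + dotv w w + 1.
have L0 : 0 < L by rewrite ltr_wpDl // addr_ge0 ?dotv_ge0 // !mulr_ge0 // ltW // addr_gt0.
pose t := Order.min (d / 2) (L^-1 / 2).
have t0 : 0 < t by rewrite lt_min !divr_gt0 ?invr_gt0.
have td : t < d by rewrite gt_min ltr_pdivrMr // ltr_pMr // ltr1n.
have tL : t * L < 1.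
  rewrite -ltr_pdivlMr // div1r gt_min; apply/orP; right.
  by rewrite ltr_pdivrMr // ltr_pMr ?invr_gt0 // ltr1n.
have tw : t * dotv w w < 1.
  apply: le_lt_trans tL; apply: ler_wpM2l; [exact: ltW|rewrite /L addrAC lerDr addr_ge0 //].
  by rewrite !mulr_ge0 // addr_ge0 // ltW.
have tN : t * (N%:R * (C + C) * `|w|) < 1.
  apply: le_lt_trans tL; apply: ler_wpM2l; first exact: ltW.
  by rewrite /L -addrA lerDl addr_ge0 ?dotv_ge0.
pose g q : euclidean R N := f q + t *: S q.
have dg : forall i, C2_close (c i) (K i) e f g by exact: dP.
(* [A |-> t (A.B) w] is a contraction, so that [f + t S] is still injective and immersive *)
have contr (A B : 'rV[R]_N) : `|B| <= C + C -> A + t *: (dotv A B *: w) = 0 -> A = 0.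
  move=> BC /eqP; rewrite addr_eq0 => /eqP AE; apply/eqP; rewrite -normr_le0 leNgt; apply/negP => A0.
  have : `|A| < `|A|; last by rewrite ltxx.
  rewrite [ltLHS](_ : _ = t * `|dotv A B| * `|w|); last first.
    by rewrite {1}AE normrN !normrZ gtr0_norm // mulrA.
  apply: (@le_lt_trans _ _ (t * (N%:R * (C + C) * `|w|) * `|A|)); last by rewrite gtr_pMl.
  rewrite (_ : t * (N%:R * (C + C) * `|w|) * `|A| = t * (N%:R * `|A| * (C + C)) * `|w|); last by ring.
  rewrite ler_wpM2r // ler_wpM2l ?(ltW t0) //; apply: le_trans (dotv_norm_le A B) _.
  by rewrite ler_wpM2l // mulr_ge0.
have sg : smooth_charts g.
  move=> d' ad' k; have od := @open_chart_codom _ _ _ d'.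
  apply: Ck_on_addv => //; first exact: sf.
  apply: (@Ck_on_scale _ _ _ _ _ (fun=> t) (S \o chart_param d') od); first exact: smooth_cst.
  exact: sS.
have eg : smooth_embedding g.
  apply/(smooth_embedding_euclideanP _ cM); split; first exact: sg.
  - move=> d' y v ad' yd gv; apply: (imf _ _ _ ad' yd).
    set F := f \o chart_param d'.
    have dF : differentiable F y by exact: smooth_charts_differentiable.
    have dD : differentiable (D \o chart_param d') y by have [+ _] := CD d' 1 ad'; exact.
    apply: (contr _ (D (chart_param d' y) + D (chart_param d' y))).
      by apply: le_trans (ler_normD _ _) _; exact: lerD.
    have dphi : differentiable (fun z => dotv ((D \o chart_param d') z) ((D \o chart_param d') z)) y.
      have := Ck_on_dotv (@open_chart_codom _ _ _ d') (CD d' 1 ad') (CD d' 1 ad').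
      by move=> [+ _]; exact.
    have DF : 'D_v (D \o chart_param d') y = 'D_v F y.
      have -> := @deriveB R _ _ F (fun=> f p0 : 'rV[R]_N) y v (diff_derivable dF) (derivable_cst _ y v).
      by rewrite derive_cst subr0.
    rewrite -gv; apply/rowP => i; rewrite [RHS]derive_entry; last by have := smooth_charts_differentiable sg ad' yd.
    rewrite (_ : (fun z => _) = (fun z => F z 0 i : R) +
        (t * w 0 i) \*: (fun z => dotv ((D \o chart_param d') z) ((D \o chart_param d') z))); last first.
      apply/funext => z; rewrite /g /S !mxE !fctE [X in _ = _ + X]mulrAC -mulrA; congr (_ + t * (_ * _)); by rewrite mxE.
    rewrite deriveD; [|exact: diff_derivable (differentiable_entry i dF)|].
      rewrite deriveZ; last exact: diff_derivable.
      rewrite (derive_dotv v dD dD) DF -(derive_entry v i dF) !mxE dotvDr /GRing.scale /=.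
      by rewrite (dotvC ('D_v F y)); ring.
    by apply: derivableZ; exact: diff_derivable.
  - move=> q q' gqq; apply: f_inj; apply/eqP; rewrite -subr_eq0; apply/eqP; apply: (contr _ (D q + D q')).
      by apply: le_trans (ler_normD _ _) _; exact: lerD.
    (* A difference of squares is linear in [f q - f q'], which is the form required by [contr]. *)
    have AB : dotv (D q) (D q) - dotv (D q') (D q') = dotv (f q - f q') (D q + D q').
      rewrite (_ : f q - f q' = D q - D q'); last by rewrite /D opprD opprK addrACA addNr addr0.
      by move: (D q) (D q') => X Y; rewrite dotvBl !dotvDr (dotvC Y X); ring.
    rewrite -AB scalerBl scalerBr addrACA -opprD; apply/eqP; rewrite subr_eq0; exact/eqP.
have ng : neighborly1 g.
  by apply: W => //; exact/smooth_map_euclideanP.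
have [a _ ap] := neighborly1_support ng p0.
have aE q : dotv a (g p0) - dotv a (g q) = dotv a (f p0 - f q) - t * dotv a w * dotv (f p0 - f q) (f p0 - f q).
  have -> : g p0 = f p0 by rewrite /g /S /D subrr dotv0l scale0r scaler0 addr0.
  have -> : dotv (f p0 - f q) (f p0 - f q) = dotv (D q) (D q).
    by rewrite -(opprB (f q)) dotvNl dotvNr opprK.
  by rewrite /g /S dotvDr !dotvZr [dotv a (f p0 - f q)]dotvBr; move: (dotv (D q) (D q)) (dotv a w) => X Y; ring.
(* Test the support at [q0], where the chord is [w]. *)
have aw : 0 < dotv a w.
  have : 0 < dotv a w * (1 - t * dotv w w).
    have := ap q0 q0p; rewrite -subr_gt0 aE -/w.
    by congr (_ < _); ring.
  by rewrite pmulr_lgt0 // subr_gt0.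
exists a, (t * dotv a w); split=> [|q]; first exact: mulr_gt0.
rewrite -subr_ge0 -aE subr_ge0; have [->//|qp] := eqVneq q p0.
by rewrite ltW // ap.
Qed.
End Support.

(** * From a field of supports to an embedding in the sphere *)

Section MonotoneField.
Context {R : realType} {n N : nat} {M : manifold R n}.
Hypothesis cM : compact [set: M].
Variables (f a : M -> 'rV[R]_N) (k : M -> R).
Hypotheses (sf : smooth_charts f) (imf : chart_immersive f) (f_inj : injective f).
Hypotheses (sa : smooth_charts a) (k_gt0 : forall p, 0 < k p).
Hypothesis supp : forall p q, k p * dotv (f p - f q) (f p - f q) <= dotv (a p) (f p - f q).

Let supp_gt0 p q : p != q -> 0 < dotv (a p) (f p - f q).
Proof.
move=> pq; apply: lt_le_trans (supp p q); apply: mulr_gt0 => //.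
by rewrite dotv_gt0 subr_eq0; apply: contra_neq pq => /f_inj.
Qed.

(** If [a p] and [a q] were on one ray, the chord from q to p would pair positively with [a p] and
    negatively with [a q]. A second point is needed to see that [a p] is not 0. *)
Lemma monotone_field_embedding : (exists p q : M, p != q) ->
  exists F : M -> sphere R N, smooth_embedding F.
Proof.
move=> [p1 [p2 p12]]; apply: (@ray_embedding R n M cM _ a sa).
- move=> p; have [q pq] : exists q, p != q.
    by have [->|] := eqVneq p p1; [exists p2|exists p1].
  by apply: contraTneq (supp_gt0 pq) => ->; rewrite dotv0l ltxx.
- move=> p q s s0 apq; apply/eqP; rewrite -[_ == _]negbK; apply/negP => pq.
  have := supp_gt0 pq; rewrite apq dotvZl pmulr_rgt0 // -opprB dotvNr oppr_gt0.
  have qp : q != p by rewrite eq_sym.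
  by move=> /lt_trans/(_ (supp_gt0 qp)); rewrite ltxx.
- move=> p; have [c ac cp] := atlas_cover p; exists c; split=> // w al dw.
  have [yc py] := chart_coordP cp; set y := chart_coord c p in dw yc py.
  have oc := @open_chart_codom _ _ _ c; set A := a \o chart_param c in dw.
  pose F := f \o chart_param c.
  have CF : Ck_on 2 (chart_codom c) F := sf ac 2.
  have CA : Ck_on 2 (chart_codom c) A := sa ac 2.
  have Fy : F y = f p by rewrite /F /= py.
  have Ay : A y = a p by rewrite /A /= py.
  have crit : dotv (a p) ('D_w F y) = 0.
    have [|D1 _] := second_derivative_min w oc yc (Ck_sup_fun (a p) 0 (f p) oc CF).
      move=> z zc; rewrite /sup_fun Fy subrr !dotv0r !mul0r !subr0.
      by apply: le_trans (supp p _); rewrite mulr_ge0 ?dotv_ge0 // ltW.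
    move: D1; rewrite (sup_fun_D1 _ _ _ w (CF.1 y yc)) mulr0 mul0r addr0.
    by move/eqP; rewrite oppr_eq0 => /eqP.
  (* [dotv (P z) (Q z)] is minimal at [y], where [P] and [Q] vanish *)
  pose Q z := F z - f p; pose P z := (A z - a p) + (- k p) *: Q z.
  have CQ : Ck_on 2 (chart_codom c) Q := Ck_on_addv oc CF (smooth_cst _ _ 2).
  have CAp : Ck_on 2 (chart_codom c) (fun z => A z - a p).
    by apply: (Ck_on_addv oc CA); exact: smooth_cst.
  have CkQ : Ck_on 2 (chart_codom c) (fun z => (- k p) *: Q z).
    by apply: (@Ck_on_scale _ _ _ _ _ (fun=> - k p) Q oc _ CQ); exact: smooth_cst.
  have CP : Ck_on 2 (chart_codom c) P := Ck_on_addv oc CAp CkQ.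
  have Qy : Q y = 0 by rewrite /Q Fy subrr.
  have Py : P y = 0 by rewrite /P Ay subrr Qy scaler0 addr0.
  have [|_] := second_derivative_min w oc yc (Ck_on_dotv oc CP CQ).
    move=> z zc; rewrite Py dotv0l /P dotvDl dotvZl mulNr subr_ge0.
    have := supp (chart_param c z) p; have := supp p (chart_param c z).
    rewrite -[f p - _]opprB !dotvNr dotvNl opprK -/(F z) -/(A z) -/(Q z) dotvBl => H1 H2.
    have H3 : 0 <= k (chart_param c z) * dotv (Q z) (Q z).
      by rewrite mulr_ge0 ?dotv_ge0 // ltW.
    (* Adding the supports at both points and dropping the nonnegative quadratic term of the moving
       point keeps only the constant [k p]. *)
    have H4 := le_trans H3 H2; have := lerD H1 H4; rewrite addr0 addrC.
    by [].
  rewrite (derive2_dotv_zero w oc yc CP CQ Py Qy) => D2.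
  have DQ : 'D_w Q y = 'D_w F y.
    have -> := @deriveB R _ _ F (fun=> f p : 'rV[R]_N) y w (diff_derivable (CF.1 y yc)) (derivable_cst _ y w).
    by rewrite derive_cst subr0.
  have DP : 'D_w P y = al *: a p - k p *: 'D_w F y.
    have dA : derivable (fun z => A z - a p) y w := diff_derivable (CAp.1 y yc).
    have dQ : derivable ((- k p) \*: Q) y w := diff_derivable (CkQ.1 y yc).
    have -> := deriveD dA dQ.
    have -> := deriveZ (- k p) (diff_derivable (CQ.1 y yc) : derivable Q y w); rewrite DQ scaleNr; congr (_ - _).
    have -> := @deriveB R _ _ A (fun=> a p : 'rV[R]_N) y w (diff_derivable (CA.1 y yc)) (derivable_cst _ y w).
    by rewrite derive_cst subr0.
  (* As [a p] is orthogonal to D f, the second order condition reads 0 <= - k p |D f|^2. *)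
  move: D2; rewrite DP DQ dotvBl !dotvZl crit mulr0 sub0r mulrN oppr_ge0 pmulr_rle0 // pmulr_rle0 //.
  rewrite le_eqVlt ltNge dotv_ge0 orbF dotv_eq0 => /eqP; exact: imf.
Qed.
End MonotoneField.

Section Gauss.
Context {R : realType} {n N : nat} {M : manifold R n}.
Hypothesis cM : compact [set: M].
Variable f : M -> euclidean R N.
Hypotheses (sf : smooth_charts f) (imf : chart_immersive f) (f_inj : injective f).
Hypothesis supp : forall p, exists (a : 'rV[R]_N) (k : R), 0 < k /\ forall q,
  k * dotv (f p - f q) (f p - f q) <= dotv a (f p - f q).

(** [local_robust] is applied to [f] itself as its own perturbation, so only the base point moves.
    Multiplying by a bump scales both sides of the inequality and extends it trivially to all
    points. *)
Lemma local_normal_field (p0 : M) : exists (a : M -> 'rV[R]_N) (b : M -> R) (A : set M),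
  [/\ smooth_charts a, open A, A p0, forall p, 0 <= b p /\ (A p -> 0 < b p) &
   forall p q, b p * dotv (f p - f q) (f p - f q) <= dotv (a p) (f p - f q)].
Proof.
have [a0 [k [k0 ak]]] := supp p0; have [c ac cp0] := atlas_cover p0.
have [r [r' [e [r0 r'0 e0 rc loc]]]] := local_robust cM sf imf f_inj k0 ac cp0 ak.
have C2ff K : C2_close c K e f f.
  move=> p _ y; rewrite (_ : (fun z => _) = cst 0); last by apply/funext => z; rewrite subrr.
  split=> [|u _|u v _ _]; first by rewrite subrr normr0.
    by rewrite derive_cst normr0.
  rewrite (_ : 'D_v (cst 0) = cst 0); first by rewrite derive_cst normr0.
  by apply/funext => z; rewrite derive_cst.
have ff q : `|(f q : 'rV[R]_N) - f q| < e by rewrite subrr normr0.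
have {}loc := loc f sf ff (C2ff _).
pose y0 := chart_coord c p0; pose F := f \o chart_param c.
pose U := chart_codom c `&` [set y : 'rV[R]_n | `|y - y0| < r'].
have [y0c _] := chart_coordP cp0.
have oc := @open_chart_codom _ _ _ c.
have oU : open U by apply: openI; [exact: oc|exact: open_norm_ball].
have Uy0 : U y0 by split=> //=; rewrite subrr normr0.
have [s s0 sU] := ex_disc c oU Uy0.
pose nu y := normal_part a0 (jac F y).
have locU y : U y -> \det (gram (jac F y)) != 0 /\ forall q,
    k / 2 * dotv (F y - f q) (F y - f q) <= dotv (nu y) (F y - f q).
  move=> [yc yr']; have [cp yE] := chart_paramP yc.
  by have := loc (chart_param c y) cp; rewrite yE; apply.
have snu : smooth_on U nu.
  move=> m; apply: Ck_on_normal_part => // [i j|y /locU[]//].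
  apply: (@Ck_on_ext _ _ _ _ _ (fun y => 'D_(delta_mx 0 i) F y 0 j)) => //.
    by move=> y _; rewrite [RHS]mxE.
  apply: Ck_on_entry => //; apply: (@Ck_on_subset _ _ _ _ (chart_codom c)); first by move=> y [].
  by have [_ DF] := sf ac m.+1; exact: DF.
pose bb p := if `[< chart_dom c p >] then bump y0 s (chart_coord c p) else 0.
exists (extend_by_zero c y0 s nu), (fun p => k / 2 * bb p), (disc_nbhs c y0 s); split.
- by apply: (smooth_extend_by_zero s0 ac oU) => // y [].
- exact: open_disc_nbhs.
- exact: disc_nbhs_center.
- move=> p; rewrite /bb; case: asboolP => [cp|ncp]; last first.
    by rewrite mulr0; split=> // -[].
  split=> [|[_ ps]]; first by rewrite mulr_ge0 ?bump_ge0 // divr_ge0 // ltW.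
  by rewrite mulr_gt0 ?bump_gt0 // divr_gt0.
- move=> p q; rewrite /extend_by_zero /bb; case: asboolP => [cp|ncp]; last first.
    by rewrite mulr0 mul0r dotv0l.
  rewrite dotvZl mulrAC mulrC; set y := chart_coord c p.
  have [yd|yd] := pselect (disc y0 s y); last by rewrite bump_eq0 // !mul0r.
  apply: ler_wpM2l; first exact: bump_ge0.
  have [_ /(_ q)] := locU y (sU y yd).
  by rewrite /F /= (chart_coordP cp).2.
Qed.

(** For a fixed p the pairs (a, b) satisfying the inequality form a convex cone, so the local fields
    are simply added. *)
Lemma normal_field : exists (a : M -> 'rV[R]_N) (b : M -> R),
  [/\ smooth_charts a, forall p, 0 < b p &
   forall p q, b p * dotv (f p - f q) (f p - f q) <= dotv (a p) (f p - f q)].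
Proof.
have /choice[a /choice[b /choice[A abA]]] := local_normal_field.
have [m [pt cov]] := compact_finite_cover cM (fun p => let: And5 _ oA _ _ _ := abA p in oA)
  (fun p => let: And5 _ _ Ap _ _ := abA p in Ap).
exists (fun p => \sum_i a (pt i) p), (fun p => \sum_i b (pt i) p); split.
- move=> c ac k; have oc := @open_chart_codom _ _ _ c; apply: Ck_on_row => // l.
  rewrite (_ : (fun y => _) = fun y => \sum_i a (pt i) (chart_param c y) 0 l); last first.
    by apply/funext => y; rewrite /= summxE.
  apply: Ck_on_bigsum => // i; have [sa _ _ _ _] := abA (pt i).
  exact: (Ck_on_entry l oc (sa c ac k)).
- move=> p; have [i Aip] := cov p.
  have [_ _ _ /(_ p)[_ /(_ Aip) bi] _] := abA (pt i).
  rewrite (bigD1 i) //= ltr_wpDr //; apply: sumr_ge0 => j _.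
  by have [_ _ _ /(_ p)[]] := abA (pt j).
- move=> p q; rewrite dotv_suml mulr_suml; apply: ler_sum => i _.
  by have [_ _ _ _] := abA (pt i); exact.
Qed.
End Gauss.

Section Forward.
Context {R : realType} {n N : nat} {M : manifold R n}.

(** On a chart domain with one point the identity of the open set of coordinates is constant, so its
    derivative w is 0. *)
Lemma subsingleton_chart (c : chart R n M) y w : (forall p q : M, p = q) ->
  chart_codom c y -> w = 0 :> 'rV[R]_n.
Proof.
move=> sub yc; have oc := @open_chart_codom _ _ _ c.
rewrite -(derive_id y w) (near_derive_eq w oc yc (g := cst y)) ?derive_cst //.
move=> z zc; rewrite -(chart_paramP zc).2 (sub (chart_param c z) (chart_param c y)).
by rewrite (chart_paramP yc).2.
Qed.

Lemma stably_neighborly1_sphere (f : M -> euclidean R N) : compact [set: M] ->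
  stably_neighborly1 f -> exists F : M -> sphere R N, smooth_embedding F.
Proof.
move=> cM stf; have [nf _] := stf; have [ef _] := nf.
have [sf imf f_inj] := (smooth_embedding_euclideanP f cM).1 ef.
have [ex2|sub] := pselect (exists p q : M, p != q).
  have [a [b [sa b0 ab]]] := normal_field cM sf imf f_inj (quadratic_support cM stf).
  exact: monotone_field_embedding cM f a b sf imf f_inj sa b0 ab ex2.
have {}sub (p q : M) : p = q.
  by apply/eqP; rewrite -[_ == _]negbK; apply/negP => pq; apply: sub; exists p, q.
(* With at most one point any nonzero vectors form a smooth field. Their existence comes from the
   supporting hyperplane, which excludes a point in R^0. *)
have /choice[a a0] : forall p : M, exists a : 'rV[R]_N, a != 0.
  by move=> p; have [a a0 _] := neighborly1_support nf p; exists a.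
apply: (@ray_embedding R n M cM _ a) => //.
  move=> c ac k; apply: Ck_on_local => y yc; exists (chart_codom c) => //.
  apply: (@Ck_on_ext _ _ _ _ _ (fun=> a (chart_param c y))); last exact: smooth_cst.
    exact: (@open_chart_codom _ _ _ c).
  by move=> z _ /=; congr a; exact: sub.
move=> p; have [c ac cp] := atlas_cover p; exists c; split=> // w _ _.
exact: subsingleton_chart (chart_coordP cp).1.
Qed.
End Forward.

Lemma C2_close_le (R : realType) n (M : manifold R n) N (c : chart R n M) K (e e' : R)
    (f g : M -> euclidean R N) : e <= e' -> C2_close c K e f g -> C2_close c K e' f g.
Proof.
move=> ee C h p Kp y; have [H0 H1 H2] := C p Kp; split=> [|u u1|u v u1 v1].
- exact: lt_le_trans H0 ee.
- exact: lt_le_trans (H1 u u1) ee.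
- exact: lt_le_trans (H2 u v u1 v1) ee.
Qed.

(** * From spheres to stably neighborly embeddings *)

Section Backward.
Context {R : realType} {n N : nat} {M : manifold R n}.
Hypothesis cM : compact [set: M].
Variable g0 : M -> euclidean R N.
Hypotheses (g01 : forall p, dotv (g0 p) (g0 p) = 1).
Hypotheses (sg0 : smooth_charts g0) (img0 : chart_immersive g0) (g0_inj : injective g0).

Let unit_support p q : 1 / 2 * dotv (g0 p - g0 q) (g0 p - g0 q) = dotv (g0 p) (g0 p - g0 q).
Proof. by rewrite !dotvBr !dotvBl !g01 (dotvC (g0 q)); field. Qed.

Lemma local_stability (p0 : M) : exists (c : chart R n M) (K A : set M) (e : R),
  [/\ [/\ atlas c, compact K & K `<=` chart_dom c], open A, A p0, A `<=` K & 0 < e /\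
    forall g : M -> euclidean R N, smooth_charts g -> (forall q, `|(g0 q : 'rV[R]_N) - g q| < e) ->
    C2_close c K e g0 g -> forall p, A p -> exists a : 'rV[R]_N, forall q,
      1 / 4 * dotv (g p - g q) (g p - g q) <= dotv a (g p - g q)].
Proof.
have [c ac cp0] := atlas_cover p0.
have k0 : 0 < 1 / 2 :> R by rewrite divr_gt0.
have supp q : 1 / 2 * dotv (g0 p0 - g0 q) (g0 p0 - g0 q) <= dotv (g0 p0) (g0 p0 - g0 q).
  by rewrite unit_support.
have [r [r' [e [r0 r'0 e0 rc loc]]]] := local_robust cM sg0 img0 g0_inj k0 ac cp0 supp.
(* Radius [r'] lets the base point vary in [A], and radius [r] keeps [A] inside the compact set
   where C^2-closeness is imposed. *)
pose y0 := chart_coord c p0; pose d := Order.min r r'.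
exists c, (chart_param c @` [set y | `|y - y0| <= r]).
exists (chart_dom c `&` chart_coord c @^-1` [set y | `|y - y0| < d]), e; split.
- split=> //; last by move=> _ [y yr <-]; have [] := chart_paramP (rc y yr).
  apply: continuous_compact; last exact: compact_norm_ball.
  apply: continuous_in_subspaceT => y /set_mem yr.
  by apply: chart_param_continuous; exact: rc.
- apply: open_preimage_on; [exact: open_chart_dom|exact: chart_coord_continuous|].
  exact: open_norm_ball.
- by split=> //=; rewrite subrr normr0 lt_min r0.
- move=> p [cp]; rewrite /= lt_min => /andP[pr _]; exists (chart_coord c p).
    exact: ltW.
  by have [] := chart_coordP cp.
split=> // g sg gg C2 p [cp]; rewrite /= lt_min => /andP[_ pr'].
have [_ H] := loc g sg gg C2 p cp pr'.
exists (normal_part (g0 p0) (jac (g \o chart_param c) (chart_coord c p))) => q.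
by apply: le_trans (H q); rewrite (_ : 1 / 2 / 2 = 1 / 4) //; field.
Qed.

Lemma sphere_stably_neighborly1 : stably_neighborly1 g0.
Proof.
have a0 p : g0 p != 0 by rewrite -dotv_gt0 g01.
have posd (g : M -> euclidean R N) p q : injective g -> q != p -> 0 < dotv (g p - g q) (g p - g q).
  by move=> g_inj qp; rewrite dotv_gt0 subr_eq0; apply: contra_neq qp => /g_inj.
split.
  apply: support_neighborly1; first exact/smooth_embedding_euclideanP.
  move=> p; exists (g0 p) => // q qp; rewrite -subr_gt0 -dotvBr -unit_support.
  by rewrite mulr_gt0 ?divr_gt0 // posd.
have /choice[c /choice[K /choice[A /choice[e H]]]] := local_stability.
have [m [pt cov]] := compact_finite_cover cM (fun p => let: And5 _ oA _ _ _ := H p in oA)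
  (fun p => let: And5 _ _ Ap _ _ := H p in Ap).
pose d := \big[Order.min/1]_i e (pt i).
have d0 : 0 < d.
  rewrite /d; elim/big_ind : _ => // [x y x0 y0|i _]; first by rewrite lt_min x0.
  by have [_ _ _ _ []] := H (pt i).
have de i : d <= e (pt i) by rewrite /d (bigD1 i) //= ge_min lexx.
exists m, (c \o pt), (K \o pt), d; split=> [//|i|g /smooth_map_euclideanP sg C2 eg].
  by have [] := H (pt i).
have g_inj : injective g by have [] := (smooth_embedding_euclideanP g cM).1 eg.
(* The compact sets cover the manifold, so local C^2-closeness implies global uniform closeness. *)
have close q : `|(g0 q : 'rV[R]_N) - g q| < d.
  have [i iq] := cov q; have [[_ _ Kc] _ _ AK _] := H (pt i).
  have [] := C2 i q (AK _ iq); rewrite /comp.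
  by rewrite (chart_coordP (Kc _ (AK _ iq))).2.
apply: support_neighborly1 => // p; have [i ip] := cov p.
have [_ _ _ _ [_ /(_ g sg)]] := H (pt i).
have ge q : `|(g0 q : 'rV[R]_N) - g q| < e (pt i) by exact: lt_le_trans (close q) (de i).
move/(_ ge (C2_close_le (de i) (C2 i)) p ip) => [a ap].
have lt q : q != p -> dotv a (g q) < dotv a (g p).
  move=> qp; rewrite -subr_gt0 -dotvBr; apply: lt_le_trans (ap q).
  by rewrite mulr_gt0 ?divr_gt0 // posd.
(* A strict inequality at a second point forces [a] to be nonzero; with one point the inequality is
   void and [g0 p] is used instead. *)
have [[q0 qp]|triv] := pselect (exists q, q != p); last first.
  by exists (g0 p) => // q qp; case: triv; exists q.
exists a => //; have := lt q0 qp.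
by apply: contraTneq => ->; rewrite !dotv0l ltxx.
Qed.
End Backward.

Section Delta1.
Context {R : realType} {n : nat} (M : manifold R n).
Hypothesis cM : compact [set: M].

(** Padding with zeros: minimality provides an embedding in dimension [Delta1 M] only, whereas
    larger N are allowed. *)
Lemma sphere_embedding_widen D N : (D <= N)%N ->
  (exists f : M -> sphere R D, smooth_embedding f) ->
  exists f : M -> sphere R N, smooth_embedding f.
Proof.
move=> /subnKC <-; move: (N - D)%N => k [f /sphere_extension].
set g := fun p => _ => /= -[g1 sg img g_inj].
pose h p := row_mx (g p) (0 : 'rV[R]_k).
have hl p j : h p 0 (lshift k j) = g p 0 j by rewrite row_mxEl.
have hr p j : h p 0 (rshift D j) = 0 by rewrite row_mxEr mxE.
have sh : smooth_charts h.
  apply: smooth_charts_rows => a; case: (splitP a) => j aj.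
    by exists D, g, j; split=> // p; rewrite -hl; congr (h p 0 _); exact: val_inj.
  exists 1%N, (fun=> 0), 0; split=> [c ac m|p]; first exact: smooth_cst.
  by rewrite [RHS]mxE -(hr p j); congr (h p 0 _); exact: val_inj.
apply: (sphere_corestriction cM (g := h)) => //.
- move=> p; rewrite -(g1 p) /dotv big_split_ord /= [X in _ + X]big1 ?addr0.
    by apply: eq_bigr => j _; rewrite hl.
  by move=> j _; rewrite hr mul0r.
- move=> c y w ac yc dw; apply: (img c y w ac yc).
  have dh := smooth_charts_differentiable sh ac yc.
  have dg := smooth_charts_differentiable sg ac yc.
  apply/rowP => j; rewrite [RHS]mxE derive_entry //.
  have := congr1 (fun v : 'rV[R]_(D + k) => v 0 (lshift k j)) dw.
  rewrite /= derive_entry // [in RHS]mxE => <-; congr ('D_w _ y).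
  by apply/funext => z; rewrite /= hl.
- by move=> p q pq; apply: g_inj; apply/rowP => j; rewrite -!hl pq.
Qed.

Lemma sphere_neighborly_dims N (f : M -> sphere R N) : smooth_embedding f -> neighborly_dims M N.
Proof.
move=> /sphere_extension[g1 sg img g_inj].
by exists (fun p => val (f p)); exact: sphere_stably_neighborly1.
Qed.

Lemma Delta1P : neighborly_dims M (Delta1 M) /\
  forall N, neighborly_dims M N -> (Delta1 M <= N)%N.
Proof.
have [N0 [f ef]] := whitney_sphere cM.
have exN : exists N, `[< neighborly_dims M N >].
  by exists N0; apply/asboolP; exact: sphere_neighborly_dims ef.
apply: (@xgetPex _ _ [set N | neighborly_dims M N /\
  forall N', neighborly_dims M N' -> (N <= N')%N]).
case: (ex_minnP exN) => N /asboolP dN minN; exists N; split=> // N' dN'.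
by apply: minN; apply/asboolP.
Qed.

Theorem Delta1_le_sphere N :
  (Delta1 M <= N)%N <-> exists f : M -> sphere R N, smooth_embedding f.
Proof.
have [[f stf] minD] := Delta1P; split=> [DN|[F /sphere_neighborly_dims/minD//]].
exact: sphere_embedding_widen DN (stably_neighborly1_sphere cM stf).
Qed.
End Delta1.

(** * Projective spaces in spheres *)

Section SquareMap.
Context {R : realType} {k : nat}.
Implicit Types x y : 'rV[R]_k.+1.

Definition square_coefs x : 'rV[R]_k.*2.+1 := poly_rV (rVpoly x ^+ 2).

Lemma square_coefsK x : rVpoly (square_coefs x) = rVpoly x ^+ 2.
Proof.
rewrite poly_rV_K //; apply: leq_trans (size_poly_exp_leq _ _) _.
rewrite muln2 ltnS leq_double.
by have : (size (rVpoly x) <= k.+1)%N := size_poly _ _; case: (size _).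
Qed.

Lemma square_coefsZ c x : square_coefs (c *: x) = c ^+ 2 *: square_coefs x.
Proof. by rewrite /square_coefs linearZ exprZn linearZ. Qed.

Lemma square_coefs_eq0 x : (square_coefs x == 0) = (x == 0).
Proof.
apply/eqP/eqP => [x0|->]; last by rewrite /square_coefs linear0 expr0n linear0.
have /eqP := square_coefsK x; rewrite x0 linear0 eq_sym sqrf_eq0 => /eqP px.
by rewrite -[x]rVpolyK px linear0.
Qed.

(** Polynomials over R form an integral domain, so P^2 = s Q^2 forces P to be plus or minus sqrt(s)
    Q. *)
Lemma square_coefs_line x y s : 0 < s -> y != 0 -> square_coefs x = s *: square_coefs y ->
  exists2 c : R, c != 0 & x = c *: y.
Proof.
move=> s0 y0 xy; have t0 : Num.sqrt s != 0 by rewrite gt_eqF // sqrtr_gt0.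
have : rVpoly x ^+ 2 == rVpoly (Num.sqrt s *: y) ^+ 2.
  by rewrite -!square_coefsK xy square_coefsZ sqr_sqrtr // ltW.
rewrite eqf_sqr => /orP[] /eqP pE; [exists (Num.sqrt s)|exists (- Num.sqrt s)] => //.
- by rewrite -[LHS]rVpolyK pE rVpolyK.
- by rewrite oppr_eq0.
- by rewrite scaleNr -[LHS]rVpolyK pE -linearN rVpolyK.
Qed.

(** The convolution is put in the form of a dot product so that smoothness and the product rule for
    [dotv] apply. *)
Lemma square_coefsE x (m : 'I_k.*2.+1) : square_coefs x 0 m =
  dotv (\row_(j < m.+1) (rVpoly x)`_j) (\row_(j < m.+1) (rVpoly x)`_(m - j)).
Proof. by rewrite mxE expr2 coefM; apply: eq_bigr => j _; rewrite !mxE. Qed.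

Variable V : normedModType R.
Implicit Types (a : V -> 'rV[R]_k.+1) (U : set V).

Lemma Ck_on_coef m U a l : open U -> Ck_on m U a -> Ck_on m U (fun z => (rVpoly (a z))`_l : R).
Proof.
move=> oU Ca; under eq_fun do rewrite coef_rVpoly.
by case: (insub l) => [j|]; [exact: Ck_on_entry|exact: smooth_cst].
Qed.

Lemma derive_coef a z w l : differentiable a z ->
  'D_w (fun z => (rVpoly (a z))`_l : R) z = (rVpoly ('D_w a z))`_l.
Proof.
move=> da; under eq_fun do rewrite coef_rVpoly; rewrite coef_rVpoly.
by case: (insub l) => [j|]; [rewrite derive_entry|rewrite derive_cst].
Qed.

Lemma Ck_on_square_coefs m U a : open U -> Ck_on m U a ->
  Ck_on m U (fun z => square_coefs (a z)).
Proof.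
move=> oU Ca; apply: Ck_on_row => // l; under eq_fun do rewrite square_coefsE.
by apply: Ck_on_dotv => //; apply: Ck_on_row => // j; under eq_fun do rewrite mxE; exact: Ck_on_coef.
Qed.

Lemma derive_square_coefs U a z w : open U -> U z -> Ck_on 1 U a ->
  'D_w (fun z => square_coefs (a z)) z = poly_rV (rVpoly (a z) * rVpoly ('D_w a z) *+ 2).
Proof.
move=> oU Uz Ca; have dS := (Ck_on_square_coefs oU Ca).1 z Uz.
have da := Ca.1 z Uz; apply/rowP => l; rewrite derive_entry // [RHS]mxE.
rewrite (_ : (fun _ => _) = fun z => dotv (\row_(j < l.+1) (rVpoly (a z))`_(id j))
    (\row_(j < l.+1) (rVpoly (a z))`_(l - j))); last by apply/funext => u; exact: square_coefsE.
have CP (h : nat -> nat) : Ck_on 1 U (fun z => \row_(j < l.+1) (rVpoly (a z))`_(h j) : 'rV[R]_l.+1).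
  by apply: Ck_on_row => // j; under eq_fun do rewrite mxE; exact: Ck_on_coef.
have DP (h : nat -> nat) : 'D_w (fun z => \row_(j < l.+1) (rVpoly (a z))`_(h j) : 'rV[R]_l.+1) z =
    \row_(j < l.+1) (rVpoly ('D_w a z))`_(h j).
  apply/rowP => j; rewrite derive_entry; last exact: (CP h).1.
  rewrite [RHS]mxE -derive_coef //; congr ('D_w _ z).
  by apply/funext => u; rewrite mxE.
rewrite (derive_dotv w ((CP id).1 z Uz) ((CP (subn l)).1 z Uz)) (DP id) (DP (subn l)).
rewrite mulr2n coefD {1}mulrC !coefM; congr (_ + _); apply: eq_bigr => j _; by rewrite !mxE.
Qed.
End SquareMap.

Section ProjectiveUpper.
Context {R : realType} {k : nat}.

Lemma vector_of_neq0 (p : projective R k) : val (vector_of p) != 0.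
Proof. by have /set_mem := valP (vector_of p). Qed.

Lemma projective_compact : compact [set: projective R k].
Proof.
have [e0 e00] : exists e0 : 'rV[R]_k.+1, e0 \in @nonzero_vector R k.
  by exists (affine_point ord0 0); exact: affine_point_neq0.
pose nz (x : 'rV[R]_k.+1) : @nonzero_vector R k := insubd (SigSub e00) x.
have nzE x : x != 0 -> val (nz x) = x by move=> x0; rewrite /nz insubdK // nonzero_mem.
pose S := [set x : 'rV[R]_k.+1 | `|x| = 1].
have S0 x : S x -> x != 0 by move=> x1; rewrite -normr_eq0 x1 oner_eq0.
rewrite (_ : [set: _] = (fun x => line_of (nz x)) @` S); last first.
  apply/seteqP; split=> // p _; set v := vector_of p.
  have v0 := vector_of_neq0 p; have nv0 : `|val v|^-1 != 0 by rewrite invr_eq0 normr_eq0.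
  have u1 : S (`|val v|^-1 *: val v) by rewrite /S /= normrZ normfV normr_id mulVf // normr_eq0.
  exists (`|val v|^-1 *: val v) => //; rewrite -[RHS]vector_ofK.
  by apply: (line_of_scale nv0); rewrite nzE //; exact: S0.
apply: continuous_compact; last exact: compact_norm_sphere.
apply: continuous_in_subspaceT => x /set_mem /S0 x0.
apply: (@continuous_comp _ _ _ nz (@line_of R k)); last exact: pi_continuous.
apply: continuous_set_type.
have /near_eq_cvg : {near x, id =1 val \o nz}.
  have : open [set y : 'rV[R]_k.+1 | y != 0].
    rewrite (_ : [set y | _] = Num.norm @^-1` [set t : R | t != 0]); last first.
      by apply/seteqP; split=> y; rewrite /= normr_eq0.
    by apply: open_comp; [move=> z _; exact: norm_continuous|exact: open_neq].
  by move=> o; apply: filterS (open_nbhs_nbhs (conj o x0)) => y /= /nzE.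
by move=> /(_ _) H; rewrite /prop_for /continuous_at /= nzE //; exact: cvg_trans H (cvg_id _).
Qed.

(** Dividing by |x|^2 makes the quadratic map homogeneous of degree 0, hence a function of the
    line. *)
Definition square_map (x : 'rV[R]_k.+1) : 'rV[R]_k.*2.+1 :=
  (dotv x x)^-1 *: square_coefs x.

Lemma square_mapZ c x : c != 0 -> square_map (c *: x) = square_map x.
Proof.
move=> c0; rewrite /square_map dotvZ square_coefsZ scalerA invfM mulrAC mulVf ?expf_neq0 //.
by rewrite mul1r.
Qed.

Lemma square_map_neq0 x : x != 0 -> square_map x != 0.
Proof. by move=> x0; rewrite scaler_eq0 invr_eq0 dotv_eq0 square_coefs_eq0 orbb. Qed.

Let G (p : projective_space R k) := square_map (val (vector_of p)).

Let G_param i y : (G \o chart_param (affine_chart R i)) y = square_map (affine_point i y).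
Proof.
rewrite /G /=; have [] := @line_ofP R k (vector_of (affine_param i y))
  (SigSub (affine_point_neq0 i y)); first exact: vector_ofK.
by move=> c c0 /= ->; rewrite square_mapZ.
Qed.

Let affine_neq0 i y : affine_point i y != 0 :> 'rV[R]_k.+1.
Proof. by have /set_mem := affine_point_neq0 (R := R) i y. Qed.

Let Ck_affine m i : Ck_on m setT (@affine_point R k i).
Proof. by apply: Ck_on_row => [|j]; [exact: openT|exact: smooth_affine_point]. Qed.

(** Immersivity is checked on polynomials: if D (A^2) = 2 A W is a multiple b A^2, cancelling A
    gives 2 W = b A. In the affine chart [i] the [i]-th coefficient of A is 1 and that of W is 0, so
    b = 0 and W = 0. *)
Lemma projective_sphere : exists f : projective_space R k -> sphere R k.*2.+1, smooth_embedding f.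
Proof.
have oT : open [set: 'rV[R]_k] by exact: openT.
have sG : smooth_charts G.
  move=> _ [i _ <-] m; apply: (Ck_on_ext (f := fun y => square_map (affine_point i y)) oT).
    by move=> y _; rewrite G_param.
  apply: Ck_on_scale => //; last exact: Ck_on_square_coefs.
  apply: Ck_onV => //; last exact: Ck_on_dotv.
  by move=> y _; rewrite dotv_eq0.
apply: (@ray_embedding R k (projective_space R k) projective_compact _ G sG).
- by move=> p; apply: square_map_neq0; exact: vector_of_neq0.
- move=> p q s s0; rewrite /G /square_map.
  set x := val (vector_of p); set y := val (vector_of q) => /= E.
  have x0 : x != 0 := vector_of_neq0 p; have y0 : y != 0 := vector_of_neq0 q.
  have dx : 0 < dotv x x by rewrite dotv_gt0.
  have dy : 0 < dotv y y by rewrite dotv_gt0.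
  have [||c c0 xy] := @square_coefs_line R k x y (dotv x x * (s * (dotv y y)^-1)) _ y0.
  + by rewrite !mulr_gt0 // invr_gt0.
  + have := congr1 (fun v => dotv x x *: v) E.
    by rewrite /= !scalerA divff ?gt_eqF // scale1r !mulrA.
  by rewrite -[LHS]vector_ofK -[RHS]vector_ofK; exact: line_of_scale c0 xy.
move=> p; have [_ [i _ <-] cp] := atlas_cover p.
exists (affine_chart R i); split=> // [|w al]; first by exists i.
set y := chart_coord _ p => dG; pose A : 'rV[R]_k.+1 := affine_point i y.
pose W : 'rV[R]_k.+1 := 'D_w (affine_point i) y.
have dA : differentiable (affine_point i) y := (Ck_affine 1 i).1 y I.
have Wi : W 0 i = 0.
  rewrite derive_entry // (_ : (fun z => _) = cst 1) ?derive_cst //.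
  by apply/funext => z; rewrite mxE unlift_none.
have Wl l : W 0 (lift i l) = w 0 l.
  rewrite derive_entry // (_ : (fun z => _) = fun z : 'rV[R]_k => z 0 l).
    by rewrite -(@derive_entry R _ _ id) // derive_id.
  by apply/funext => z; rewrite mxE liftK.
suff W0 : W = 0 by apply/rowP => l; rewrite -Wl W0 !mxE.
pose d z := dotv (affine_point i z) (affine_point i z : 'rV[R]_k.+1).
have Cd : Ck_on 1 setT d := Ck_on_dotv oT (Ck_affine 1 i) (Ck_affine 1 i).
have d0 z : d z != 0 by rewrite dotv_eq0.
pose g := G \o chart_param (affine_chart R i).
have gE z : g z = (d z)^-1 *: square_coefs (affine_point i z) by rewrite /g G_param.
have dg : differentiable g y by apply: (smooth_charts_differentiable sG); [exists i|].
have Gp : G p = (d y)^-1 *: square_coefs A.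
  by rewrite -gE /g /comp (chart_coordP cp).2.
have DS : 'D_w (fun z => square_coefs (affine_point i z)) y =
    ('D_w d y * (d y)^-1 + al) *: square_coefs A.
  apply/rowP => l; rewrite derive_entry; last first.
    by have [+ _] := Ck_on_square_coefs oT (Ck_affine 1 i); exact.
  (* The unnormalized square is d g, so the product rule turns the radial derivative of [g] into a
     radial derivative of the square. *)
  rewrite (_ : (fun z => _) = d * (fun z => g z 0 l : R)); last first.
    by apply/funext => z; rewrite -[RHS]/(d z * g z 0 l) gE [in RHS]mxE mulVKf.
  rewrite (deriveM (diff_derivable (Cd.1 y I)) (diff_derivable (differentiable_entry l dg))).
  rewrite -derive_entry // dG gE Gp !mxE /GRing.scale /=.
  by move: ('D_w d y) => D; field.
rewrite (derive_square_coefs w oT (I : setT y) (Ck_affine 1 i)) -/A -/W in DS.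
set b := (_ + al) in DS.
have AWE : rVpoly A * (rVpoly W *+ 2) = rVpoly A * (b *: rVpoly A).
  rewrite mulrnAr -scalerAr -expr2 -square_coefsK -linearZ /= -DS poly_rV_K //.
  rewrite -scaler_nat; apply: leq_trans (size_scale_leq _ _) _.
  apply: leq_trans (size_polyMleq _ _) _.
  have sA : (size (rVpoly A) <= k.+1)%N := size_poly _ _.
  have sW : (size (rVpoly W) <= k.+1)%N := size_poly _ _.
  have : (size (rVpoly A) + size (rVpoly W) <= k.*2.+2)%N by rewrite -addnn -addnS -addSn leq_add.
  by case: (_ + _)%N.
have {}AWE : W *+ 2 = b *: A.
  rewrite -[LHS]rVpolyK -[RHS]rVpolyK; congr poly_rV; rewrite linearMn linearZ /=.
  apply: (mulfI _ AWE); apply/eqP => A0; have := affine_neq0 i y.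
  by rewrite -/A -[A]rVpolyK A0 linear0 eqxx.
have b0 : b = 0.
  have := congr1 (fun v : 'rV[R]_k.+1 => v 0 i) AWE.
  by rewrite mulmxnE Wi mul0rn [RHS]mxE [A 0 i]mxE unlift_none mulr1.
by apply/eqP; move/eqP: AWE; rewrite b0 scale0r -scaler_nat scaler_eq0 pnatr_eq0.
Qed.
End ProjectiveUpper.

Theorem proposition1 (R : realType) :
  (forall (n : nat) (M : manifold R n), closed_manifold M ->
     forall N : nat,
       (Delta1 M <= N)%N <->
       exists f : M -> sphere R N, smooth_embedding f) /\
  (forall j k : nat, (0 < j)%N -> k = (2 ^ j)%N ->
     Delta1 (projective_space R k) = (2 * k + 1)%N).
Proof.
split=> [n M cM N|j k j0 kE]; first exact: Delta1_le_sphere.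
(* The hypothesis j > 0 excludes RP^1, a circle, which embeds in S^1 and would violate the
   formula. *)
have k2 : (2 <= k)%N by rewrite kE -{1}(expn1 2) leq_exp2l.
have DP := Delta1_le_sphere (M := projective_space R k) projective_compact.
rewrite addn1 mul2n; apply/eqP; rewrite eqn_leq; apply/andP; split.
  by apply/DP; exact: projective_sphere.
rewrite ltnNge; apply/negP => /DP[f ef].
exact: projective_not_in_sphere k2 (odd_bin_pow2 kE) ef.
Qed.
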